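(* Let $\mathcal{H}_A,\mathcal{H}_B,\mathcal{H}_C$ be finite-dimensional Hilbert spaces and let $|\psi\rangle_{ABC}\in\mathcal{H}_A\otimes\mathcal{H}_B\otimes\mathcal{H}_C$ be a pure (unit vector) state, with $\rho_{AB}=\mathrm{Tr}_C|\psi\rangle\langle\psi|$. Then $|\psi\rangle_{ABC}$ is a sum of triangle states (SOTS) if and only if $h(A:B)=0$.
   Context: All Hilbert spaces are finite-dimensional complex Hilbert spaces. For a state on several parties and a subset $X$ of the parties, $S_X=-\mathrm{Tr}(\rho_X\log\rho_X)$ is the von Neumann entropy of the reduced density matrix on $X$. The mutual information is $I(A:B)=S_A+S_B-S_{AB}$, evaluated on $\rho_{AB}$. Canonical purification and reflected entropy: let $\sqrt{\rho_{AB}}$ be the unique non-negative square root of $\rho_{AB}$. Regarding this operator on $\mathcal{H}_A\otimes\mathcal{H}_B$ as a vector gives the canonical purification $|\sqrt{\rho_{AB}}\rangle\in\mathcal{H}_A\otimes\mathcal{H}_B\otimes\mathcal{H}_A^*\otimes\mathcal{H}_B^*$ (a unit vector whose reduced density matrix on $AB$ is $\rho_{AB}$). The reflected entropy is $S_R(A:B)=S_{AA^*}(|\sqrt{\rho_{AB}}\rangle)$, the entropy of the reduced density matrix on $\mathcal{H}_A\otimes\mathcal{H}_A^*$. Define $h(A:B)=S_R(A:B)-I(A:B)$, which is always $\ge 0$. Sum of triangle states (SOTS): a pure state $|\psi\rangle_{ABC}$ is a SOTS if there is a finite index set $J$ and, for each $\alpha\in\{A,B,C\}$, an orthogonal decomposition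 $\mathcal{H}_\alpha=\mathcal{H}_\alpha^0\oplus\bigoplus_{j\in J}\mathcal{H}_{\alpha_L^j}\otimes\mathcal{H}_{\alpha_R^j}$ (where $\mathcal{H}_\alpha^0$ may be zero-dimensional), such that $$|\psi\rangle_{ABC}=\sum_{j\in J}\sqrt{p_j}\,|\psi_j\rangle_{A_R^jB_L^j}\,|\psi_j\rangle_{B_R^jC_L^j}\,|\psi_j\rangle_{C_R^jA_L^j},$$ where each $|\psi_j\rangle_{\alpha_R^j\beta_L^j}$ is a pure (unit vector) state in $\mathcal{H}_{\alpha_R^j}\otimes\mathcal{H}_{\beta_L^j}$, $p_j\ge 0$ and $\sum_jp_j=1$. *)

(* Defs.v *)
From mathcomp Require Import all_boot all_order all_algebra.
From mathcomp Require Import complex mxtens spectral.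
From mathcomp Require Import reals exp.

Set Implicit Arguments.
Unset Strict Implicit.
Unset Printing Implicit Defensive.

Import Order.TTheory GRing.Theory Num.Theory.
Local Open Scope ring_scope.
Local Open Scope complex_scope.
Local Open Scope sesquilinear_scope.

(* Conventions.  A finite-dimensional Hilbert space is C^n in an orthonormal
   basis, C = R[i]; its vectors are columns.  C^m (x) C^n is C^(m * n), with
   e_i (x) e_j the basis vector of index [mxtens_index (i, j)].  The dual
   space (C^n)^* is C^n in the dual basis <i|. *)

Section States.
Variable R : realType.
Local Notation C := R[i].

Definition unit_vector n (v : 'cV[C]_n) : Prop :=
  \sum_i `|v i 0| ^+ 2 = 1.

Definition projector n (v : 'cV[C]_n) : 'M[C]_n := v *m v^t*.

Definition ptrace1 m n (M : 'M[C]_(m * n)) : 'M[C]_n :=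
  \matrix_(j, j') \sum_i M (mxtens_index (i, j)) (mxtens_index (i, j')).

Definition ptrace2 m n (M : 'M[C]_(m * n)) : 'M[C]_m :=
  \matrix_(i, i') \sum_j M (mxtens_index (i, j)) (mxtens_index (i', j)).

(* f(M) by functional calculus, meaningful for Hermitian M, whose
   eigenvalues [spectral_diag M] are real. *)
Definition hermfun (f : R -> R) n (M : 'M[C]_n) : 'M[C]_n :=
  invmx (spectralmx M)
    *m diag_mx (map_mx (fun z : C => (f (complex.Re z))%:C) (spectral_diag M))
    *m spectralmx M.

Definition sqrtmx n (M : 'M[C]_n) : 'M[C]_n := hermfun Num.sqrt M.

(* As ln 0 = 0, [rho *m logmx rho] vanishes on the kernel of rho, which is
   the convention 0 log 0 = 0. *)
Definition logmx n (M : 'M[C]_n) : 'M[C]_n := hermfun (@ln R) M.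

(* The trace is real for Hermitian rho; [complex.Re] only changes its type. *)
Definition entropy n (rho : 'M[C]_n) : R :=
  - complex.Re (\tr (rho *m logmx rho)).

Definition mutual_information m n (rho : 'M[C]_(m * n)) : R :=
  entropy (ptrace2 rho) + entropy (ptrace1 rho) - entropy rho.

(* The operator \sum_(i, j) M i j |i><j| as the vector of coordinates M i j
   on |i> (x) <j|, in H (x) H^*. *)
Definition vec_of_op n (M : 'M[C]_n) : 'cV[C]_(n * n) :=
  \col_k M (mxtens_unindex k).1 (mxtens_unindex k).2.

(* H1 (x) H2 (x) H3 (x) H4 -> H1 (x) H3 (x) H2 (x) H4 *)
Definition swap_middle n1 n2 n3 n4 (v : 'cV[C]_((n1 * n2) * (n3 * n4))) :
    'cV[C]_((n1 * n3) * (n2 * n4)) :=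
  \col_k let: (u, w) := mxtens_unindex k in
         let: (i1, i3) := mxtens_unindex u in
         let: (i2, i4) := mxtens_unindex w in
         v (mxtens_index (mxtens_index (i1, i2), mxtens_index (i3, i4))) 0.

Definition canonical_purification n (rho : 'M[C]_n) : 'cV[C]_(n * n) :=
  vec_of_op (sqrtmx rho).

(* The swap turns A B A^* B^* into A A^* B B^*, and B B^* is traced out. *)
Definition reflected_entropy m n (rho : 'M[C]_(m * n)) : R :=
  entropy (ptrace2 (projector (swap_middle (canonical_purification rho)))).

Definition markov_gap m n (rho : 'M[C]_(m * n)) : R :=
  reflected_entropy rho - mutual_information rho.

(* An orthogonal decomposition C^n = H^0 (+) \bigoplus_j HL^j (x) HR^j, given
   by the isometric embeddings of its summands. *)
Record bipartite_decomposition (n : nat) (J : finType) := BipartiteDecomposition {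
  dim0 : nat;
  dimL : J -> nat;
  dimR : J -> nat;
  emb0 : 'M[C]_(n, dim0);
  emb : forall j, 'M[C]_(n, dimL j * dimR j);
  emb0_isometry : emb0^t* *m emb0 = 1%:M;
  emb_isometry : forall j, (emb j)^t* *m emb j = 1%:M;
  emb0_orthogonal : forall j, emb0^t* *m emb j = 0;
  emb_orthogonal : forall j k, j != k -> (emb j)^t* *m emb k = 0;
  emb_complete : emb0 *m emb0^t* + \sum_j emb j *m (emb j)^t* = 1%:M
}.

(* |a>_{A_R B_L} |b>_{B_R C_L} |c>_{C_R A_L}, with tensor factors reordered as
   (A_L A_R) (B_L B_R) (C_L C_R). *)
Definition triangle_vector lA rA lB rB lC rC
    (a : 'cV[C]_(rA * lB)) (b : 'cV[C]_(rB * lC)) (c : 'cV[C]_(rC * lA)) :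
    'cV[C]_((lA * rA) * (lB * rB) * (lC * rC)) :=
  \col_k let: (uv, w) := mxtens_unindex k in
         let: (u, v) := mxtens_unindex uv in
         let: (al, ar) := mxtens_unindex u in
         let: (bl, br) := mxtens_unindex v in
         let: (cl, cr) := mxtens_unindex w in
         a (mxtens_index (ar, bl)) 0 * b (mxtens_index (br, cl)) 0
           * c (mxtens_index (cr, al)) 0.

Definition sum_of_triangle_states nA nB nC (psi : 'cV[C]_(nA * nB * nC)) : Prop :=
  exists (J : finType)
    (DA : bipartite_decomposition nA J)
    (DB : bipartite_decomposition nB J)
    (DC : bipartite_decomposition nC J)
    (p : J -> R)
    (a : forall j, 'cV[C]_(dimR DA j * dimL DB j))
    (b : forall j, 'cV[C]_(dimR DB j * dimL DC j))
    (c : forall j, 'cV[C]_(dimR DC j * dimL DA j)),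
  [/\ forall j, 0 <= p j,
      \sum_j p j = 1,
      forall j, [/\ unit_vector (a j), unit_vector (b j) & unit_vector (c j)]
    & psi = \sum_j (Num.sqrt (p j))%:C *:
              (tensmx (tensmx (emb DA j) (emb DB j)) (emb DC j)
                 *m triangle_vector (a j) (b j) (c j))].

End States.

(* Main.v *)
(* Let M = sqrt rho_AB and let Rm be M realigned as an operator from B B^* to A A^*,
   so that S_R(A:B) = S(Rm Rm^* ) and h = S_R + S_AB - S_A - S_B.

   For a SOTS, Schmidt decompositions of the edge vectors diagonalize rho_A, rho_B,
   rho_AB and Rm Rm^*.  Each spectrum consists of products p_j f g with f and g
   the Schmidt weights of two edges, and the logarithms cancel in h.

   Conversely let xi be the canonical purification in A A^* B B^*, and put
   D1 = Rm Rm^* (x) (rho_{B^*})^-1 and D2 = rho_A (x) (rho_{A^*B^*})^-1.  Then h = 0 says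
   <xi, ln D1 xi> = <xi, ln D2 xi>, while D1 <= D2 as quadratic forms on the support
   of D2, so that <xi, (D2 + t)^-1 xi> <= <xi, (D1 + t)^-1 xi> for t > 0.  Integrating
   over t turns the former into equality in the latter, which forces
   (D1 + t)^-1 xi = (D2 + t)^-1 xi for all t > 0, hence f(D1) xi = f(D2) xi for all f.
   For f(x) = x^(-1/2) this gives
   rho(ij, i'j') = sqrt(rho_A)_i sqrt(rho_B)_j' G(ii', jj') in eigenbases of rho_A and
   rho_B, where G is the partial isometry in the polar decomposition of Rm.
   Therefore the columns of M, as a x b matrices divided by sqrt rho_A, are the Kraus
   operators eta_m of a unital map F whose composite with a second unital map F' satisfies
   F F' F = F.  By the equality case of the Kadison-Schwarz inequality, X eta_m = eta_m Y
   for all pairs X = F Y, Y = F' X.  In H_A (+) H_B take a resolution of 1 into minimal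
   projections that commute with all X (+) Y and with rho_A (+) rho_B.  By Schur's lemma
   eta_m is a scalar multiple of a fixed partial isometry between any two of them, and these
   scalars are orthogonal as vectors indexed by m.  The classes of equivalent projections
   are the summands j of the SOTS; the projections of a class inside H_A and H_B index the
   edges CA and BC, and their common range is the edge AB. *)

Require Import Defs.
From mathcomp Require Import all_boot all_order all_algebra.
From mathcomp Require Import complex mxtens spectral.
From mathcomp Require Import boolp classical_sets functions reals topology normedtype derive realfun exp.
From mathcomp Require Import ring lra.

Set Implicit Arguments.
Unset Strict Implicit.
Unset Printing Implicit Defensive.

Import Order.TTheory GRing.Theory Num.Theory.
Import numFieldNormedType.Exports.
Local Open Scope ring_scope.
Local Open Scope sesquilinear_scope.
Local Notation "x %:C" := (real_complex _ x) : ring_scope.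

(** * Resolvents and the equality case for the logarithm *)

Section LogFamilies.
Variable R : realType.

(** Write A', B' for the dual copies. As xi is pure, h is S(AA') + S(A'B') - S(A') - S(AA'B'), the
    conditional mutual information of A and B' given A'. So h = 0 is equality in strong
    subadditivity, and D1, D2 are the relative modular operators that belong to it. The comparison
    D1 <= D2 comes down to Bessel's inequality: the columns of M, normalized by rho_B, form an
    isometry, and the rest is the marginal rho_A. The power -1/2 is the one that removes the
    singular values of Rm on one side and turns M into rho on the other.

    What prevents a direct use of Schur's lemma is that eta_m relates the densities only up to a
    positive factor, rho_A^(1/2) eta_m = dl_m eta_m rho_B^(1/2). Placed off the diagonal of H_A (+)
    H_B, eta_m lies outside the algebra whose minimal projections are taken, so Schur's lemma is
    proved for eigenvectors of the modular automorphism of tau = rho_A^(1/2) (+) rho_B^(1/2). The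
    factors found on the way become weights of the edges BC and CA. Since h depends on rho_AB alone,
    C enters only at the end, by decomposing psi along the eigenvectors of rho_AB. *)

Lemma is_derive_log_sum (I : finType) (w k : I -> R) (t : R) :
  (forall i, 0 < k i + t) ->
  is_derive t (1 : R) (fun s => \sum_i w i * ln (k i + s)) (\sum_i w i / (k i + t)).
Proof.
move=> kt; elim: (index_enum I) => [|i r IH].
  rewrite big_nil; have -> : (fun s : R => \sum_(i <- [::]) w i * ln (k i + s)) = cst 0.
    by apply/funext => s; rewrite big_nil.
  exact: is_derive_cst.
have -> : (fun s : R => \sum_(j <- i :: r) w j * ln (k j + s)) =
   (fun s => w i *: ln (k i + s)) + (fun s => \sum_(j <- r) w j * ln (k j + s)).
  by apply/funext => s; rewrite big_cons.
rewrite big_cons; apply: (is_deriveD _ IH).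
have D : is_derive t (1 : R) (fun s => k i + s) 1.
  have := is_deriveD (is_derive_cst (k i) t (1:R)) (is_derive_id t (1 : R)).
  by rewrite add0r.
have Dl : is_derive (k i + t) 1 (@ln R) (k i + t)^-1 by exact: is_derive1_ln.
have Dc := is_derive1_comp Dl D; rewrite mulr1 in Dc.
exact: is_deriveZ.
Qed.

Variables (P Q : finType).
Variables (x lam : P -> R) (y mu : Q -> R).
Hypotheses (lam0 : forall p, 0 < lam p) (mu0 : forall q, 0 < mu q).
Hypotheses (x0 : forall p, 0 <= x p) (y0 : forall q, 0 <= y q).
Hypothesis xy : \sum_p x p = \sum_q y q.
Hypothesis xyln : \sum_p x p * ln (lam p) = \sum_q y q * ln (mu q).
Hypothesis xyres : forall t : R, 0 < t ->
  \sum_q y q / (mu q + t) <= \sum_p x p / (lam p + t).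

(* [F t = \sum_q y q ln (mu q + t) - \sum_p x p ln (lam p + t)] is nonincreasing, vanishes at 0 and
   tends to 0 at infinity. *)
Lemma log_resolvent_eq (t : R) : 0 < t ->
  \sum_q y q / (mu q + t) = \sum_p x p / (lam p + t).
Proof.
move=> t0.
pose F s := \sum_q y q * ln (mu q + s) - \sum_p x p * ln (lam p + s).
pose F' s := \sum_q y q / (mu q + s) - \sum_p x p / (lam p + s).
have dF (s : R) : 0 <= s -> is_derive s (1 : R) F (F' s).
  move=> s0; apply: is_deriveB; apply: is_derive_log_sum => i.
    by rewrite ltr_wpDr.
  by rewrite ltr_wpDr.
have Fmono (u v : R) : 0 <= u -> u <= v -> F v <= F u.
  move=> u0.
  rewrite le_eqVlt => /predU1P[->//|uv].
  have [||c] := @MVT R F F' u v uv.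
  - by move=> z; rewrite in_itv /= => /andP[uz _]; apply/dF/(le_trans u0)/ltW.
  - apply: continuous_in_subspaceT => z; rewrite inE /= in_itv /= => /andP[uz _].
    apply: differentiable_continuous; apply/derivable1_diffP.
    by have [] := dF z (le_trans u0 uz).
  rewrite in_itv /= => /andP[uc cv] Fuv.
  rewrite -subr_le0 Fuv mulr_le0_ge0 ?subr_ge0 // ?(ltW uv) // /F' subr_le0.
  exact/xyres/(le_lt_trans u0).
have F0 : F 0 = 0.
  rewrite /F; under eq_bigr do rewrite addr0.
  by under [X in _ - X]eq_bigr do rewrite addr0; rewrite xyln subrr.
(* After [ln s] is split off from every logarithm, its coefficients cancel because [x] and [y] have
   the same mass. The bound [ln (1 + u) <= u] on the rest leaves exactly [c / s]. *)
pose c := \sum_p x p * lam p.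
have Fge (s : R) : 0 < s -> - (c / s) <= F s.
  move=> s0.
  have H (I : finType) (w k : I -> R) : (forall i, 0 < k i) ->
      \sum_i w i * ln (k i + s) = (\sum_i w i) * ln s + \sum_i w i * ln (1 + k i / s).
    move=> k0; rewrite mulr_suml -big_split /=; apply: eq_bigr => i _.
    rewrite -mulrDr -lnM ?posrE //; last by rewrite addr_gt0 // divr_gt0.
    by congr (_ * ln _); rewrite mulrDr mulr1 mulrCA divff ?mulr1 ?gt_eqF // addrC.
  rewrite /F !H // xy opprD addrACA subrr add0r -[leLHS]add0r lerD //.
    apply: sumr_ge0 => q _; rewrite mulr_ge0 // ln_ge0 // lerDl.
    by rewrite divr_ge0 // ltW.
  rewrite lerN2 mulr_suml ler_sum // => p _; rewrite -mulrA ler_wpM2l //.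
  by rewrite le_ln1Dx // (@lt_trans _ _ 0) ?divr_gt0 // oppr_lt0.
have c0 : 0 <= c by rewrite sumr_ge0 // => p _; rewrite mulr_ge0 // ltW.
have Fz (s : R) : 0 <= s -> F s = 0.
  move=> s0; apply/le_anti; rewrite -{1}F0 Fmono //=.
  apply/ler_addgt0Pl => e e0.
  (* Beyond this point [c / s] is at most [e], and monotonicity carries the lower bound for [F] back
     to [s]. *)
  have m0 : 0 < Num.max (s + 1) ((c + 1) / e) by rewrite lt_max ltr_wpDl.
  rewrite -lerBlDl sub0r (le_trans _ (Fmono s _ s0 (_ : s <= Num.max (s + 1) ((c + 1) / e)))) //; last first.
    by rewrite le_max lerDl ler01.
  apply: le_trans (Fge _ m0); rewrite lerN2 ler_pdivrMr //.
  rewrite (@le_trans _ _ (e * ((c + 1) / e))) ?ler_wpM2l ?(ltW e0) ?le_max ?lexx ?orbT //.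
  by rewrite mulrCA divff ?gt_eqF // mulr1 lerDl.
(* [F] vanishes on a neighbourhood of [t > 0], so its derivative at [t], the difference of the two
   sides, is zero. *)
have [dFt] := dF t (ltW t0).
rewrite (@near_eq_derive _ _ _ _ (cst 0)) ?derive_cst; last first.
  near=> s; apply/Fz/ltW; near: s; exact: lt_nbhsr.
by move/eqP; rewrite eq_sym subr_eq0 => /eqP.
Unshelve. all: by end_near.
Qed.
End LogFamilies.

(** * Separation of simple poles *)

Section PartialFractions.
Variable R : realType.
Local Notation C := R[i].

(** Clearing denominators turns the hypothesis into a polynomial in [t] with too many roots.
    Evaluating it at minus a value of [k] isolates the sum of the coefficients attached to that
    value. Only these grouped sums vanish, which suffices because [f] sees [i] through [k i]
    alone. *)
Lemma partial_fractions (I : finType) (c : I -> C) (k : I -> R) :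
  (forall i, 0 < k i) -> (forall t, 0 < t -> \sum_i c i / (k i + t)%:C = 0) ->
  forall f : R -> C, \sum_i c i * f (k i) = 0.
Proof.
move=> k0 ck f.
pose s := undup [seq k i | i : I].
have ks i : k i \in s by rewrite mem_undup map_f ?mem_enum.
pose r a := \prod_(l <- s | l != a) ('X + (l%:C)%:P) : {poly C}.
pose q := \sum_i c i *: r (k i).
have qt t : 0 < t -> q.[t%:C] = 0.
  move=> t0; rewrite /q horner_sum.
  have E i : (c i *: r (k i)).[t%:C] =
     c i / (k i + t)%:C * \prod_(l <- s) (l + t)%:C.
    rewrite hornerZ /r horner_prod (bigD1_seq (k i)) ?undup_uniq //= !mulrA.
    rewrite -[c i / _ * _]mulrA mulVf ?mulr1; last first.
      by rewrite fmorph_eq0 gt_eqF // addr_gt0.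
    by congr (_ * _); apply: eq_bigr => l _; rewrite hornerD hornerX hornerC rmorphD addrC.
  by rewrite (eq_bigr _ (fun i _ => E i)) -mulr_suml ck ?mul0r.
have q0 : q = 0.
  apply: (@roots_geq_poly_eq0 _ _ [seq (n.+1%:R : C) | n <- iota 0 (size q)]).
  - apply/allP => _ /mapP[n _ ->]; apply/rootP.
    by rewrite -[n.+1%:R](rmorph_nat (real_complex R)) qt.
  - rewrite map_inj_uniq ?iota_uniq // => m n /eqP.
    by rewrite eqr_nat => /eqP[].
  - by rewrite size_map size_iota.
have cz a : a \in s -> \sum_(i | k i == a) c i = 0.
  move=> sa; have := congr1 (fun p : {poly C} => p.[- a%:C]) q0.
  rewrite horner0 /q horner_sum (bigID (fun i => k i == a)) /=.
  rewrite [X in _ + X]big1 ?addr0 => [|i kia]; last first.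
    rewrite hornerZ /r horner_prod (big_rem a) //= eq_sym kia.
    by rewrite hornerD hornerX hornerC addNr mul0r mulr0.
  rewrite (eq_bigr (fun i => c i * (r a).[- a%:C])); last first.
    by move=> i /eqP <-; rewrite hornerZ.
  rewrite -mulr_suml => /eqP; rewrite mulf_eq0 => /orP[/eqP //|].
  rewrite /r horner_prod prodf_seq_eq0 => /hasP[l _ /andP[la]].
  by rewrite hornerD hornerX hornerC addrC subr_eq0 (inj_eq (@complexI R)) (negPf la).
have -> : \sum_i c i * f (k i) = \sum_i \sum_(a <- s | a == k i) c i * f a.
  by apply: eq_bigr => i _; rewrite big_mkcond (bigD1_seq (k i)) ?undup_uniq //= eqxx big1 ?addr0
    // => a /negPf ->.
rewrite (exchange_big_dep predT) //= big1_seq // => a /andP[_ sa].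
by under eq_bigl do rewrite eq_sym; rewrite -mulr_suml cz // mul0r.
Qed.
End PartialFractions.

(** * Squared moduli and finite orthonormal families *)

Section NormSq.
Variable R : realType.
Local Notation C := R[i].

Definition normsq (z : C) : R := complex.Re z ^+ 2 + complex.Im z ^+ 2.

Lemma normsqE z : (normsq z)%:C = z^* * z.
Proof. by rewrite /normsq add_Re2_Im2 normCK mulrC. Qed.

Lemma normsq_ge0 z : 0 <= normsq z.
Proof. by rewrite addr_ge0 ?sqr_ge0. Qed.

Lemma normsq_eq0 z : (normsq z == 0) = (z == 0).
Proof.
by rewrite -(inj_eq (@complexI R)) normsqE mulf_eq0 conjC_eq0 orbb.
Qed.

Lemma conjC_real (a : R) : (a%:C)^* = a%:C.
Proof. exact: conjc_real. Qed.

Lemma normsqM z w : normsq (z * w) = normsq z * normsq w.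
Proof. by apply: (@complexI R); rewrite rmorphM /= !normsqE rmorphM /=; ring. Qed.

Lemma normsqr (a : R) : normsq a%:C = a ^+ 2.
Proof. by rewrite /normsq /= expr0n addr0. Qed.

Lemma sum_normsq_eq0 (T : finType) (u : T -> C) :
  \sum_t normsq (u t) = 0 -> forall t, u t = 0.
Proof.
move=> u0 t; apply/eqP; rewrite -normsq_eq0.
by move/eqP: u0; rewrite psumr_eq0 => [/allP/(_ t)|i _]; rewrite ?normsq_ge0 ?mem_index_enum //; apply.
Qed.

End NormSq.

Section InnerProduct.
Variables (R : realType) (T : finType).
Local Notation C := R[i].
Implicit Types (u v : T -> C).

Definition ip u v : C := \sum_t (u t)^* * v t.

Definition lincomb (P : finType) (a : P -> C) (e : P -> T -> C) : T -> C :=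
  fun t => \sum_p a p * e p t.

Definition orthonormal_family (P : finType) (e : P -> T -> C) :=
  forall p p', ip (e p) (e p') = (p == p')%:R.

Lemma ipC u v : ip v u = (ip u v)^*.
Proof.
by rewrite /ip rmorph_sum; apply: eq_bigr => t _; rewrite rmorphM /= conjCK mulrC.
Qed.

Lemma ip_normsq u : ip u u = (\sum_t normsq (u t))%:C.
Proof. by rewrite rmorph_sum; apply: eq_bigr => t _; rewrite /= normsqE. Qed.

Lemma ip_lincombr (P : finType) u (a : P -> C) (e : P -> T -> C) :
  ip u (lincomb a e) = \sum_p a p * ip u (e p).
Proof.
rewrite /ip /lincomb; under eq_bigr do rewrite mulr_sumr.
rewrite exchange_big; apply: eq_bigr => p _; rewrite mulr_sumr.
by apply: eq_bigr => t _; rewrite mulrCA.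
Qed.

Lemma ip_lincombl (P : finType) u (a : P -> C) (e : P -> T -> C) :
  ip (lincomb a e) u = \sum_p (a p)^* * ip (e p) u.
Proof.
rewrite ipC ip_lincombr rmorph_sum; apply: eq_bigr => p _.
by rewrite rmorphM /= -ipC.
Qed.

Lemma ip_on (P : finType) (e : P -> T -> C) (a : P -> C) p :
  orthonormal_family e -> ip (e p) (lincomb a e) = a p.
Proof.
move=> eo; rewrite ip_lincombr (bigD1 p) //= eo eqxx mulr1 big1 ?addr0 // => q qp.
by rewrite eo eq_sym (negPf qp) mulr0.
Qed.

Lemma ip_on2 (P : finType) (e : P -> T -> C) (a b : P -> C) :
  orthonormal_family e -> ip (lincomb a e) (lincomb b e) = \sum_p (a p)^* * b p.
Proof. by move=> eo; rewrite ip_lincombl; apply: eq_bigr => p _; rewrite ip_on. Qed.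

(** The equality form keeps the defect, whose vanishing puts [w] in the span of [e]; the families
    used later need not be bases, since only positive eigenvalues are kept. *)
Lemma bessel_eq (P : finType) (e : P -> T -> C) w : orthonormal_family e ->
  \sum_t normsq (w t) = \sum_p normsq (ip (e p) w)
    + \sum_t normsq (w t - lincomb (fun p => ip (e p) w) e t).
Proof.
move=> eo; apply: (@complexI R); rewrite rmorphD /= -!ip_normsq rmorph_sum.
set v := lincomb _ e; set d := fun p => ip (e p) w.
have vw : ip v w = \sum_p (normsq (d p))%:C.
  by rewrite ip_lincombl; apply: eq_bigr => p _; rewrite normsqE.
have wv : ip w v = ip v w by rewrite ipC vw rmorph_sum; apply: eq_bigr => p _; rewrite /= conjC_real.
have vv : ip v v = ip v w by rewrite ip_on2 // vw; apply: eq_bigr => p _; rewrite normsqE.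
have -> : ip (fun t => w t - v t) (fun t => w t - v t) = ip w w - ip w v - ip v w + ip v v.
  rewrite /ip -!sumrB -big_split; apply: eq_bigr => t _; rewrite rmorphB /=; ring.
rewrite vv wv -vw; ring.
Qed.

Lemma bessel (P : finType) (e : P -> T -> C) w : orthonormal_family e ->
  \sum_p normsq (ip (e p) w) <= \sum_t normsq (w t).
Proof.
by move=> eo; rewrite (bessel_eq w eo) lerDl sumr_ge0 // => t _; apply: normsq_ge0.
Qed.

End InnerProduct.

(** * Two positive operators compared at a common vector *)

Section Resolvent.
Variables (R : realType) (T P Q : finType).
Local Notation C := R[i].
Variables (e : P -> T -> C) (g : Q -> T -> C) (lam : P -> R) (mu : Q -> R).
Variables (x : P -> C) (y : Q -> C).
Hypotheses (eo : orthonormal_family e) (go : orthonormal_family g).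
Hypotheses (lam0 : forall p, 0 < lam p) (mu0 : forall q, 0 < mu q).
Hypothesis xy : lincomb x e =1 lincomb y g.
Hypothesis form_le : forall c : Q -> C,
  \sum_p lam p * normsq (ip (e p) (lincomb c g)) <= \sum_q mu q * normsq (c q).
Hypothesis log_eq :
  \sum_p normsq (x p) * ln (lam p) = \sum_q normsq (y q) * ln (mu q).

(* With [w = (D2 + s)^-1 xi], expanding [<r, (D1 + s) r>] at
   [r = (D1 + s)^-1 xi - w] compares the two resolvents. *)
Lemma resolvent_gap s : 0 < s ->
  let c q := y q / (mu q + s)%:C in
  let d p := ip (e p) (lincomb c g) in
  \sum_p normsq (x p) / (lam p + s) - \sum_q normsq (y q) / (mu q + s) =
  \sum_p (lam p + s) * normsq (x p / (lam p + s)%:C - d p)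
  + (\sum_q mu q * normsq (c q) - \sum_p lam p * normsq (d p))
  + s * (\sum_q normsq (c q) - \sum_p normsq (d p)).
Proof.
move=> s0 c d.
have ls p : (lam p + s)%:C != 0 by rewrite fmorph_eq0 gt_eqF // addr_gt0.
have ms q : (mu q + s)%:C != 0 by rewrite fmorph_eq0 gt_eqF // addr_gt0.
(* Both sums are the inner product of w with the common vector xi, expanded in the two families. *)
have dx : \sum_p (d p)^* * x p = \sum_q (c q)^* * y q.
  rewrite -(ip_on2 c y go).
  have -> : ip (lincomb c g) (lincomb y g) = ip (lincomb c g) (lincomb x e).
    by apply: eq_bigr => t _; rewrite xy.
  rewrite ip_lincombr; apply: eq_bigr => p _; rewrite mulrC [in RHS]ipC.
  by rewrite /d.
have cy : \sum_q (c q)^* * y q = (\sum_q normsq (y q) / (mu q + s))%:C.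
  rewrite rmorph_sum; apply: eq_bigr => q _ /=.
  rewrite /c [RHS]rmorphM /= normsqE fmorphV !rmorphM /= !fmorphV /= conjC_real mulrAC //.
have xd : \sum_p (x p)^* * d p = (\sum_q normsq (y q) / (mu q + s))%:C.
  rewrite -(conjC_real (\sum_q _)) -cy -dx rmorph_sum; apply: eq_bigr => p _.
  by rewrite rmorphM /= conjCK mulrC.
rewrite {}cy in dx.
have E1 : (\sum_p (lam p + s) * normsq (x p / (lam p + s)%:C - d p))%:C =
  (\sum_p normsq (x p) / (lam p + s))%:C - \sum_p (x p)^* * d p - \sum_p (d p)^* * x p
   + (\sum_p (lam p + s) * normsq (d p))%:C.
  rewrite !rmorph_sum -!sumrB -big_split; apply: eq_bigr => p _ /=.
  rewrite !rmorphM /= fmorphV /= !normsqE rmorphB /= rmorphM /= fmorphV /= conjC_real.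
  by field; rewrite -rmorphD; exact: ls.
have E2 : (\sum_q normsq (y q) / (mu q + s)) = \sum_q (mu q + s) * normsq (c q).
  apply: eq_bigr => q _; apply: (@complexI R).
  rewrite !rmorphM /= fmorphV /= !normsqE /c rmorphM /= fmorphV /= conjC_real.
  by field; rewrite -rmorphD; exact: ms.
apply: (@complexI R); rewrite rmorphB !rmorphD /= E1 xd dx -!rmorphD -!rmorphB -?rmorphD -?rmorphB.
rewrite -?rmorphB -?rmorphD -?rmorphM; congr (_ %:C).
have F1 : \sum_p (lam p + s) * normsq (d p) =
   \sum_p lam p * normsq (d p) + s * \sum_p normsq (d p).
  by rewrite mulr_sumr -big_split; apply: eq_bigr => p _; rewrite mulrDl.
have F2 : \sum_q (mu q + s) * normsq (c q) =
   \sum_q mu q * normsq (c q) + s * \sum_q normsq (c q).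
  by rewrite mulr_sumr -big_split; apply: eq_bigr => p _; rewrite mulrDl.
rewrite F1 E2 F2; ring.
Qed.

Lemma sum_normsq_coord : \sum_p normsq (x p) = \sum_q normsq (y q).
Proof.
apply: (@complexI R); rewrite !rmorph_sum /=.
under eq_bigr do rewrite normsqE; under [RHS]eq_bigr do rewrite normsqE.
rewrite -(ip_on2 x x eo) -(ip_on2 y y go).
by apply: eq_bigr => t _; rewrite xy.
Qed.

Lemma resolvent_le s : 0 < s ->
  \sum_q normsq (y q) / (mu q + s) <= \sum_p normsq (x p) / (lam p + s).
Proof.
move=> s0; rewrite -subr_ge0 (resolvent_gap s0).
apply: addr_ge0; first apply: addr_ge0.
- by rewrite sumr_ge0 // => p _; rewrite mulr_ge0 ?normsq_ge0 // addr_ge0 // ltW.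
- by rewrite subr_ge0 form_le.
- rewrite mulr_ge0 ?(ltW s0) // subr_ge0.
  have <- : \sum_t normsq (lincomb (fun q => y q / (mu q + s)%:C) g t) =
      \sum_q normsq (y q / (mu q + s)%:C).
    apply: (@complexI R); rewrite -ip_normsq ip_on2 // rmorph_sum.
    by apply: eq_bigr => q _; rewrite /= normsqE.
  exact: bessel.
Qed.

Lemma log_equality f t :
  lincomb (fun p => x p * f (lam p)) e t = lincomb (fun q => y q * f (mu q)) g t.
Proof.
have res s : 0 < s -> lincomb (fun p => x p / (lam p + s)%:C) e t =
    lincomb (fun q => y q / (mu q + s)%:C) g t.
  move=> s0; have := resolvent_gap s0.
  set c := fun q => _; rewrite /=; set d := fun p => ip (e p) (lincomb c g).
  have -> := @log_resolvent_eq R P Q (fun p => normsq (x p)) lam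
    (fun q => normsq (y q)) mu lam0 mu0 (fun p => normsq_ge0 _) (fun q => normsq_ge0 _)
    sum_normsq_coord log_eq resolvent_le s s0.
  rewrite subrr => /esym/eqP.
  (* The three summands of the gap are nonnegative, so all vanish with it. The first gives
     [d p = x p / (lam p + s)], the third puts w in the span of [e]; together they identify the two
     resolvent vectors. *)
  have n1 : 0 <= \sum_p (lam p + s) * normsq (x p / (lam p + s)%:C - d p).
    by rewrite sumr_ge0 // => p _; rewrite mulr_ge0 ?normsq_ge0 // addr_ge0 // ltW.
  have n2 : 0 <= \sum_q mu q * normsq (c q) - \sum_p lam p * normsq (d p).
    by rewrite subr_ge0 form_le.
  have B : \sum_q normsq (c q) - \sum_p normsq (d p) =
      \sum_t normsq (lincomb c g t - lincomb d e t).
    apply/eqP; rewrite subr_eq addrC -(bessel_eq _ eo); apply/eqP/esym.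
    apply: (@complexI R); rewrite -ip_normsq ip_on2 // rmorph_sum.
    by apply: eq_bigr => q _; rewrite /= normsqE.
  rewrite B; have n3 : 0 <= \sum_t normsq (lincomb c g t - lincomb d e t).
    by rewrite sumr_ge0 // => u _; rewrite normsq_ge0.
  have n4 := mulr_ge0 (ltW s0) n3.
  move=> /eqP E; have n12 := addr_ge0 n1 n2.
  have [E1 E2] : \sum_p (lam p + s) * normsq (x p / (lam p + s)%:C - d p) = 0 /\
     \sum_u normsq (lincomb c g u - lincomb d e u) = 0.
    have [s_ne0 z4] : s != 0 /\ s * (\sum_u normsq (lincomb c g u - lincomb d e u)) = 0.
      by split; [rewrite gt_eqF | lra].
    split; first lra.
    by apply/eqP; move/eqP: z4; rewrite mulf_eq0 (negPf s_ne0).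
  have {}E2 := sum_normsq_eq0 E2 t.
  move/eqP: E2; rewrite subr_eq0 => /eqP ->.
  apply: eq_bigr => p _; congr (_ * _); apply/eqP; rewrite -subr_eq0 -normsq_eq0.
  move/eqP: E1; rewrite psumr_eq0 => [/allP/(_ p)|i _]; last first.
    by rewrite mulr_ge0 ?normsq_ge0 // addr_ge0 // ltW.
  by rewrite mem_index_enum mulf_eq0 gt_eqF ?addr_gt0 //=; apply.
(* At the fixed coordinate [t] the difference of the two expansions is one sum of simple poles in
   [s], indexed by [P + Q]. *)
pose c (i : P + Q) := match i with inl p => x p * e p t | inr q => - (y q * g q t) end.
pose k (i : P + Q) := match i with inl p => lam p | inr q => mu q end.
have k0 i : 0 < k i by case: i.
have ck s : 0 < s -> \sum_i c i / (k i + s)%:C = 0.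
  move=> s0; rewrite big_sumType /=; have := res s s0; rewrite /lincomb => E.
  apply/eqP; rewrite addr_eq0 -sumrN; apply/eqP.
  under [RHS]eq_bigr do rewrite mulNr opprK mulrAC.
  by rewrite -E; apply: eq_bigr => p _; rewrite mulrAC.
have := partial_fractions k0 ck f; rewrite big_sumType /= => /eqP.
rewrite addr_eq0 -sumrN => /eqP E; rewrite /lincomb.
rewrite (eq_bigr (fun p => x p * e p t * f (lam p))) => [|p _]; last by rewrite mulrAC.
by rewrite E; apply: eq_bigr => q _; rewrite mulNr opprK mulrAC.
Qed.

End Resolvent.

(** * Spectral calculus *)

Section Adjoint.
Variable C : numClosedFieldType.

Lemma adjmxM m n p (A : 'M[C]_(m, n)) (B : 'M[C]_(n, p)) :
  (A *m B)^t* = B^t* *m A^t*.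
Proof. by rewrite trmx_mul map_mxM. Qed.

Lemma adjmxD m n (A B : 'M[C]_(m, n)) : (A + B)^t* = A^t* + B^t*.
Proof. by rewrite linearD map_mxD. Qed.

Lemma adjmxB m n (A B : 'M[C]_(m, n)) : (A - B)^t* = A^t* - B^t*.
Proof. by rewrite linearB map_mxB. Qed.

Lemma adjmxZ m n a (A : 'M[C]_(m, n)) : (a *: A)^t* = a^* *: A^t*.
Proof. by rewrite linearZ map_mxZ. Qed.

Lemma adjmx_sum m n (I : Type) (r : seq I) (P : pred I) (A : I -> 'M[C]_(m, n)) :
  (\sum_(i <- r | P i) A i)^t* = \sum_(i <- r | P i) (A i)^t*.
Proof. by rewrite linear_sum map_mx_sum. Qed.

Lemma adjmx1 n : (1%:M : 'M[C]_n)^t* = 1%:M.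
Proof. by rewrite trmx1 map_mx1. Qed.

Lemma adjmx0 m n : (0 : 'M[C]_(m, n))^t* = 0.
Proof. by rewrite trmx0 map_mx0. Qed.

Lemma adjmxE m n (A : 'M[C]_(m, n)) i j : A^t* i j = (A j i)^*.
Proof. by rewrite !mxE. Qed.

Lemma adjmx_inj m n : injective (fun A : 'M[C]_(m, n) => A^t*).
Proof. by move=> A B /(congr1 (fun M => M^t*)); rewrite !trmxCK. Qed.

End Adjoint.

Section Spectral.
Variable R : realType.
Local Notation C := R[i].

Definition rdiag n (d : 'I_n -> R) : 'M[C]_n := diag_mx (\row_i (d i)%:C).

Lemma rdiagE n (d : 'I_n -> R) i j : rdiag d i j = (d j)%:C *+ (i == j).
Proof. by rewrite !mxE; case: eqP => [->|]. Qed.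

Lemma mul_rdiag_mx m n (d : 'I_m -> R) (A : 'M[C]_(m, n)) i j :
  (rdiag d *m A) i j = (d i)%:C * A i j.
Proof. by rewrite mul_diag_mx !mxE. Qed.

Lemma mul_mx_rdiag m n (d : 'I_n -> R) (A : 'M[C]_(m, n)) i j :
  (A *m rdiag d) i j = A i j * (d j)%:C.
Proof. by rewrite mul_mx_diag !mxE. Qed.

Lemma adj_rdiag n (d : 'I_n -> R) : (rdiag d)^t* = rdiag d.
Proof.
apply/matrixP => i j; rewrite adjmxE !rdiagE eq_sym; case: eqP => [->|_].
  by rewrite !mulr1n conjC_real.
by rewrite !mulr0n conjC0.
Qed.

Lemma mxtrace_mul_adj m n (A : 'M[C]_(m, n)) :
  \tr (A *m A^t*) = (\sum_i \sum_j normsq (A i j))%:C.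
Proof.
rewrite rmorph_sum; apply: eq_bigr => i _ /=; rewrite mxE rmorph_sum.
by apply: eq_bigr => j _ /=; rewrite adjmxE normsqE mulrC.
Qed.

Lemma mul_adj_eq0 m n (A : 'M[C]_(m, n)) : A *m A^t* = 0 -> A = 0.
Proof.
move=> /(congr1 mxtrace); rewrite mxtrace_mul_adj mxtrace0 pair_big /= => E.
have {}E : \sum_(p : 'I_m * 'I_n) normsq (A p.1 p.2) = 0 by apply: (@complexI R).
by apply/matrixP => i j; rewrite mxE; exact: (sum_normsq_eq0 E (i, j)).
Qed.

Lemma adj_mul_eq0 m n (A : 'M[C]_(m, n)) : A^t* *m A = 0 -> A = 0.
Proof.
rewrite -{2}[A]trmxCK => /mul_adj_eq0 E; apply: (@adjmx_inj _ m n).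
by rewrite E adjmx0.
Qed.

Section Hermitian.
Variables (n : nat) (M : 'M[C]_n).
Hypothesis Mherm : M^t* = M.

Let U := spectralmx M.
Let d i : R := complex.Re (spectral_diag M 0 i).

Let UU : U *m U^t* = 1%:M.
Proof. exact/unitarymxP/spectral_unitarymx. Qed.

Let UU' : U^t* *m U = 1%:M.
Proof. exact: mulmx1C. Qed.

Let hM : M \is hermsymmx.
Proof. by apply/is_hermitianmxP; rewrite expr0 scale1r Mherm. Qed.

Lemma herm_spectralE : M = U^t* *m rdiag d *m U.
Proof.
have /orthomx_spectralP E := hermitian_normalmx hM.
rewrite {1}E invmx_unitary ?spectral_unitarymx //; congr (_ *m _ *m _).
apply/matrixP => i j; rewrite /rdiag !mxE; congr (_ *+ _).
have /mxOverP/(_ 0 i) := hermitian_spectral_diag_real hM.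
by move/RRe_real.
Qed.

Lemma herm_hermfunE f : hermfun f M = U^t* *m rdiag (f \o d) *m U.
Proof.
rewrite /hermfun invmx_unitary ?spectral_unitarymx //; congr (_ *m _ *m _).
by apply/matrixP => i j; rewrite /rdiag !mxE.
Qed.

(** [spectralmx] fixes some eigenbasis; this makes the calculus independent of that choice. In
    spectral coordinates a nonzero entry of an eigenvector can only sit where the diagonal equals
    [a]. *)
Lemma hermfun_eigen f m (v : 'M[C]_(n, m)) a :
  M *m v = a%:C *: v -> hermfun f M *m v = (f a)%:C *: v.
Proof.
move=> Mv; pose w := U *m v.
have v_w : v = U^t* *m w by rewrite mulmxA UU' mul1mx.
have dw : rdiag d *m w = a%:C *: w.
  rewrite /w scalemxAr -Mv {1}herm_spectralE !mulmxA UU mul1mx //.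
have Fw : hermfun f M *m v = U^t* *m (rdiag (f \o d) *m w).
  by rewrite herm_hermfunE -!mulmxA.
clearbody w.
have fw : rdiag (f \o d) *m w = (f a)%:C *: w.
  apply/matrixP => i j; have := congr1 (fun X : 'M_(n, m) => X i j) dw.
  rewrite !mul_rdiag_mx mxE => E; rewrite mxE.
  have [->|wij] := eqVneq (w i j) 0; first by rewrite !mulr0.
  by rewrite /= (complexI (mulIf wij E)).
by rewrite Fw fw -scalemxAr -v_w.
Qed.

(** A matrix commuting with a diagonal one has nonzero entries only between equal diagonal values,
    and such entries also commute with every function of the diagonal. *)
Lemma hermfun_comm f (T : 'M[C]_n) :
  T *m M = M *m T -> T *m hermfun f M = hermfun f M *m T.
Proof.
move=> TM; pose S := U *m T *m U^t*.
have Sd : S *m rdiag d = rdiag d *m S.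
  have <- : U *m M *m U^t* = rdiag d.
    by rewrite {1}herm_spectralE !mulmxA UU mul1mx -!mulmxA UU mulmx1.
  by rewrite /S !mulmxA mulmxKtV ?spectral_unitarymx // mulmxKtV ?spectral_unitarymx // -(mulmxA U) TM mulmxA.
have Sf : S *m rdiag (f \o d) = rdiag (f \o d) *m S.
  apply/matrixP => i j; have := congr1 (fun X : 'M_n => X i j) Sd.
  rewrite !mul_mx_rdiag !mul_rdiag_mx => E.
  have [->|Sij] := eqVneq (S i j) 0; first by rewrite mulr0 mul0r.
  rewrite mulrC; congr (_ * _); move: E; rewrite mulrC => E.
  by rewrite /= (complexI (mulIf Sij E)).
have T_S : T = U^t* *m S *m U by rewrite /S !mulmxA UU' mul1mx -mulmxA UU' mulmx1.
clearbody S; rewrite herm_hermfunE {1}T_S -!mulmxA (mulmxA U) UU mul1mx (mulmxA S) Sf.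
by rewrite [in RHS]T_S -!mulmxA (mulmxA U (U^t*)) UU mul1mx.
Qed.

Lemma adj_hermfun f : (hermfun f M)^t* = hermfun f M.
Proof. by rewrite herm_hermfunE !adjmxM trmxCK adj_rdiag mulmxA. Qed.

Lemma herm_eigenbasis : exists (w : 'I_n -> R) (v : 'I_n -> 'cV[C]_n),
  [/\ forall k l, (v k)^t* *m v l = (k == l)%:R%:M,
      M = \sum_k (w k)%:C *: projector (v k) & \sum_k projector (v k) = 1%:M].
Proof.
exists d, (fun k => col k (U^t*)).
have pk (x : 'I_n -> R) : U^t* *m rdiag x *m U = \sum_k (x k)%:C *: projector (col k (U^t*)).
  apply/matrixP => i j; rewrite mxE summxE; apply: eq_bigr => k _.
  rewrite mul_mx_rdiag !mxE big_ord1 !mxE conjCK; ring.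
split.
- move=> k l; apply/matrixP => i j; rewrite !ord1 !mxE eqxx mulr1n.
  have := congr1 (fun X : 'M_n => X k l) UU; rewrite !mxE => <-.
  by apply: eq_bigr => t _; rewrite !mxE conjCK.
- by rewrite -pk -herm_spectralE.
- rewrite -UU' -[in RHS](mulmx1 (U^t*)) .
  have -> : 1%:M = rdiag (fun _ : 'I_n => 1%R : R).
    by apply/matrixP => i j; rewrite rdiagE mxE.
  by rewrite pk; under [RHS]eq_bigr do rewrite scale1r.
Qed.

End Hermitian.

Section OrthonormalSums.
Variables (n : nat) (I : finType) (P : pred I) (w : I -> R) (v : I -> 'cV[C]_n).
Hypothesis von : forall k l, P k -> P l -> (v k)^t* *m v l = (k == l)%:R%:M.
Let M := \sum_(k | P k) (w k)%:C *: projector (v k).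

Lemma adj_projector m (u : 'cV[C]_m) : (projector u)^t* = projector u.
Proof. by rewrite /projector adjmxM trmxCK. Qed.

Lemma adj_projector_sum : M^t* = M.
Proof.
rewrite adjmx_sum; apply: eq_bigr => k _.
by rewrite adjmxZ adj_projector conjC_real.
Qed.

Lemma projector_sum_mul k : P k -> M *m v k = (w k)%:C *: v k.
Proof.
move=> Pk; rewrite mulmx_suml (bigD1 k) //= big1 ?addr0 => [|l /andP[Pl lk]].
  by rewrite -scalemxAl -mulmxA von // eqxx mulmx1.
by rewrite -scalemxAl -mulmxA von // (negPf lk) raddf0 mulmx0 scaler0.
Qed.

Lemma entropy_sum : entropy M = - \sum_(k | P k) w k * ln (w k).
Proof.
rewrite /entropy; congr (- _).
have -> : \tr (M *m logmx M) = (\sum_(k | P k) w k * ln (w k))%:C; last by [].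
rewrite mulmx_suml rmorph_sum raddf_sum /=; apply: eq_bigr => k Pk.
rewrite -scalemxAl mxtraceZ rmorphM /=; congr (_ * _).
have Lv : logmx M *m v k = (ln (w k))%:C *: v k.
  by apply: hermfun_eigen; [apply: adj_projector_sum | apply: projector_sum_mul].
rewrite /projector -mulmxA mxtrace_mulC -mulmxA Lv -scalemxAr von // eqxx.
by rewrite mxtraceZ mxtrace1 mulr1.
Qed.

(** The vectors need not span; their complement lies in the kernel of [M], where [f 0 = 0] makes it
    contribute nothing. The condition holds for the square root and, because [0^-1 = 0], for its
    inverse. *)
Lemma hermfun_sum f : f 0 = 0 ->
  hermfun f M = \sum_(k | P k) (f (w k))%:C *: projector (v k).
Proof.
move=> f0; pose Q := \sum_(k | P k) projector (v k).
have MQ : M *m Q = M.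
  rewrite mulmx_sumr; apply: eq_bigr => k Pk.
  by rewrite /projector mulmxA projector_sum_mul // -scalemxAl.
have FQ : hermfun f M *m (1%:M - Q) = 0.
  rewrite (@hermfun_eigen _ _ adj_projector_sum f _ _ 0) ?f0 ?rmorph0 ?scale0r //.
  by rewrite mulmxBr mulmx1 MQ subrr.
rewrite -[LHS](mulmx1) -(subrK Q 1%:M) mulmxDr FQ add0r mulmx_sumr.
apply: eq_bigr => k Pk; rewrite /projector mulmxA.
by rewrite (hermfun_eigen adj_projector_sum f (projector_sum_mul Pk)) -scalemxAl.
Qed.

End OrthonormalSums.

End Spectral.

(** * Gram matrices, singular values and polar parts *)

Section SingularValues.
Variable R : realType.
Local Notation C := R[i].

Definition orthonormal_vectors n (I : eqType) (v : I -> 'cV[C]_n) :=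
  forall k l, (v k)^t* *m v l = (k == l)%:R%:M.

Lemma normsq_vec_eq n (u : 'cV[C]_n) : u^t* *m u = (\sum_i normsq (u i 0))%:C%:M.
Proof.
apply/matrixP => i j; rewrite !ord1 !mxE eqxx mulr1n rmorph_sum.
by apply: eq_bigr => k _ /=; rewrite !mxE normsqE.
Qed.

Lemma gram_eigenbasis n m (X : 'M[C]_(n, m)) :
  exists (w : 'I_n -> R) (v : 'I_n -> 'cV[C]_n),
  [/\ forall k, 0 <= w k, orthonormal_vectors v,
      X *m X^t* = \sum_k (w k)%:C *: projector (v k),
      \sum_k projector (v k) = 1%:M &
      forall k, (X^t* *m v k)^t* *m (X^t* *m v k) = (w k)%:C%:M].
Proof.
have hX : (X *m X^t*)^t* = X *m X^t* by rewrite adjmxM trmxCK.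
have [w [v [von E E1]]] := herm_eigenbasis hX.
have Xv k : (X^t* *m v k)^t* *m (X^t* *m v k) = (w k)%:C%:M.
  rewrite adjmxM trmxCK mulmxA -(mulmxA ((v k)^t*)) E -mulmxA.
  have von' k' l' : xpredT k' -> xpredT l' -> (v k')^t* *m v l' = (k' == l')%:R%:M by [].
  by rewrite (@projector_sum_mul _ _ _ _ w v von' k) // -scalemxAr von eqxx scale_scalar_mx mulr1.
exists w, v; split=> // k.
have := Xv k; rewrite normsq_vec_eq => /(congr1 (fun M : 'M_1 => M 0 0)).
rewrite !mxE eqxx !mulr1n => /complexI <-.
by rewrite sumr_ge0 // => i _; apply: normsq_ge0.
Qed.

(** Zero eigenvalues are dropped so that the weights can be inverted. Nothing of [X] is lost, since
    a zero weight means [X^t* *m v k = 0]. *)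
Lemma gram_positive_decomposition n m (X : 'M[C]_(n, m)) :
  exists (K : finType) (w : K -> R) (v : K -> 'cV[C]_n),
  [/\ forall k, 0 < w k, orthonormal_vectors v,
      X *m X^t* = \sum_k (w k)%:C *: projector (v k) &
      (\sum_k projector (v k)) *m X = X].
Proof.
have [w [v [w0 von E E1 Xv]]] := gram_eigenbasis X.
have Xv0 k : ~~ (0 < w k) -> X^t* *m v k = 0.
  rewrite lt_def w0 andbT negbK => /eqP wk; apply: adj_mul_eq0.
  by rewrite Xv wk raddf0.
pose A := [pred k | 0 < w k].
exists {k in A}, (fun k => w (val k)), (fun k => v (val k)); split.
- by case.
- by move=> k l; rewrite von -(inj_eq val_inj).
- rewrite E (bigID (fun k => 0 < w k)) /= [X in _ + X]big1 ?addr0 => [|k].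
    by rewrite [LHS](big_sub A).
  rewrite lt_def w0 andbT negbK => /eqP ->; exact: scale0r.
- rewrite -{2}[X]mul1mx -E1 (bigID (fun k => 0 < w k)) /= mulmxDl.
  rewrite [X in _ = _ + X]mulmx_suml [X in _ = _ + X]big1 ?addr0 => [|k wk].
    by congr (_ *m _); rewrite [RHS](big_sub A).
  rewrite /projector -mulmxA -[X in _ *m (_ *m X)]trmxCK -adjmxM Xv0 //.
  by rewrite adjmx0 mulmx0.
Qed.

Lemma trmx_adj_mul n m p (A : 'M[C]_(n, m)) (B : 'M[C]_(p, m)) :
  (A^T)^t* *m B^T = (B *m A^t*)^T.
Proof. by rewrite trmx_mul [in RHS]map_trmx. Qed.

Lemma trmx_mul_adj n m p (A : 'M[C]_(m, n)) (B : 'M[C]_(m, p)) :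
  A^T *m (B^T)^t* = (B^t* *m A)^T.
Proof. by rewrite trmx_mul [in RHS]map_trmx. Qed.

(** The right vectors are transposed and not conjugated: [X] is then the unfolding of the vector
    with terms [x k] (x) [y k], so that this also serves as the Schmidt decomposition. *)
Lemma svd n m (X : 'M[C]_(n, m)) :
  exists (K : finType) (s : K -> R) (x : K -> 'cV[C]_n) (y : K -> 'cV[C]_m),
  [/\ forall k, 0 < s k, orthonormal_vectors x, orthonormal_vectors y &
      X = \sum_k (s k)%:C *: (x k *m (y k)^T)].
Proof.
have [K [w [v [w0 von E EX]]]] := gram_positive_decomposition X.
pose s k := Num.sqrt (w k).
have s0 k : 0 < s k by rewrite sqrtr_gt0.
have sC k : (s k)%:C != 0 by rewrite fmorph_eq0 gt_eqF.
exists K, s, v, (fun k => (s k)%:C^-1 *: ((v k)^t* *m X)^T); split => //.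
- move=> k l; rewrite adjmxZ -scalemxAl -scalemxAr.
  rewrite trmx_adj_mul adjmxM trmxCK mulmxA -(mulmxA ((v l)^t*)) E -mulmxA.
  have von' k' l' : xpredT k' -> xpredT l' -> (v k')^t* *m v l' = (k' == l')%:R%:M by [].
  rewrite (@projector_sum_mul _ _ _ _ w v von' k) // -scalemxAr von eq_sym.
  case: eqP => [->|_]; last by rewrite raddf0 scaler0 trmx0 !scaler0.
  rewrite [(_ *: _)^T]linearZ /= tr_scalar_mx !scalerA fmorphV /= conjC_real.
  have -> : (w l)%:C = (s l)%:C * (s l)%:C by rewrite -rmorphM -expr2 sqr_sqrtr // ltW.
  by rewrite mulrA mulfVK // mulVf // scale1r.
- rewrite -{1}EX mulmx_suml; apply: eq_bigr => k _.
  by rewrite linearZ /= -scalemxAr scalerA divff // scale1r trmxK mulmxA.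
Qed.

Lemma gram_sum n m (K : finType) (P : pred K) (s : K -> R) (x : K -> 'cV[C]_n)
    (y : K -> 'cV[C]_m) :
  (forall k l, P k -> P l -> (y k)^t* *m y l = (k == l)%:R%:M) ->
  let X := \sum_(k | P k) (s k)%:C *: (x k *m (y k)^T) in
  X *m X^t* = \sum_(k | P k) (s k ^+ 2)%:C *: projector (x k).
Proof.
move=> yon X; rewrite mulmx_suml; apply: eq_bigr => k Pk; rewrite adjmx_sum mulmx_sumr.
have E l : P l -> ((s k)%:C *: (x k *m (y k)^T)) *m ((s l)%:C *: (x l *m (y l)^T))^t* =
    (k == l)%:R *: ((s k * s l)%:C *: (x k *m (x l)^t*)).
  move=> Pl; rewrite adjmxZ -scalemxAl -scalemxAr conjC_real [LHS]scalerA -rmorphM.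
  rewrite adjmxM !mulmxA -(mulmxA (x k)) trmx_mul_adj yon // tr_scalar_mx mul_mx_scalar.
  by rewrite -scalemxAl eq_sym !scalerA mulrC.
rewrite (bigD1 k) //= big1 ?addr0 => [|l /andP[Pl lk]].
  by rewrite E // eqxx scale1r expr2.
by rewrite E // eq_sym (negPf lk) scale0r.
Qed.

Section PolarPart.
Variables (n m : nat) (K : finType) (s : K -> R).
Variables (x : K -> 'cV[C]_n) (y : K -> 'cV[C]_m).
Hypotheses (s0 : forall k, 0 < s k).
Hypotheses (xon : orthonormal_vectors x) (yon : orthonormal_vectors y).
Let X := \sum_k (s k)%:C *: (x k *m (y k)^T).

Lemma svd_gram : X *m X^t* = \sum_k (s k ^+ 2)%:C *: projector (x k).
Proof. by apply: gram_sum => k l _ _. Qed.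

(** The convention [0^-1 = 0] makes the inverse square root a pseudo-inverse, which replaces each
    positive singular value by 1 and ignores the kernel. *)
Lemma polar_svd : hermfun (fun t => (Num.sqrt t)^-1) (X *m X^t*) *m X =
  \sum_k x k *m (y k)^T.
Proof.
have xon' k l : xpredT k -> xpredT l -> (x k)^t* *m x l = (k == l)%:R%:M by [].
rewrite svd_gram (hermfun_sum (fun k => s k ^+ 2) xon') ?sqrtr0 ?invr0 //.
rewrite mulmx_sumr; apply: eq_bigr => k _.
rewrite -scalemxAr mulmxA (projector_sum_mul _ xon') // sqrtr_sqr gtr0_norm //.
rewrite -scalemxAl scalerA -rmorphM divff ?gt_eqF // scale1r //.
Qed.

End PolarPart.

End SingularValues.

(** * Partial traces and realignment *)

Section TensorIndices.

Lemma sum_mxtens (V : nmodType) m n (F : 'I_(m * n) -> V) :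
  \sum_u F u = \sum_i \sum_j F (mxtens_index (i, j)).
Proof.
rewrite pair_big /= (reindex (@mxtens_index m n)) /=.
  by apply: eq_bigr => -[i j] _.
by exists (@mxtens_unindex m n) => u _; rewrite (mxtens_indexK, mxtens_unindexK).
Qed.

Lemma mxtens_index_eq m n (p q : 'I_m * 'I_n) :
  (mxtens_index p == mxtens_index q) = (p == q).
Proof. exact/inj_eq/(can_inj (@mxtens_indexK m n)). Qed.

Variable R : realType.
Local Notation C := R[i].

Lemma adj_tensmx m n p q (A : 'M[C]_(m, n)) (B : 'M[C]_(p, q)) :
  (tensmx A B)^t* = tensmx (A^t*) (B^t*).
Proof. by rewrite trmx_tens map_mxT. Qed.

Lemma tensmx1 m n : tensmx (1%:M : 'M[C]_m) (1%:M : 'M[C]_n) = 1%:M.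
Proof.
apply/matrixP => u v; case: (mxtens_indexP u) => i j; case: (mxtens_indexP v) => i' j'.
by rewrite tensmxE !mxE mxtens_index_eq xpair_eqE -natrM mulnb.
Qed.

Lemma tensmx_isometry m n p q (A : 'M[C]_(m, n)) (B : 'M[C]_(p, q)) :
  A^t* *m A = 1%:M -> B^t* *m B = 1%:M ->
  (tensmx A B)^t* *m tensmx A B = 1%:M.
Proof. by move=> AA BB; rewrite adj_tensmx tensmx_mul AA BB tensmx1. Qed.

Definition realign m n (M : 'M[C]_(m * n)) : 'M[C]_(m * m, n * n) :=
  \matrix_(u, w) M (mxtens_index ((mxtens_unindex u).1, (mxtens_unindex w).1))
                   (mxtens_index ((mxtens_unindex u).2, (mxtens_unindex w).2)).

Lemma realignE m n (M : 'M[C]_(m * n)) i i' j j' :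
  realign M (mxtens_index (i, i')) (mxtens_index (j, j')) =
  M (mxtens_index (i, j)) (mxtens_index (i', j')).
Proof. by rewrite mxE !mxtens_indexK. Qed.

Definition unfold_vec m n (v : 'cV[C]_(m * n)) : 'M[C]_(m, n) :=
  \matrix_(i, j) v (mxtens_index (i, j)) 0.

Lemma ptrace2_projector m n (v : 'cV[C]_(m * n)) :
  ptrace2 (projector v) = unfold_vec v *m (unfold_vec v)^t*.
Proof.
apply/matrixP => i i'; rewrite !mxE; apply: eq_bigr => j _.
by rewrite /projector !mxE big_ord1 !mxE.
Qed.

Lemma unfold_swap_middle m n (M : 'M[C]_(m * n)) :
  unfold_vec (swap_middle (vec_of_op M)) = realign M.
Proof.
apply/matrixP => u w; rewrite !mxE mxtens_indexK.
case: (mxtens_unindex u) (mxtens_unindex w) => i i' [j j'].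
by rewrite mxE mxtens_indexK.
Qed.

Lemma reflected_entropyE m n (rho : 'M[C]_(m * n)) :
  reflected_entropy rho =
  entropy (realign (sqrtmx rho) *m (realign (sqrtmx rho))^t*).
Proof. by rewrite /reflected_entropy ptrace2_projector unfold_swap_middle. Qed.

Lemma sandwichE a b a' b' (A : 'M[C]_(a, a')) (B : 'M[C]_(b, b')) (M : 'M[C]_(a' * b')) i j i' j' :
  (tensmx A B *m M *m (tensmx A B)^t*) (mxtens_index (i, j)) (mxtens_index (i', j')) =
  \sum_p \sum_q \sum_p' \sum_q' A i p * B j q *
     M (mxtens_index (p, q)) (mxtens_index (p', q')) * (A i' p')^* * (B j' q')^*.
Proof.
rewrite -mulmxA mxE sum_mxtens; apply: eq_bigr => p _; apply: eq_bigr => q _.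
rewrite [X in _ * X]mxE mulr_sumr sum_mxtens; apply: eq_bigr => p' _; apply: eq_bigr => q' _.
by rewrite tensmxE adjmxE tensmxE rmorphM /= !mulrA.
Qed.

Lemma isometryE m n (B : 'M[C]_(m, n)) : B^t* *m B = 1%:M ->
  forall q q', \sum_j (B j q')^* * B j q = (q == q')%:R.
Proof.
move=> BB q q'; have := congr1 (fun M : 'M_n => M q' q) BB.
by rewrite !mxE eq_sym => <-; apply: eq_bigr => j _; rewrite adjmxE.
Qed.

Section Sandwich.
Variables (a b a' b' : nat) (A : 'M[C]_(a, a')) (B : 'M[C]_(b, b')).
Hypotheses (AA : A^t* *m A = 1%:M) (BB : B^t* *m B = 1%:M).
Variable M : 'M[C]_(a' * b').
Let V := tensmx A B.

Lemma ptrace2_sandwich : ptrace2 (V *m M *m V^t*) = A *m ptrace2 M *m A^t*.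
Proof.
apply/matrixP => i i'; rewrite mxE; under eq_bigr do rewrite sandwichE.
rewrite exchange_big -mulmxA mxE; apply: eq_bigr => p _ /=.
rewrite mxE mulr_sumr.
under eq_bigr do rewrite exchange_big.
rewrite exchange_big; apply: eq_bigr => p' _ /=.
rewrite adjmxE mxE mulr_suml mulr_sumr exchange_big; apply: eq_bigr => q _ /=.
rewrite exchange_big /= (bigD1 q) //= [X in _ + X]big1 ?addr0 => [|q' qq'].
  rewrite (eq_bigr (fun j => A i p * M (mxtens_index (p, q)) (mxtens_index (p',
    q)) * (A i' p')^* * ((B j q)^* * B j q))); last by move=> j _; ring.
  by rewrite -mulr_sumr isometryE // eqxx mulr1; ring.
rewrite (eq_bigr (fun j => A i p * M (mxtens_index (p, q)) (mxtens_index (p',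
  q')) * (A i' p')^* * ((B j q')^* * B j q))); last by move=> j _; ring.
by rewrite -mulr_sumr isometryE // eq_sym (negPf qq') mulr0.
Qed.

Lemma ptrace1_sandwich : ptrace1 (V *m M *m V^t*) = B *m ptrace1 M *m B^t*.
Proof.
apply/matrixP => j j'; rewrite mxE; under eq_bigr do rewrite sandwichE.
under eq_bigr do rewrite exchange_big.
rewrite exchange_big -mulmxA mxE; apply: eq_bigr => q _ /=.
rewrite mxE mulr_sumr.
under eq_bigr do under eq_bigr do rewrite exchange_big.
under eq_bigr do rewrite exchange_big.
rewrite exchange_big; apply: eq_bigr => q' _ /=.
rewrite adjmxE mxE mulr_suml mulr_sumr exchange_big; apply: eq_bigr => p _ /=.
rewrite exchange_big /= (bigD1 p) //= [X in _ + X]big1 ?addr0 => [|p' pp'].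
  rewrite (eq_bigr (fun i => B j q * M (mxtens_index (p, q)) (mxtens_index (p,
    q')) * (B j' q')^* * ((A i p)^* * A i p))); last by move=> i _; ring.
  by rewrite -mulr_sumr isometryE // eqxx mulr1; ring.
rewrite (eq_bigr (fun i => B j q * M (mxtens_index (p, q)) (mxtens_index (p',
  q')) * (B j' q')^* * ((A i p')^* * A i p))); last by move=> i _; ring.
by rewrite -mulr_sumr isometryE // eq_sym (negPf pp') mulr0.
Qed.

Lemma realign_sandwich :
  realign (V *m M *m V^t*) = tensmx A (map_mx Num.conj A) *m realign M *m (tensmx B (map_mx Num.conj B))^T.
Proof.
apply/matrixP => u w; case: (mxtens_indexP u) => i i'; case: (mxtens_indexP w) => j j'.
rewrite realignE sandwichE -mulmxA mxE sum_mxtens; apply: eq_bigr => p _.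
rewrite exchange_big; apply: eq_bigr => p' _ /=.
rewrite [X in _ * X]mxE mulr_sumr sum_mxtens; apply: eq_bigr => q _; apply: eq_bigr => q' _.
rewrite realignE [_^T _ _]mxE !tensmxE !mxE; ring.
Qed.

End Sandwich.

Lemma conj_isometry m n (A : 'M[C]_(m, n)) :
  A^t* *m A = 1%:M -> (map_mx Num.conj A)^t* *m map_mx Num.conj A = 1%:M.
Proof. by move=> AA; rewrite map_trmx -map_mxM AA map_mx1. Qed.

Lemma entropy_isometry m n (V : 'M[C]_(m, n)) (M : 'M[C]_n) :
  V^t* *m V = 1%:M -> M^t* = M -> entropy (V *m M *m V^t*) = entropy M.
Proof.
move=> VV hM; have [w [v [von E _]]] := herm_eigenbasis hM.
have von' k l : xpredT k -> xpredT l -> (v k)^t* *m v l = (k == l)%:R%:M by [].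
have Von k l : xpredT k -> xpredT l -> (V *m v k)^t* *m (V *m v l) = (k == l)%:R%:M.
  by move=> _ _; rewrite adjmxM mulmxA -(mulmxA ((v k)^t*)) VV mulmx1 von.
rewrite E (entropy_sum w von') -(entropy_sum w Von); congr entropy.
rewrite mulmx_sumr mulmx_suml; apply: eq_bigr => k _.
by rewrite -scalemxAr -scalemxAl /projector adjmxM !mulmxA.
Qed.

Lemma hermfun_isometry f m n (V : 'M[C]_(m, n)) (M : 'M[C]_n) : f 0 = 0 ->
  V^t* *m V = 1%:M -> M^t* = M -> hermfun f (V *m M *m V^t*) = V *m hermfun f M *m V^t*.
Proof.
move=> f0 VV hM; have [w [v [von E _]]] := herm_eigenbasis hM.
have von' k l : xpredT k -> xpredT l -> (v k)^t* *m v l = (k == l)%:R%:M by [].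
have Von k l : xpredT k -> xpredT l -> (V *m v k)^t* *m (V *m v l) = (k == l)%:R%:M.
  by move=> _ _; rewrite adjmxM mulmxA -(mulmxA ((v k)^t*)) VV mulmx1 von.
have S (x : 'I_n -> R) : V *m (\sum_k (x k)%:C *: projector (v k)) *m V^t* =
    \sum_(k | xpredT k) (x k)%:C *: projector (V *m v k).
  rewrite mulmx_sumr mulmx_suml; apply: eq_bigr => k _.
  by rewrite -scalemxAr -scalemxAl /projector adjmxM !mulmxA.
by rewrite {1}E S (hermfun_sum w Von f0) {1}E (hermfun_sum w von' f0) S.
Qed.

Lemma adj_ptrace2 m n (M : 'M[C]_(m * n)) : M^t* = M -> (ptrace2 M)^t* = ptrace2 M.
Proof.
move=> hM; apply/matrixP => i j; rewrite adjmxE !mxE rmorph_sum.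
by apply: eq_bigr => k _ /=; rewrite -adjmxE hM.
Qed.

Lemma adj_ptrace1 m n (M : 'M[C]_(m * n)) : M^t* = M -> (ptrace1 M)^t* = ptrace1 M.
Proof.
move=> hM; apply/matrixP => i j; rewrite adjmxE !mxE rmorph_sum.
by apply: eq_bigr => k _ /=; rewrite -adjmxE hM.
Qed.

(** This permits passing to the supports of the marginals, where these are invertible. A local
    isometry acts on the dual copy by its conjugate, so the realigned square root is only multiplied
    by an isometry on each side. *)
Lemma markov_gap_isometry a b a' b' (A : 'M[C]_(a, a')) (B : 'M[C]_(b, b'))
    (M : 'M[C]_(a' * b')) :
  A^t* *m A = 1%:M -> B^t* *m B = 1%:M -> M^t* = M ->
  markov_gap (tensmx A B *m M *m (tensmx A B)^t*) = markov_gap M.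
Proof.
move=> AA BB hM; have VV := tensmx_isometry AA BB.
rewrite /markov_gap /mutual_information entropy_isometry //.
rewrite ptrace2_sandwich // ptrace1_sandwich // !entropy_isometry ?adj_ptrace1 ?adj_ptrace2 //.
congr (_ - _); rewrite !reflected_entropyE /sqrtmx hermfun_isometry ?sqrtr0 //.
set N := hermfun _ M; rewrite realign_sandwich.
set W := tensmx B _; set U := tensmx A _; set X := realign N.
have WW : W^t* *m W = 1%:M by apply: tensmx_isometry => //; apply: conj_isometry.
have UU : U^t* *m U = 1%:M by apply: tensmx_isometry => //; apply: conj_isometry.
rewrite !adjmxM !mulmxA -(mulmxA (U *m X)) trmx_mul_adj WW trmx1 mulmx1 -(mulmxA U).
by rewrite entropy_isometry // adjmxM trmxCK.
Qed.

End TensorIndices.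

(** * Vanishing Markov gap in eigenbases of the marginals *)

Section PairSums.

Lemma sum_pair (V : nmodType) (I J : finType) (F : I * J -> V) :
  \sum_p F p = \sum_i \sum_j F (i, j).
Proof. by rewrite pair_bigA /=; apply: eq_bigr => -[]. Qed.

Lemma sum_mxtens_pair (V : nmodType) m n (F : 'I_(m * n) -> V) :
  \sum_u F u = \sum_p F (mxtens_index p).
Proof. by rewrite sum_mxtens sum_pair. Qed.

Lemma sum_deltar (A : pzSemiRingType) (I : finType) (F : I -> A) k :
  \sum_i F i * (i == k)%:R = F k.
Proof.
rewrite (bigD1 k) //= eqxx mulr1 big1 ?addr0 // => i /negPf ->.
by rewrite mulr0.
Qed.

End PairSums.

Section Entropies.
Variable R : realType.
Local Notation C := R[i].

Lemma entropy_rdiag n (d : 'I_n -> R) : entropy (rdiag d) = - \sum_i d i * ln (d i).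
Proof.
have von (k l : 'I_n) : xpredT k -> xpredT l ->
    (delta_mx k 0 : 'cV[C]_n)^t* *m delta_mx l 0 = (k == l)%:R%:M.
  move=> _ _; rewrite trmx_delta map_delta_mx mul_delta_mx_cond.
  by apply/matrixP => i j; rewrite !ord1 !mxE; case: eqP => _; rewrite !mxE /= ?mulr1n ?mulr0n.
rewrite -(entropy_sum d von); congr entropy; apply/matrixP => i j.
rewrite rdiagE summxE (bigD1 j) //= big1 ?addr0 => [|k kj].
  by rewrite /projector trmx_delta map_delta_mx mul_delta_mx !mxE !eqxx andbT mulr_natr.
rewrite /projector trmx_delta map_delta_mx mul_delta_mx !mxE [j == k]eq_sym (negPf kj).
by rewrite andbF mulr0.
Qed.

Lemma ip_orthonormal_vectors n (I : finType) (v : I -> 'cV[C]_n) :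
  orthonormal_vectors v -> orthonormal_family (fun k u => v k u 0).
Proof.
move=> von k l; have := congr1 (fun M : 'M_1 => M 0 0) (von k l).
by rewrite !mxE eqxx mulr1n => <-; apply: eq_bigr => u _; rewrite adjmxE.
Qed.

Lemma orthonormal_vectors_normsq n (I : finType) (v : I -> 'cV[C]_n) k :
  orthonormal_vectors v -> \sum_u normsq (v k u 0) = 1.
Proof.
move=> /ip_orthonormal_vectors/(_ k k); rewrite ip_normsq eqxx => E.
by apply: (@complexI R); rewrite E.
Qed.

End Entropies.

(** * The relative modular operators of the canonical purification *)

Section Flattening.
Variables (R : realType) (a b : nat).
Local Notation C := R[i].
Variables (N : nat) (X : 'M[C]_(a * b, N)) (al : 'I_a -> R) (be : 'I_b -> R).
Let rho := X *m X^t*.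
Hypotheses (al0 : forall i, 0 < al i) (be0 : forall j, 0 < be j).
Hypotheses (rhoA : ptrace2 rho = rdiag al) (rhoB : ptrace1 rho = rdiag be).
Hypothesis gap0 : markov_gap rho = 0.

Let M := sqrtmx rho.
Let G := hermfun (fun t => (Num.sqrt t)^-1) (realign M *m (realign M)^t*) *m realign M.

Variables (L : finType) (r : L -> R) (w : L -> 'cV[C]_(a * b)).
Hypotheses (r0 : forall m, 0 < r m) (won : orthonormal_vectors w).
Hypothesis rhoE : rho = \sum_m (r m)%:C *: projector (w m).

Variables (K : finType) (sg : K -> R) (x : K -> 'cV[C]_(a * a)) (y : K -> 'cV[C]_(b * b)).
Hypotheses (sg0 : forall k, 0 < sg k).
Hypotheses (xon : orthonormal_vectors x) (yon : orthonormal_vectors y).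
Hypothesis realignM : realign M = \sum_k (sg k)%:C *: (x k *m (y k)^T).

Let won' k l : xpredT k -> xpredT l -> (w k)^t* *m w l = (k == l)%:R%:M.
Proof. by []. Qed.

Let xon' k l : xpredT k -> xpredT l -> (x k)^t* *m x l = (k == l)%:R%:M.
Proof. by []. Qed.

Lemma sqrt_rhoE : M = \sum_m (Num.sqrt (r m))%:C *: projector (w m).
Proof. by rewrite /M /sqrtmx rhoE (hermfun_sum r won') // sqrtr0. Qed.

Lemma adj_rho : rho^t* = rho.
Proof. by rewrite /rho adjmxM trmxCK. Qed.

Lemma adj_sqrt_rho : M^t* = M.
Proof. by apply: adj_hermfun; apply: adj_rho. Qed.

Lemma sqrt_rho_sqr : M *m M = rho.
Proof.
rewrite rhoE {2}sqrt_rhoE mulmx_sumr; apply: eq_bigr => k _.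
rewrite /projector -scalemxAr mulmxA sqrt_rhoE (projector_sum_mul _ won') //.
by rewrite -scalemxAl scalerA -rmorphM -expr2 sqr_sqrtr // ltW.
Qed.

Lemma rho_entry u v : rho u v = \sum_m (r m)%:C * (w m u 0 * (w m v 0)^*).
Proof.
rewrite {1}rhoE summxE; apply: eq_bigr => m _.
by rewrite !mxE big_ord1 !mxE.
Qed.

Lemma sqrt_rho_entry u v : M u v = \sum_m (Num.sqrt (r m))%:C * (w m u 0 * (w m v 0)^*).
Proof.
rewrite {1}sqrt_rhoE summxE; apply: eq_bigr => m _.
by rewrite !mxE big_ord1 !mxE.
Qed.

Lemma realign_entry p q :
  M (mxtens_index (p.1, q.1)) (mxtens_index (p.2, q.2)) =
  \sum_k (sg k)%:C * y k (mxtens_index q) 0 * x k (mxtens_index p) 0.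
Proof.
case: p q => i i' [j j']; rewrite -realignE realignM summxE; apply: eq_bigr => k _.
by rewrite !mxE big_ord1 !mxE -mulrA [y _ _ _ * _]mulrC.
Qed.

Lemma rhoA_entry i i' :
  \sum_j rho (mxtens_index (i, j)) (mxtens_index (i', j)) = (al i')%:C *+ (i == i').
Proof. by rewrite -rdiagE -rhoA mxE. Qed.

Lemma rhoB_entry j j' :
  \sum_i rho (mxtens_index (i, j)) (mxtens_index (i, j')) = (be j')%:C *+ (j == j').
Proof. by rewrite -rdiagE -rhoB mxE. Qed.

Lemma rho_sqrt_entry u v : rho u v = \sum_t (M t u)^* * M t v.
Proof.
rewrite -sqrt_rho_sqr mxE; apply: eq_bigr => t _.
by rewrite -{1}adj_sqrt_rho adjmxE.
Qed.

Lemma rho_sqrt_entry' u v : rho u v = \sum_t M u t * (M v t)^*.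
Proof.
rewrite -sqrt_rho_sqr mxE; apply: eq_bigr => t _.
by rewrite -{2}adj_sqrt_rho adjmxE.
Qed.

(** Tracing the dual copy of A out of the Gram matrix of [realign M] gives the A marginal of
    [M M^*], which is rho since [M] is Hermitian. *)
Lemma sqrt_rho_row_gram i1 i1' :
  \sum_i2 \sum_k (sg k ^+ 2)%:C *
     (x k (mxtens_index (i1, i2)) 0 * (x k (mxtens_index (i1', i2)) 0)^*) =
  (al i1')%:C *+ (i1 == i1').
Proof.
have G2 := svd_gram sg x yon; rewrite -realignM in G2.
rewrite -rhoA_entry; under [RHS]eq_bigr do rewrite rho_sqrt_entry' sum_mxtens.
rewrite [RHS]exchange_big /=; apply: eq_bigr => i2 _.
have := congr1 (fun Z : 'M_(a * a) => Z (mxtens_index (i1, i2)) (mxtens_index (i1', i2))) G2.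
rewrite mxE sum_mxtens summxE.
under [X in X = _ -> _]eq_bigr do under eq_bigr do rewrite adjmxE !realignE.
move=> ->; apply: eq_bigr => k _; by rewrite !mxE big_ord1 !mxE.
Qed.

(** The [y k] with weights [sg k ^+ 2] make up the state of B and its dual copy. Its diagonal on the
    dual factor comes from [M^* M = rho]. *)
Lemma sqrt_rho_col_norm l :
  \sum_j \sum_k sg k ^+ 2 * normsq (y k (mxtens_index (j, l)) 0) = be l.
Proof.
apply: (@complexI R); have := rhoB_entry l l; rewrite eqxx mulr1n => <-.
under [RHS]eq_bigr do rewrite rho_sqrt_entry sum_mxtens.
under [RHS]eq_bigr do rewrite exchange_big.
rewrite [RHS]exchange_big rmorph_sum; apply: eq_bigr => j _ /=.
pose c k := (sg k)%:C * y k (mxtens_index (j, l)) 0; pose f k u := x k u 0.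
have E i1 i2 : M (mxtens_index (i1, j)) (mxtens_index (i2, l)) =
   lincomb c f (mxtens_index (i1, i2)).
  by rewrite (realign_entry (i1, i2) (j, l)).
under [RHS]eq_bigr do under eq_bigr do rewrite E.
rewrite [RHS]exchange_big /=.
transitivity (ip (lincomb c f) (lincomb c f)); last by rewrite /ip sum_mxtens.
rewrite (ip_on2 _ _ (ip_orthonormal_vectors xon)).
rewrite rmorph_sum; apply: eq_bigr => k _ /=.
by rewrite /c !rmorphM /= normsqE conjC_real; ring.
Qed.

Local Notation T := ('I_a * 'I_a * ('I_b * 'I_b))%type.
Local Notation P := (K * ('I_b * 'I_b))%type.
Local Notation Q := ('I_a * 'I_b * L)%type.

(** [e], [lam] and [xc] are the eigenvectors and eigenvalues of D1 and the coordinates of xi in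
    them; [g], [mu] and [yc] are the same for D2. An index [t] lists A, the dual of A, B and the
    dual of B. The vectors [w] are conjugated in [g] because there they sit in the dual factors. *)
Let e (p : P) (t : T) : C := x p.1 (mxtens_index t.1) 0 * (t.2 == p.2)%:R.
Let g (q : Q) (t : T) : C :=
  (w q.2 (mxtens_index (t.1.2, t.2.2)) 0)^* * ((t.1.1, t.2.1) == q.1)%:R.
Let lam (p : P) : R := sg p.1 ^+ 2 / be p.2.2.
Let mu (q : Q) : R := al q.1.1 / r q.2.
Let xc (p : P) : C := (sg p.1)%:C * y p.1 (mxtens_index p.2) 0.
Let yc (q : Q) : C := (Num.sqrt (r q.2))%:C * w q.2 (mxtens_index q.1) 0.

Lemma lincomb_e c t :
  lincomb c e t = \sum_k c (k, t.2) * x k (mxtens_index t.1) 0.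
Proof.
rewrite /lincomb sum_pair; apply: eq_bigr => k _; rewrite /e /=.
rewrite -[RHS](sum_deltar (fun q => c (k, q) * x k (mxtens_index t.1) 0)).
by apply: eq_bigr => q _; rewrite mulrA eq_sym.
Qed.

Lemma lincomb_g c t :
  lincomb c g t = \sum_m c ((t.1.1, t.2.1), m) * (w m (mxtens_index (t.1.2, t.2.2)) 0)^*.
Proof.
rewrite /lincomb sum_pair exchange_big; apply: eq_bigr => m _; rewrite /g /=.
rewrite -[RHS](sum_deltar (fun q => c (q, m) * (w m (mxtens_index (t.1.2, t.2.2)) 0)^*)).
by apply: eq_bigr => q _; rewrite mulrA eq_sym.
Qed.

Lemma orthonormal_e : orthonormal_family e.
Proof.
move=> [k q] [k' q']; rewrite /ip sum_pair xpair_eqE -mulnb natrM.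
rewrite -(ip_orthonormal_vectors xon k k') /ip sum_mxtens_pair mulr_suml.
apply: eq_bigr => t1 _; rewrite /e /=.
rewrite -(sum_deltar (fun t => (x k (mxtens_index t1) 0)^* * x k' (mxtens_index t1) 0 * (t == q')%:R)).
by apply: eq_bigr => t2 _; rewrite rmorphM /= conjC_nat; ring.
Qed.

Lemma orthonormal_g : orthonormal_family g.
Proof.
move=> [[i j] m] [[i' j'] m']; rewrite /ip sum_pair.
under eq_bigr do rewrite sum_pair.
rewrite sum_pair.
transitivity (\sum_i0 \sum_j0 ((i0, j0) == (i, j))%:R * ((i0, j0) == (i', j'))%:R *
    \sum_i1 \sum_l (w m (mxtens_index (i1, l)) 0) * (w m' (mxtens_index (i1, l)) 0)^* : C).
  apply: eq_bigr => i0 _; rewrite exchange_big; apply: eq_bigr => j0 _.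
  rewrite mulr_sumr; apply: eq_bigr => i1 _; rewrite mulr_sumr; apply: eq_bigr => l _.
  by rewrite /g !rmorphM /= conjC_nat conjCK; ring.
have -> : \sum_i1 \sum_l w m (mxtens_index (i1, l)) 0 * (w m' (mxtens_index (i1, l)) 0)^* =
    (m == m')%:R.
  rewrite -(sum_mxtens (fun u => w m u 0 * (w m' u 0)^*)).
  rewrite eq_sym -(ip_orthonormal_vectors won m' m); apply: eq_bigr => u _.
  by rewrite mulrC.
rewrite pair_bigA /= -mulr_suml [in RHS]xpair_eqE -mulnb natrM; congr (_ * _).
rewrite (eq_bigr (fun p => (p == (i', j'))%:R * (p == (i, j))%:R)); last by move=> [? ?] _; rewrite mulrC.
by rewrite (sum_deltar (fun p => (p == (i', j'))%:R)).
Qed.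

Lemma lam_gt0 p : 0 < lam p.
Proof. by rewrite divr_gt0 ?exprn_gt0. Qed.

Lemma mu_gt0 q : 0 < mu q.
Proof. by rewrite divr_gt0. Qed.

Lemma coords_eq : lincomb xc e =1 lincomb yc g.
Proof.
move=> [[i i'] [j l]]; rewrite lincomb_e lincomb_g /=.
rewrite -(realign_entry (i, i') (j, l)) sqrt_rho_entry.
by apply: eq_bigr => m _; rewrite mulrA.
Qed.

(* [tr (Lambda v v^* ) = sum_i al_i |v_i|^2]: Lambda has marginal rho_A. *)
Lemma sqrt_rho_row_form (v : 'I_a -> C) :
  \sum_k sg k ^+ 2 * (\sum_i2 normsq (\sum_i1 (x k (mxtens_index (i1, i2)) 0)^* * v i1)) =
  \sum_i al i * normsq (v i).
Proof.
apply: (@complexI R); rewrite !rmorph_sum /=.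
transitivity (\sum_i1 \sum_i1' (v i1)^* * v i1' * (\sum_i2 \sum_k (sg k ^+ 2)%:C *
     (x k (mxtens_index (i1, i2)) 0 * (x k (mxtens_index (i1', i2)) 0)^*))).
  under [RHS]eq_bigr do under eq_bigr do rewrite exchange_big mulr_sumr.
  under [RHS]eq_bigr do rewrite exchange_big.
  rewrite [RHS]exchange_big; apply: eq_bigr => k _ /=.
  rewrite rmorphM rmorph_sum mulr_sumr.
  under [RHS]eq_bigr do under eq_bigr do rewrite mulr_sumr.
  under [RHS]eq_bigr do rewrite exchange_big.
  rewrite [RHS]exchange_big; apply: eq_bigr => i2 _ /=.
  rewrite normsqE rmorph_sum mulr_suml mulr_sumr; apply: eq_bigr => i1 _.
  rewrite mulr_sumr mulr_sumr; apply: eq_bigr => i1' _ /=.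
  by rewrite [(_ * v i1)^*]rmorphM /= conjCK; ring.
apply: eq_bigr => i _; under eq_bigr do rewrite sqrt_rho_row_gram.
rewrite (bigD1 i) //= big1 ?addr0 => [|i' ii'].
  by rewrite eqxx mulr1n rmorphM /= normsqE mulrC.
by rewrite eq_sym (negPf ii') mulr0n mulr0.
Qed.

(** This is the isometry that gives D1 <= D2; its orthonormality expresses that the B marginal of
    rho is [rdiag be]. *)
Lemma sqrt_rho_col_orthonormal : orthonormal_family (fun l (t : 'I_(a * b) * 'I_a) =>
   (M t.1 (mxtens_index (t.2, l)))^* / (Num.sqrt (be l))%:C).
Proof.
move=> l l'; rewrite /ip.
transitivity ((Num.sqrt (be l))%:C^-1 / (Num.sqrt (be l'))%:C *
    \sum_i \sum_u ((M u (mxtens_index (i, l')))^* * M u (mxtens_index (i, l)))).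
  rewrite sum_pair exchange_big mulr_sumr; apply: eq_bigr => i _.
  rewrite mulr_sumr; apply: eq_bigr => u _ /=.
  by rewrite rmorphM /= conjCK fmorphV /= conjC_real; ring.
under eq_bigr do rewrite -rho_sqrt_entry.
rewrite rhoB_entry eq_sym; case: eqP => [->|_]; last by rewrite mulr0n mulr0.
rewrite mulr1n -invfM -rmorphM -expr2 sqr_sqrtr ?ltW // mulVf // fmorph_eq0.
by rewrite gt_eqF.
Qed.

(** The factor [1 / be l] in D1 is the one that normalizes the columns of [M], so the sum over [l]
    is controlled by Bessel. The sum over [k] then sees only the marginal rho_A and yields the form
    of D2. *)
Lemma compressed_form_le (c : Q -> C) :
  \sum_p lam p * normsq (ip (e p) (lincomb c g)) <= \sum_q mu q * normsq (c q).
Proof.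
(* [Y] is the given vector with rho^(-1/2) applied in the dual factors, so that a factor [M] can be
   split off; [Z] is its contraction with [x k] over A. *)
pose Y ij u := \sum_m c (ij, m) / (Num.sqrt (r m))%:C * (w m u 0)^*.
pose Z k j (t : 'I_(a * b) * 'I_a) : C :=
  \sum_i1 (x k (mxtens_index (i1, t.2)) 0)^* * Y (i1, j) t.1.
have gY i i' j l : lincomb c g ((i, i'), (j, l)) =
    \sum_u Y (i, j) u * M u (mxtens_index (i', l)).
  rewrite lincomb_g /=.
  under [RHS]eq_bigr do rewrite mulr_suml.
  rewrite exchange_big; apply: eq_bigr => m _ /=.
  transitivity (c (i, j, m) / (Num.sqrt (r m))%:C * ((w m)^t* *m M) 0 (mxtens_index (i', l))).
    have -> : (w m)^t* *m M = (Num.sqrt (r m))%:C *: (w m)^t*.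
      apply: (@adjmx_inj _ 1 (a * b)); rewrite adjmxM adjmxZ trmxCK conjC_real adj_sqrt_rho.
      by rewrite sqrt_rhoE (projector_sum_mul _ won').
    rewrite !mxE mulrA mulfVK // fmorph_eq0 gt_eqF // sqrtr_gt0 //.
  rewrite mxE mulr_sumr; apply: eq_bigr => u _; rewrite adjmxE; ring.
have dE k j l : ip (e (k, (j, l))) (lincomb c g) = (Num.sqrt (be l))%:C *
    ip (fun t : 'I_(a * b) * 'I_a => (M t.1 (mxtens_index (t.2, l)))^* / (Num.sqrt (be l))%:C) (Z k j).
  rewrite /ip sum_pair sum_pair [RHS]mulr_sumr [RHS]sum_pair.
  transitivity (\sum_i1 \sum_i2 (x k (mxtens_index (i1, i2)) 0)^* *
      lincomb c g ((i1, i2), (j, l))).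
    apply: eq_bigr => i1 _; apply: eq_bigr => i2 _.
    rewrite -(sum_deltar (fun t => (x k (mxtens_index (i1, i2)) 0)^* * lincomb c g (i1, i2, t)) (j, l)) /=.
    by apply: eq_bigr => t2 _; rewrite /e /= rmorphM /= conjC_nat; ring.
  rewrite exchange_big [RHS]exchange_big; apply: eq_bigr => i2 _ /=.
  rewrite /Z /=; under [RHS]eq_bigr do rewrite !mulr_sumr.
  rewrite [RHS]exchange_big; apply: eq_bigr => i1 _ /=.
  rewrite gY mulr_sumr; apply: eq_bigr => u _.
  rewrite rmorphM /= conjCK fmorphV /= conjC_real.
  field; rewrite fmorph_eq0 gt_eqF // sqrtr_gt0 //.
have -> : \sum_p lam p * normsq (ip (e p) (lincomb c g)) =
   \sum_k sg k ^+ 2 * \sum_j \sum_l normsq (ip (fun t : 'I_(a * b) * 'I_a =>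
      (M t.1 (mxtens_index (t.2, l)))^* / (Num.sqrt (be l))%:C) (Z k j)).
  rewrite sum_pair; apply: eq_bigr => k _; rewrite sum_pair mulr_sumr.
  apply: eq_bigr => j _; rewrite mulr_sumr; apply: eq_bigr => l _.
  rewrite dE normsqM normsqr sqr_sqrtr ?ltW // /lam /=.
  by rewrite mulrA mulfVK // gt_eqF.
(* The only inequality: Bessel in the index [l], for each [k] and [j]. All other steps are
   equalities. *)
apply: (@le_trans _ _ (\sum_k sg k ^+ 2 * \sum_j \sum_t normsq (Z k j t))).
  apply: ler_sum => k _; rewrite ler_wpM2l ?sqr_ge0 // ler_sum // => j _.
  exact: bessel sqrt_rho_col_orthonormal.
under eq_bigr do rewrite mulr_sumr.
rewrite exchange_big /=.
have -> : \sum_j \sum_k sg k ^+ 2 * (\sum_t normsq (Z k j t)) =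
    \sum_j \sum_u \sum_i al i * normsq (Y (i, j) u).
  apply: eq_bigr => j _.
  under eq_bigr do rewrite sum_pair mulr_sumr.
  rewrite exchange_big; apply: eq_bigr => u _ /=.
  by rewrite -sqrt_rho_row_form.
under [leLHS]eq_bigr do rewrite exchange_big.
rewrite exchange_big [leRHS]sum_pair sum_pair /= le_eqVlt; apply/orP; left; apply/eqP.
apply: eq_bigr => i _; apply: eq_bigr => j _; rewrite -mulr_sumr.
under [RHS]eq_bigr do rewrite /mu /= -mulrA.
rewrite -mulr_sumr; congr (_ * _); apply: (@complexI R).
rewrite -ip_normsq.
transitivity (ip (lincomb (fun m => c ((i, j), m) / (Num.sqrt (r m))%:C)
    (fun m u => (w m u 0)^*)) (lincomb (fun m => c ((i, j), m) / (Num.sqrt (r m))%:C)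
    (fun m u => (w m u 0)^*))); first by [].
rewrite ip_on2 => [|m m']; last first.
  rewrite eq_sym -(ip_orthonormal_vectors won m' m); apply: eq_bigr => u _.
  by rewrite conjCK mulrC.
rewrite rmorph_sum; apply: eq_bigr => m _ /=.
rewrite -normsqE normsqM -[_^-1]fmorphV normsqr exprVn sqr_sqrtr ?ltW //.
by rewrite mulrC.
Qed.
(** The left side is S_B - S_R and the right side S_AB - S_A, so the equality is the vanishing gap
    rearranged. *)
Lemma log_expectation_eq :
  \sum_p normsq (xc p) * ln (lam p) = \sum_q normsq (yc q) * ln (mu q).
Proof.
have xE : \sum_p normsq (xc p) * ln (lam p) =
    \sum_k sg k ^+ 2 * ln (sg k ^+ 2) - \sum_l be l * ln (be l).
  have -> : \sum_p normsq (xc p) * ln (lam p) = \sum_k \sum_j \sum_l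
      (sg k ^+ 2 * ln (sg k ^+ 2) * normsq (y k (mxtens_index (j, l)) 0)
       - sg k ^+ 2 * normsq (y k (mxtens_index (j, l)) 0) * ln (be l)).
    rewrite sum_pair; apply: eq_bigr => k _; rewrite sum_pair.
    apply: eq_bigr => j _; apply: eq_bigr => l _.
    rewrite /xc /lam /= normsqM normsqr ln_div ?posrE ?exprn_gt0 //; ring.
  under eq_bigr do under eq_bigr do rewrite sumrB.
  under eq_bigr do rewrite sumrB.
  rewrite sumrB; congr (_ - _).
    apply: eq_bigr => k _; under eq_bigr do rewrite -mulr_sumr.
    by rewrite -mulr_sumr -(sum_mxtens (fun u => normsq (y k u 0))) orthonormal_vectors_normsq // mulr1.
  under eq_bigr do rewrite exchange_big.
  rewrite exchange_big; apply: eq_bigr => l _ /=.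
  rewrite -sqrt_rho_col_norm exchange_big mulr_suml; apply: eq_bigr => j _ /=.
  by rewrite mulr_suml.
have yE : \sum_q normsq (yc q) * ln (mu q) =
    \sum_i al i * ln (al i) - \sum_m r m * ln (r m).
  have -> : \sum_q normsq (yc q) * ln (mu q) = \sum_i \sum_j \sum_m
      (r m * normsq (w m (mxtens_index (i, j)) 0) * ln (al i)
       - r m * ln (r m) * normsq (w m (mxtens_index (i, j)) 0)).
    rewrite sum_pair sum_pair; apply: eq_bigr => i _; apply: eq_bigr => j _.
    apply: eq_bigr => m _.
    by rewrite /yc /mu /= normsqM normsqr sqr_sqrtr ?ltW // ln_div ?posrE //; ring.
  under eq_bigr do under eq_bigr do rewrite sumrB.
  under eq_bigr do rewrite sumrB.
  rewrite sumrB; congr (_ - _).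
    apply: eq_bigr => i _; under eq_bigr do rewrite -mulr_suml.
    rewrite -mulr_suml; congr (_ * _); apply: (@complexI R).
    have := rhoA_entry i i; rewrite eqxx mulr1n => <-.
    rewrite rmorph_sum; apply: eq_bigr => j _ /=; rewrite rho_entry rmorph_sum.
    by apply: eq_bigr => m _; rewrite /= rmorphM /= normsqE mulrC [_ * _^*]mulrC mulrC.
  under eq_bigr do rewrite exchange_big.
  rewrite exchange_big; apply: eq_bigr => m _ /=.
  under eq_bigr do rewrite -mulr_sumr.
  by rewrite -mulr_sumr -(sum_mxtens (fun u => normsq (w m u 0))) orthonormal_vectors_normsq // mulr1.
move: gap0; rewrite /markov_gap /mutual_information rhoA rhoB !entropy_rdiag.
rewrite reflected_entropyE -/M realignM (svd_gram sg x yon) (entropy_sum _ xon').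
rewrite {1}rhoE (entropy_sum r won') xE yE => E.
by lra.
Qed.

Theorem flattening i j i' j' :
  rho (mxtens_index (i, j)) (mxtens_index (i', j')) =
  (Num.sqrt (al i) * Num.sqrt (be j'))%:C * G (mxtens_index (i, i')) (mxtens_index (j, j')).
Proof.
have := log_equality orthonormal_e orthonormal_g lam_gt0 mu_gt0 coords_eq
  compressed_form_le log_expectation_eq (fun t => (Num.sqrt t)^-1%:C) ((i, i'), (j, j')).
rewrite lincomb_e lincomb_g /= => E.
have sal : (Num.sqrt (al i))%:C != 0 by rewrite fmorph_eq0 gt_eqF // sqrtr_gt0.
have sbe : (Num.sqrt (be j'))%:C != 0 by rewrite fmorph_eq0 gt_eqF // sqrtr_gt0.
(* The power -1/2 of D1 cancels [sg k] in the coordinates of xi, leaving the polar part [G]; that of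
   D2 turns [Num.sqrt (r m)] into [r m], leaving rho. *)
have E1 : (Num.sqrt (be j'))%:C * G (mxtens_index (i, i')) (mxtens_index (j, j')) =
   (Num.sqrt (al i))%:C^-1 * rho (mxtens_index (i, j)) (mxtens_index (i', j')).
  transitivity (\sum_k xc (k, (j, j')) * (Num.sqrt (lam (k, (j, j'))))^-1%:C *
                  x k (mxtens_index (i, i')) 0).
    rewrite /G realignM (polar_svd sg0 xon yon) summxE mulr_sumr; apply: eq_bigr => k _.
    rewrite /xc /lam /= sqrtrM ?sqr_ge0 // sqrtr_sqr gtr0_norm // sqrtrV ?ltW //.
    rewrite invfM invrK rmorphM fmorphV /= !mxE big_ord1 !mxE.
    by field; rewrite fmorph_eq0 gt_eqF.
  rewrite E rho_entry mulr_sumr; apply: eq_bigr => m _.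
  rewrite /yc /mu /= sqrtrM ?ltW // sqrtrV ?ltW // invfM invrK rmorphM fmorphV /=.
  have -> : (r m)%:C = (Num.sqrt (r m))%:C ^+ 2 by rewrite -rmorphXn sqr_sqrtr // ltW.
  by field.
by rewrite rmorphM -mulrA E1 mulrA divff // mul1r.
Qed.

End Flattening.

(** * Symmetry of the polar part and the flat form of rho *)

Section FlatForm.
Variable R : realType.
Local Notation C := R[i].

(** The antiunitary exchange of a space with its dual; it sends the vector of a matrix to the vector
    of its adjoint. *)
Definition flip_conj n (v : 'cV[C]_(n * n)) : 'cV[C]_(n * n) :=
  \col_u (v (mxtens_index ((mxtens_unindex u).2, (mxtens_unindex u).1)) 0)^*.

Lemma flip_conjE n (v : 'cV[C]_(n * n)) i i' :
  flip_conj v (mxtens_index (i, i')) 0 = (v (mxtens_index (i', i)) 0)^*.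
Proof. by rewrite mxE mxtens_indexK. Qed.

Lemma flip_conj_orthonormal n (I : eqType) (v : I -> 'cV[C]_(n * n)) :
  orthonormal_vectors v -> orthonormal_vectors (fun k => flip_conj (v k)).
Proof.
move=> von k l; rewrite eq_sym -von; apply/matrixP => s t; rewrite !ord1 !mxE !sum_mxtens.
rewrite exchange_big; apply: eq_bigr => i _; apply: eq_bigr => j _.
by rewrite !adjmxE !flip_conjE conjCK mulrC.
Qed.

Definition polar_part m n (A : 'M[C]_(m, n)) :=
  hermfun (fun t => (Num.sqrt t)^-1) (A *m A^t*) *m A.

(** Flipping all singular vectors gives a second singular value decomposition of the same realigned
    matrix, and the polar part does not depend on the decomposition. *)
Lemma polar_part_realign_herm m n (M : 'M[C]_(m * n)) i i' j j' : M^t* = M ->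
  polar_part (realign M) (mxtens_index (i', i)) (mxtens_index (j', j)) =
  (polar_part (realign M) (mxtens_index (i, i')) (mxtens_index (j, j')))^*.
Proof.
move=> hM; have [K [s [x [y [s0 xon yon E]]]]] := svd (realign M).
have E' : realign M = \sum_k (s k)%:C *: (flip_conj (x k) *m (flip_conj (y k))^T).
  apply/matrixP => u v; case: (mxtens_indexP u) => p p'; case: (mxtens_indexP v) => q q'.
  rewrite realignE -hM adjmxE -realignE E !summxE rmorph_sum; apply: eq_bigr => k _ /=.
  by rewrite !mxE !big_ord1 ![(_^T) _ _]mxE !flip_conjE !rmorphM /= conjC_real.
have P := polar_svd s0 xon yon; rewrite -E -/(polar_part _) in P.
have := polar_svd s0 (flip_conj_orthonormal xon) (flip_conj_orthonormal yon).
rewrite -E' -/(polar_part _) => P'.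
rewrite {1}P' P !summxE rmorph_sum; apply: eq_bigr => k _ /=.
by rewrite !mxE !big_ord1 ![(_^T) _ _]mxE !flip_conjE rmorphM.
Qed.

Lemma polar_part_isometry m n (A : 'M[C]_(m, n)) :
  polar_part A *m (polar_part A)^t* *m polar_part A = polar_part A.
Proof.
have [K [s [x [y [s0 xon yon E]]]]] := svd A.
rewrite E /polar_part (polar_svd s0 xon yon).
have xon' k l : xpredT k -> xpredT l -> (x k)^t* *m x l = (k == l)%:R%:M by [].
have one : \sum_k x k *m (y k)^T = \sum_k (1 : R)%:C *: (x k *m (y k)^T).
  by apply: eq_bigr => k _; rewrite scale1r.
rewrite {1 2}one svd_gram // mulmx_sumr; apply: eq_bigr => k _.
by rewrite mulmxA (projector_sum_mul (fun k => 1 ^+ 2) xon') // expr1n scale1r.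
Qed.

(** The last clause says that rho commutes with rho_A (x) rho_B^-1. It comes from comparing the flat
    form of an entry with the conjugate of the flat form of the transposed entry: the two contain
    the same entry of [G] with different square roots in front. *)
Theorem markov_gap0_flat a b N (X : 'M[C]_(a * b, N)) (al : 'I_a -> R) (be : 'I_b -> R) :
  let rho := X *m X^t* in
  (forall i, 0 < al i) -> (forall j, 0 < be j) ->
  ptrace2 rho = rdiag al -> ptrace1 rho = rdiag be -> markov_gap rho = 0 ->
  exists G : 'M[C]_(a * a, b * b),
  [/\ G *m G^t* *m G = G,
      forall i i' j j', rho (mxtens_index (i, j)) (mxtens_index (i', j')) =
        (Num.sqrt (al i) * Num.sqrt (be j'))%:C * G (mxtens_index (i, i')) (mxtens_index (j, j')) &
      forall i i' j j', rho (mxtens_index (i, j)) (mxtens_index (i', j')) != 0 ->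
        al i * be j' = al i' * be j].
Proof.
move=> rho al0 be0 rhoA rhoB gap0.
have [L [r [w [r0 won rhoE _]]]] := gram_positive_decomposition X.
have [K [sg [x [y [sg0 xon yon E]]]]] := svd (realign (sqrtmx rho)).
exists (polar_part (realign (sqrtmx rho))); split; first exact: polar_part_isometry.
  move=> i i' j j'.
  exact: (flattening al0 be0 rhoA rhoB gap0 r0 won rhoE sg0 xon yon E).
move=> i i' j j' rho0.
have F := flattening al0 be0 rhoA rhoB gap0 r0 won rhoE sg0 xon yon E.
have hrho : rho^t* = rho by rewrite /rho adjmxM trmxCK.
have hM : (sqrtmx rho)^t* = sqrtmx rho by apply: adj_hermfun.
have F1 := F i j i' j'; have F2 := F i' j' i j.
have hr u v : (rho u v)^* = rho v u by rewrite -adjmxE hrho.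
have := congr1 Num.conj F2; rewrite hr F1 [(_ * _)^*]rmorphM /= conjC_real.
rewrite -/(polar_part _) -(polar_part_realign_herm _ _ _ _ hM) -/(polar_part _) => H.
have G0 : polar_part (realign (sqrtmx rho)) (mxtens_index (i, i')) (mxtens_index (j, j')) != 0.
  by apply: contraNneq rho0 => G0; rewrite F1 [X in _ * X]G0 mulr0.
move/(mulIf G0)/complexI: H => H.
have := congr1 (fun t => t ^+ 2) H; rewrite !exprMn !sqr_sqrtr // ?ltW //.
Qed.

End FlatForm.

(** * Minimal projections of a twisted commutant *)

Section TwistedCommutant.
Variables (R : realType) (n : nat).
Local Notation C := R[i].
Local Notation MM := 'M[C]_n.
Variables (ZZ : MM -> Prop) (wt : 'I_n -> R) (PA : MM).
Hypothesis wt0 : forall i, 0 < wt i.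
Hypothesis ZZadj : forall Z, ZZ Z -> ZZ (Z^t*).
Let tau : MM := rdiag wt.

(* T is an eigenvector of the modular automorphism tau _ tau^-1 of the commutant of ZZ. *)
Definition twisted (d : R) (T : MM) :=
  (forall Z, ZZ Z -> Z *m T = T *m Z) /\ tau *m T = d%:C *: (T *m tau).

Hypotheses (PAadj : PA^t* = PA) (PAidem : PA *m PA = PA) (PAtw : twisted 1 PA).

(** For [d = 1] the twist means commuting with [tau]. This is therefore the commutant of [ZZ], [tau]
    and [PA], closed under adjoints and functional calculus, in which minimal projections exist. *)
Definition in_commutant T := twisted 1 T /\ PA *m T = T *m PA.

Lemma twistedM d1 d2 T1 T2 :
  twisted d1 T1 -> twisted d2 T2 -> twisted (d1 * d2) (T1 *m T2).
Proof.
move=> [z1 t1] [z2 t2]; split=> [Z ZZZ|].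
  by rewrite mulmxA z1 // -mulmxA z2 // mulmxA.
by rewrite mulmxA t1 -scalemxAl -mulmxA t2 -scalemxAr scalerA rmorphM mulmxA.
Qed.

Lemma twisted_adj d T : 0 < d -> twisted d T -> twisted d^-1 (T^t*).
Proof.
move=> d0 [z1 t1]; split=> [Z ZZZ|].
  apply: (@adjmx_inj _ n n); rewrite !adjmxM trmxCK.
  by rewrite -z1 //; apply: ZZadj.
apply: (@adjmx_inj _ n n); rewrite adjmxZ !adjmxM !trmxCK adj_rdiag t1 conjC_real.
by rewrite scalerA -rmorphM mulVf ?gt_eqF // scale1r.
Qed.

Lemma twistedZ d c T : twisted d T -> twisted d (c *: T).
Proof.
move=> [z1 t1]; split=> [Z ZZZ|]; first by rewrite -scalemxAl -scalemxAr z1.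
by rewrite -scalemxAr t1 -scalemxAl !scalerA mulrC.
Qed.

Lemma twistedD d T1 T2 : twisted d T1 -> twisted d T2 -> twisted d (T1 + T2).
Proof.
move=> [z1 t1] [z2 t2]; split=> [Z ZZZ|]; first by rewrite mulmxDl mulmxDr z1 // z2.
by rewrite mulmxDr t1 t2 mulmxDl scalerDr.
Qed.

Lemma twisted1 : twisted 1 1%:M.
Proof. by split=> [Z _|]; rewrite mulmx1 mul1mx ?scale1r. Qed.

Lemma commutantM T1 T2 : in_commutant T1 -> in_commutant T2 -> in_commutant (T1 *m T2).
Proof.
move=> [t1 p1] [t2 p2]; split; first by rewrite -[1]mulr1; apply: twistedM.
by rewrite mulmxA p1 -mulmxA p2 mulmxA.
Qed.

Lemma commutantD T1 T2 : in_commutant T1 -> in_commutant T2 -> in_commutant (T1 + T2).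
Proof.
move=> [t1 p1] [t2 p2]; split; first exact: twistedD.
by rewrite mulmxDr p1 p2 mulmxDl.
Qed.

Lemma commutantZ c T : in_commutant T -> in_commutant (c *: T).
Proof.
move=> [t1 p1]; split; first exact: twistedZ.
by rewrite -scalemxAr p1 scalemxAl.
Qed.

Lemma commutant_adj T : in_commutant T -> in_commutant (T^t*).
Proof.
move=> [t1 p1]; split; first by rewrite -[1]invr1; apply: twisted_adj.
by apply: (@adjmx_inj _ n n); rewrite !adjmxM trmxCK PAadj p1.
Qed.

Lemma commutant1 : in_commutant 1%:M.
Proof. by split; [exact: twisted1 | rewrite mulmx1 mul1mx]. Qed.

Lemma commutant_hermfun f S : S^t* = S -> in_commutant S -> in_commutant (hermfun f S).
Proof.
move=> hS [[zS tS] pS]; split; last by apply: hermfun_comm.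
split=> [Z ZZZ|]; first by apply: hermfun_comm => //; apply: zS.
by rewrite scale1r; apply: hermfun_comm => //; rewrite tS scale1r.
Qed.

Definition commutant_projection (e : MM) :=
  [/\ e^t* = e, e *m e = e & in_commutant e].

Definition minimal_projection (e : MM) :=
  forall T, in_commutant T -> exists c, e *m T *m e = c *: e.

(** [F] is the indicator of one eigenvalue. Taking that eigenvalue nonzero places the range of [F]
    inside that of [S], so [F] stays below every projection that fixes [S]. *)
Lemma spectral_projection (S : MM) : S^t* = S -> S != 0 -> exists (l : R) F,
  [/\ F^t* = F, F *m F = F, F != 0, l != 0 & S *m F = l%:C *: F] /\
  (in_commutant S -> in_commutant F).
Proof.
move=> hS S0; have [w [v [von E E1]]] := herm_eigenbasis hS.
have von' k l : xpredT k -> xpredT l -> (v k)^t* *m v l = (k == l)%:R%:M by [].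
have [k wk] : exists k, w k != 0.
  apply: contrapT => H; move/eqP: S0; apply; rewrite E big1 // => k _.
  have [->|wk] := eqVneq (w k) 0; first exact: scale0r.
  by case: H; exists k.
pose f (x : R) : R := (x == w k)%:R.
have f0 : f 0 = 0 by rewrite /f eq_sym (negPf wk).
have FE : hermfun f S = \sum_(j | xpredT j) (f (w j))%:C *: projector (v j).
  by rewrite {1}E (hermfun_sum w von' f0).
have ev j : S *m v j = (w j)%:C *: v j by rewrite E (projector_sum_mul w von').
exists (w k), (hermfun f S); split; last exact: commutant_hermfun.
have fv j : hermfun f S *m v j = (f (w j))%:C *: v j by apply: hermfun_eigen.
split => //.
- exact: adj_hermfun.
- rewrite {2 3}FE mulmx_sumr; apply: eq_bigr => j _.
  rewrite -scalemxAr /projector mulmxA fv -scalemxAl scalerA /f -rmorphM.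
  by case: eqP => _; rewrite ?mulr1 ?mulr0.
- apply/eqP => F0; have := fv k; rewrite F0 mul0mx /f eqxx scale1r => v0.
  have := von k k; rewrite -v0 mulmx0 eqxx => /matrixP/(_ 0 0); rewrite !mxE eqxx mulr1n.
  by move/eqP; rewrite eq_sym oner_eq0.
- rewrite FE mulmx_sumr scaler_sumr; apply: eq_bigr => j _.
  rewrite -scalemxAr /projector mulmxA ev -scalemxAl !scalerA -!rmorphM mulrC /f.
  by case: eqP => [->|_]; rewrite ?mulr1 ?mulr0 ?mul0r.
Qed.

Lemma split_projection e : commutant_projection e -> ~ minimal_projection e ->
  exists f, [/\ commutant_projection f, f != 0, f != e & e *m f = f].
Proof.
move=> [he ee ec] /existsNP[T /not_implyP[Tc /forallNP TN]].
have [S [hS Sc SN Se]] : exists S, [/\ S^t* = S, in_commutant S,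
   forall c, S <> c *: e & e *m S = S].
  (* Since [T = (T1 - i T2) / 2], scalar corners of both Hermitian parts would give [T] a scalar
     corner. *)
  pose T1 := T + T^t*; pose T2 := 'i *: (T - T^t*).
  have hT1 : T1^t* = T1 by rewrite /T1 adjmxD trmxCK addrC.
  have hT2 : T2^t* = T2.
    by rewrite /T2 adjmxZ adjmxB trmxCK conjCi scaleNr -scalerN opprB.
  have T1c : in_commutant T1 by apply: commutantD => //; apply: commutant_adj.
  have T2c : in_commutant T2.
    apply: commutantZ; apply: commutantD => //; rewrite -scaleN1r.
    by apply: commutantZ; apply: commutant_adj.
  have sub T' : T'^t* = T' -> in_commutant T' -> (forall c, e *m T' *m e <> c *: e) ->
      exists S, [/\ S^t* = S, in_commutant S, forall c, S <> c *: e & e *m S = S].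
    move=> hT' T'c H; exists (e *m T' *m e); split => //.
    - by rewrite !adjmxM he hT' mulmxA.
    - by apply: commutantM => //; apply: commutantM.
    - by rewrite !mulmxA ee.
  have [[c1 E1]|/forallNP H1] := pselect (exists c, e *m T1 *m e = c *: e); last exact: (sub T1).
  have [[c2 E2]|/forallNP H2] := pselect (exists c, e *m T2 *m e = c *: e); last exact: (sub T2).
  case: (TN (2%:R^-1 * (c1 - 'i * c2))).
  have -> : T = 2%:R^-1 *: (T1 - 'i *: T2).
    rewrite /T2 scalerA -expr2 sqrCi scaleN1r opprK /T1 addrACA subrr addr0 -mulr2n.
    by rewrite -[T *+ 2]scaler_nat scalerA mulVf ?pnatr_eq0 // scale1r.
  rewrite -scalemxAr -scalemxAl mulmxBr mulmxBl E1 -scalemxAr -scalemxAl E2.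
  by rewrite -scalerA scalerBl scalerA.
have S0 : S != 0 by apply/eqP => S0; apply: (SN 0); rewrite scale0r.
have [l [F [[hF FF F0 l0 SF] Fc]]] := spectral_projection hS S0.
have lC : l%:C != 0 by rewrite fmorph_eq0.
have eF : e *m F = F.
  have {1}-> : F = l%:C^-1 *: (S *m F) by rewrite SF scalerA mulVf // scale1r.
  by rewrite -scalemxAr mulmxA Se SF scalerA mulVf // scale1r.
exists F; split => //; first by split => //; apply: Fc.
apply/eqP => Fe; apply: (SN l%:C); rewrite -Fe -SF Fe.
by apply: (@adjmx_inj _ n n); rewrite adjmxM hS he.
Qed.

Lemma subprojection_rank (e f : MM) : e^t* = e -> f^t* = f -> e *m e = e ->
  f *m f = f -> e *m f = f -> f != e -> (\rank f < \rank e)%N.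
Proof.
move=> he hf ee ff ef fe.
have f_e : f *m e = f by apply: (@adjmx_inj _ n n); rewrite adjmxM he hf.
have sfe : (f <= e)%MS by apply/submxP; exists f.
rewrite ltn_neqAle mxrankS // andbT; apply: contra fe => /eqP rk.
have /submxP[X eX] : (e <= f)%MS by rewrite -(mxrank_leqif_sup sfe) rk.
by apply/eqP; rewrite -ef {1}eX -mulmxA ff -eX.
Qed.

Lemma minimal_decomposition e : commutant_projection e ->
  exists s : seq MM, [/\ uniq s,
    forall g, g \in s -> [/\ commutant_projection g, minimal_projection g, g != 0 & e *m g = g],
    forall g g', g \in s -> g' \in s -> g != g' -> g *m g' = 0 &
    \sum_(g <- s) g = e].
Proof.
have [k] := ubnP (\rank e); elim: k e => // k IH e rk ce.
have [e0|e0] := eqVneq e 0.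
  by exists [::]; split=> //; rewrite big_nil e0.
have [me|nme] := pselect (minimal_projection e).
  exists [:: e]; split=> //; last by rewrite big_seq1.
    by move=> g; rewrite inE => /eqP ->; have [_ ee _] := ce; split.
  by move=> g g'; rewrite !inE => /eqP -> /eqP ->; rewrite eqxx.
have [f [cf f0 fe ef]] := split_projection ce nme.
have [he ee ec] := ce; have [hf ff fc] := cf.
have f_e : f *m e = f by apply: (@adjmx_inj _ n n); rewrite adjmxM he hf.
have cf' : commutant_projection (e - f).
  split; first by rewrite adjmxB he hf.
    by rewrite mulmxBl !mulmxBr ee ef f_e ff subrr subr0.
  by apply: commutantD => //; rewrite -scaleN1r; apply: commutantZ.
have [he' ee' _] := cf'.
have [s1 [u1 P1 O1 S1]] := IH f (leq_trans (subprojection_rank he hf ee ff ef fe) rk) cf.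
have rk' : (\rank (e - f)%R < k)%N.
  refine (leq_trans (subprojection_rank he he' ee ee' _ _) rk).
    by rewrite mulmxBr ee ef.
  by apply: contra f0 => /eqP E; rewrite -[f](subKr e) E subrr.
have [s2 [u2 P2 O2 S2]] := IH (e - f) rk' cf'.
have O12 g g' : g \in s1 -> g' \in s2 -> g *m g' = 0.
  move=> /P1[[hg _ _] _ _ fg] /P2[_ _ _ fg'].
  have gf : g *m f = g by apply: (@adjmx_inj _ n n); rewrite adjmxM hf hg.
  by rewrite -gf -fg' -mulmxA (mulmxA f) mulmxBr f_e ff subrr mul0mx mulmx0.
have O21 g g' : g \in s2 -> g' \in s1 -> g *m g' = 0.
  move=> g2 g1; apply: (@adjmx_inj _ n n); rewrite adjmxM adjmx0.
  by have [[-> _ _] _ _ _] := P2 _ g2; have [[-> _ _] _ _ _] := P1 _ g1; apply: O12.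
exists (s1 ++ s2); split.
- rewrite cat_uniq u1 u2 andbT /=; apply/hasPn => g g2; apply/negP => g1.
  have [[_ gg _] _ g0 _] := P1 _ g1.
  by move/eqP: g0; apply; rewrite -gg; apply: O12.
- move=> g; rewrite mem_cat => /orP[/P1|/P2] [cg mg g0 Eg]; split=> //.
    by rewrite -Eg mulmxA ef.
  by rewrite -Eg mulmxA mulmxBr ee ef.
- move=> g g'; rewrite !mem_cat => /orP[] gs /orP[] gs'; first exact: O1.
  + by move=> _; apply: O12.
  + by move=> _; apply: O21.
  + exact: O2.
- by rewrite big_cat /= S1 S2 addrC subrK.
Qed.

Lemma minimal_resolution : exists N (e : 'I_N -> MM),
  [/\ forall v, [/\ commutant_projection (e v), minimal_projection (e v) & e v != 0],
      forall v w, v != w -> e v *m e w = 0 & \sum_v e v = 1%:M].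
Proof.
have c1 : commutant_projection 1%:M.
  by split; [rewrite adjmx1 | rewrite mulmx1 | exact: commutant1].
have [s [us Ps Os Ss]] := minimal_decomposition c1.
exists (size s), (tnth (in_tuple s)); split.
- by move=> v; have [] := Ps _ (mem_tnth v (in_tuple s)).
- move=> v w vw; apply: Os; rewrite ?mem_tnth //.
  by apply: contra vw => /eqP /(elimT (tuple_uniqP (in_tuple s)) us) ->.
- by rewrite -Ss [RHS]big_tnth.
Qed.

Lemma trace_projection_gt0 (e : MM) : e^t* = e -> e *m e = e -> e != 0 -> 0 < \tr e.
Proof.
move=> he ee e0; rewrite -ee -{2}he mxtrace_mul_adj ltcR.
rewrite lt_def sumr_ge0 ?andbT => [|i _]; last by rewrite sumr_ge0 // => j _; apply: normsq_ge0.
apply: contra e0 => /eqP E; apply/eqP/matrixP => i j; rewrite mxE.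
by rewrite pair_bigA /= in E; exact: (sum_normsq_eq0 E (i, j)).
Qed.

Lemma trace_weighted_gt0 (e : MM) : e^t* = e -> e *m e = e -> e != 0 -> 0 < \tr (tau *m e).
Proof.
move=> he ee e0; have -> : \tr (tau *m e) = (\sum_i wt i * \sum_j normsq (e i j))%:C.
  transitivity (\tr (tau *m (e *m e^t*))); first by rewrite he ee.
  rewrite rmorph_sum; apply: eq_bigr => i _ /=.
  rewrite mul_rdiag_mx rmorphM mxE rmorph_sum /=; congr (_ * _).
  by apply: eq_bigr => j _; rewrite adjmxE normsqE mulrC.
rewrite ltcR lt_def sumr_ge0 ?andbT => [|i _]; last first.
  by rewrite mulr_ge0 ?(ltW (wt0 i)) // sumr_ge0 // => j _; apply: normsq_ge0.
apply: contra e0 => /eqP E; apply/eqP/matrixP => i j; rewrite mxE.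
move/eqP: E; rewrite psumr_eq0 => [/allP/(_ i)|k _]; last first.
  by rewrite mulr_ge0 ?(ltW (wt0 k)) // sumr_ge0 // => l _; apply: normsq_ge0.
rewrite mem_index_enum mulf_eq0 gt_eqF //= => /(_ isT) /eqP E.
exact: (sum_normsq_eq0 E j).
Qed.

(** [PA] is a central projection of the algebra, so a minimal projection lies below [PA] or below
    its complement: it lives in H_A or in H_B. *)
Lemma commutant_scalar_PA e : commutant_projection e -> minimal_projection e -> e != 0 ->
  exists c : C, PA *m e = c *: e /\ (c = 0 \/ c = 1).
Proof.
move=> ce me e0; have [he ee [etw ePA]] := ce.
have [c E] : exists c, e *m PA *m e = c *: e by apply: me.
have E1 : PA *m e = c *: e by rewrite -E -ePA -mulmxA ee.
exists c; split=> //.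
have : PA *m (PA *m e) = PA *m e by rewrite mulmxA PAidem.
rewrite E1 -scalemxAr E1 => /eqP; rewrite -subr_eq0 scalerA -scalerBl scaler_eq0 (negPf e0) orbF.
by rewrite -{3}[c]mulr1 -mulrBr mulf_eq0 subr_eq0 => /orP[] /eqP; [left | right].
Qed.

Section MinimalPair.
Variables (e f : MM).
Hypotheses (ce : commutant_projection e) (cf : commutant_projection f).
Hypotheses (mf : minimal_projection f) (f0 : f != 0).

(** [T] may have a nontrivial twist and may map H_B to H_A, so it need not belong to the algebra. In
    the Gram product the twists cancel, and [PA] acts on the range of [f] as a scalar, so minimality
    of [f] applies. *)
Lemma sandwich_gram_scalar d T : 0 < d -> twisted d T ->
  exists c, (e *m T *m f)^t* *m (e *m T *m f) = c *: f.
Proof.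
move=> d0 Ttw; set S := e *m T *m f.
have [he ee [etw ePA]] := ce; have [hf ff [ftw fPA]] := cf.
have Stw : twisted d S.
  by rewrite -[d]mulr1; apply: twistedM => //; rewrite -[d]mul1r; apply: twistedM.
have SStw : twisted 1 (S^t* *m S).
  by rewrite -(mulVf (lt0r_neq0 d0)); apply: twistedM => //; apply: twisted_adj.
have Sf : S *m f = S by rewrite /S -mulmxA ff.
have fS : f *m S^t* = S^t* by apply: (@adjmx_inj _ n n); rewrite adjmxM trmxCK hf.
have SSc : in_commutant (S^t* *m S).
  split=> //.
  have [c [PAf c01]] := commutant_scalar_PA cf mf f0.
  have SPA : S *m PA = c *: S by rewrite -Sf -mulmxA -fPA PAf -scalemxAr.
  have PAS : PA *m S^t* = c *: S^t*.
    apply: (@adjmx_inj _ n n); rewrite adjmxM trmxCK PAadj adjmxZ trmxCK SPA.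
    by case: c01 => ->; rewrite ?conjC0 ?conjC1.
  by rewrite mulmxA PAS -mulmxA SPA -scalemxAl -scalemxAr.
have [c E] := mf SSc; exists c; rewrite -E.
by rewrite (mulmxA f) fS -(mulmxA (S^t*)) Sf.
Qed.

End MinimalPair.

(** A nonzero corner [S] satisfies [S^* S = S S^* = c1 e]. Evaluating the trace of [S^* tau S]
    through the twist and by cyclicity gives the same positive trace of [tau e] with and without the
    factor [d]. Hence [d = 1], so [S] belongs to the algebra and minimality makes it a scalar. *)
Lemma twisted_schur e d T : commutant_projection e -> minimal_projection e -> e != 0 ->
  0 < d -> twisted d T -> exists c, e *m T *m e = c *: e /\ (c != 0 -> d = 1).
Proof.
move=> ce me e0 d0 Ttw; have [he ee [etw ePA]] := ce.
set S := e *m T *m e.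
have Se : S *m e = S by rewrite /S -mulmxA ee.
have eS : e *m S = S by rewrite /S !mulmxA ee.
have Stw : twisted d S.
  by rewrite -[d]mulr1; apply: twistedM => //; rewrite -[d]mul1r; apply: twistedM.
have [c1 E1] := sandwich_gram_scalar ce ce me e0 d0 Ttw; rewrite -/S in E1.
have [c2 E2] : exists c, S *m S^t* = c *: e.
  have d0' : 0 < d^-1 by rewrite invr_gt0.
  have [c] := sandwich_gram_scalar ce ce me e0 d0' (twisted_adj d0 Ttw).
  have -> : e *m T^t* *m e = S^t* by rewrite /S !adjmxM he mulmxA.
  by rewrite trmxCK; exists c.
have te0 : \tr (tau *m e) != 0 by rewrite gt_eqF // trace_weighted_gt0.
have [S0|S0] := eqVneq S 0.
  by exists 0; rewrite S0 scale0r eqxx.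
have c12 : c1 = c2.
  have : c1 *: S = c2 *: S.
    by rewrite -{1}Se scalemxAr -E1 mulmxA E2 -scalemxAl eS.
  by move/eqP; rewrite -subr_eq0 -scalerBl scaler_eq0 (negPf S0) orbF subr_eq0 => /eqP.
have c1_0 : c1 != 0.
  by apply: contra S0 => /eqP c0; apply/eqP/adj_mul_eq0; rewrite E1 c0 scale0r.
have d1 : d = 1.
  have [_ tS] := Stw.
  have H : d%:C * (c1 * \tr (tau *m e)) = c1 * \tr (tau *m e).
    have <- : \tr (S^t* *m (tau *m S)) = d%:C * (c1 * \tr (tau *m e)).
      by rewrite tS -scalemxAr mulmxA E1 mxtraceZ -scalemxAl mxtraceZ mxtrace_mulC.
    by rewrite mxtrace_mulC -mulmxA E2 -scalemxAr mxtraceZ -c12.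
  have : (d%:C - 1) * (c1 * \tr (tau *m e)) == 0 by rewrite mulrBl mul1r H subrr.
  rewrite mulf_eq0 mulf_eq0 (negPf c1_0) (negPf te0) !orbF.
  by rewrite subr_eq0 -[1](rmorph1 (real_complex R)) => /eqP /complexI.
rewrite d1 in Stw.
have [c cPA] := commutant_scalar_PA ce me e0.
have Sc : in_commutant S.
  split=> //; rewrite -{1}eS mulmxA cPA.1 -scalemxAl eS.
  by rewrite -[in RHS]Se -mulmxA -ePA cPA.1 -scalemxAr Se.
have [c3 E3] := me S Sc; exists c3; split=> //.
by rewrite -E3 eS Se.
Qed.

(** Both Gram products of the corner are multiples of the projections by the same positive scalar,
    so rescaling the corner makes it a partial isometry with these as initial and final
    projections. *)
Lemma twisted_partial_isometry e f d T :
  commutant_projection e -> minimal_projection e -> e != 0 ->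
  commutant_projection f -> minimal_projection f -> f != 0 ->
  0 < d -> twisted d T -> e *m T *m f != 0 ->
  exists U, [/\ twisted d U, U^t* *m U = f & U *m U^t* = e].
Proof.
move=> ce me e0 cf mf f0 d0 Ttw; set S := e *m T *m f => S0.
have [he ee [etw _]] := ce; have [hf ff [ftw _]] := cf.
have [c1 E1] := sandwich_gram_scalar ce cf mf f0 d0 Ttw; rewrite -/S in E1.
have [c2 E2] : exists c, S *m S^t* = c *: e.
  have d0' : 0 < d^-1 by rewrite invr_gt0.
  have [c] := sandwich_gram_scalar cf ce me e0 d0' (twisted_adj d0 Ttw).
  have -> : f *m T^t* *m e = S^t* by rewrite /S !adjmxM he hf mulmxA.
  by rewrite trmxCK; exists c.
have Sf : S *m f = S by rewrite /S -mulmxA ff.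
have eS : e *m S = S by rewrite /S !mulmxA ee.
have Stw : twisted d S.
  by rewrite -[d]mulr1; apply: twistedM => //; rewrite -[d]mul1r; apply: twistedM.
have c12 : c1 = c2.
  have : c1 *: S = c2 *: S.
    by rewrite -{1}Sf scalemxAr -E1 mulmxA E2 -scalemxAl eS.
  by move/eqP; rewrite -subr_eq0 -scalerBl scaler_eq0 (negPf S0) orbF subr_eq0 => /eqP.
have c1_gt0 : 0 < c1.
  have t1 : \tr (S *m S^t*) = c1 * \tr e by rewrite E2 mxtraceZ c12.
  have t2 : 0 < \tr (S *m S^t*).
    rewrite lt_def mxtrace_mul_adj lecR sumr_ge0 ?andbT => [|i _]; last first.
      by rewrite sumr_ge0 // => j _; apply: normsq_ge0.
    apply: contra S0 => /eqP/(@complexI R) E; apply/eqP/matrixP => i j; rewrite [RHS]mxE.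
    by rewrite pair_bigA /= in E; exact: (sum_normsq_eq0 E (i, j)).
  by move: t2; rewrite t1 pmulr_lgt0 // trace_projection_gt0.
have rc : (sqrtC c1)^-1^* * (sqrtC c1)^-1 * c1 = 1.
  have sq0 : 0 < sqrtC c1 by rewrite sqrtC_gt0.
  rewrite (CrealP _) ?realV ?gtr0_real // -[X in _ * X](sqrtCK c1) expr2.
  by rewrite mulrA mulfVK ?mulVf // gt_eqF.
exists ((sqrtC c1)^-1 *: S); split; first exact: twistedZ.
  by rewrite adjmxZ -scalemxAl -scalemxAr E1 !scalerA rc scale1r.
by rewrite adjmxZ -scalemxAl -scalemxAr E2 !scalerA -c12 [X in X * _]mulrC rc scale1r.
Qed.

(** Being linked by a twisted partial isometry is an equivalence on minimal projections. [U v] moves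
    the range of [e v] to that of its representative, where Schur's lemma applies to the transported
    operator, whose twist is [(dl v)^-1 * d * dl w]. *)
Theorem twisted_frames : exists N (e U : 'I_N -> MM) (rep : 'I_N -> 'I_N) (dl : 'I_N -> R)
    (isA : pred 'I_N),
  [/\ [/\ forall v, [/\ (e v)^t* = e v, e v *m e v = e v, e v != 0 & twisted 1 (e v)],
          forall v w, v != w -> e v *m e w = 0, \sum_v e v = 1%:M &
          forall v, PA *m e v = if isA v then e v else 0],
      [/\ forall v, rep (rep v) = rep v,
          forall v, 0 < dl v, forall v, twisted (dl v) (U v),
          forall v, (U v)^t* *m U v = e (rep v) & forall v, U v *m (U v)^t* = e v],
      forall d T v w, 0 < d -> twisted d T -> rep v != rep w -> e v *m T *m e w = 0 &
      forall d T v w, 0 < d -> twisted d T -> rep v = rep w ->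
        exists c, (U v)^t* *m T *m U w = c *: e (rep v) /\ (c != 0 -> d * dl w = dl v)].
Proof.
have [N [e [Pe Oe Se]]] := minimal_resolution.
have ce v : commutant_projection (e v) by have [] := Pe v.
have me v : minimal_projection (e v) by have [] := Pe v.
have e0 v : e v != 0 by have [] := Pe v.
pose lnk v w := exists d U, [/\ 0 < d, twisted d U, U^t* *m U = e w & U *m U^t* = e v].
have lnkP d T v w : 0 < d -> twisted d T -> e v *m T *m e w != 0 -> lnk v w.
  move=> d0 Ttw T0; have [U [Utw U1 U2]] := twisted_partial_isometry (ce v) (me v) (e0 v) (ce w)
    (me w) (e0 w) d0 Ttw T0.
  by exists d, U.
have Ue U v w : U^t* *m U = e w -> U *m U^t* = e v -> U *m e w = U /\ e v *m U = U.
  move=> U1 U2; suff Uw : U *m e w = U by rewrite -U2 -mulmxA U1 Uw.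
  have [he ee _] := ce w.
  have : U *m (1%:M - e w) = 0.
    apply: adj_mul_eq0; rewrite adjmxM -mulmxA (mulmxA (U^t*)) U1.
    by rewrite mulmxBr mulmx1 ee subrr mulmx0.
  by rewrite mulmxBr mulmx1 => /eqP; rewrite subr_eq0 => /eqP.
have lnk_refl v : lnk v v.
  have [he ee _] := ce v; exists 1, (e v); split; rewrite ?he ?ee //.
  by have [_ _ []] := ce v.
have lnk_sym v w : lnk v w -> lnk w v.
  move=> [d [U [d0 Utw U1 U2]]]; exists d^-1, (U^t*).
  by split; rewrite ?invr_gt0 ?trmxCK //; apply: twisted_adj.
have lnk_trans v w u : lnk v w -> lnk w u -> lnk v u.
  move=> [d [U [d0 Utw U1 U2]]] [d' [U' [d0' Utw' U1' U2']]].
  exists (d * d'), (U *m U'); split; first by rewrite mulr_gt0.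
  - exact: twistedM.
  - have [_ eU'] := Ue _ _ _ U1' U2'.
    by rewrite adjmxM -mulmxA (mulmxA (U^t*)) U1 eU' U1'.
  - have [Uw _] := Ue _ _ _ U1 U2.
    by rewrite adjmxM mulmxA -(mulmxA U) U2' Uw.
(* [pick] depends only on the predicate, which is the same for linked indices, so [rep] is constant
   on classes. The default is harmless because [lnk] is reflexive. *)
pose rep v := odflt v [pick w | `[< lnk v w >]].
have rep_lnk v : lnk v (rep v).
  by rewrite /rep; case: pickP => [w /asboolP //|_].
have rep_eq v w : lnk v w -> rep v = rep w.
  move=> vw; have E : (fun u => `[< lnk v u >]) =1 (fun u => `[< lnk w u >]).
    move=> u; apply/asbool_equiv_eq; split; last exact: lnk_trans.
    by apply: lnk_trans; apply: lnk_sym.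
  rewrite /rep (eq_pick E); case: pickP => // H.
  by have := H w; rewrite asboolT.
have /choice[dU dUP] : forall v, exists p : R * MM,
    [/\ 0 < p.1, twisted p.1 p.2, p.2^t* *m p.2 = e (rep v) & p.2 *m p.2^t* = e v].
  by move=> v; have [d [U H]] := rep_lnk v; exists (d, U).
pose dl v := (dU v).1; pose U v := (dU v).2.
have /choice[isA isAP] : forall v, exists b : bool, PA *m e v = if b then e v else 0.
  move=> v; have [c [-> []->]] := commutant_scalar_PA (ce v) (me v) (e0 v).
    by exists false; rewrite scale0r.
  by exists true; rewrite scale1r.
exists N, e, U, rep, dl, isA; split.
- split=> // v; have [he ee [etw _]] := ce v; split=> //.
- split=> v.
  + by rewrite -(rep_eq _ _ (rep_lnk v)).
  + by have [] := dUP v.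
  + by have [] := dUP v.
  + by have [] := dUP v.
  + by have [] := dUP v.
- move=> d T v w d0 Ttw; apply: contraNeq => /(lnkP d T v w d0 Ttw) /rep_eq ->.
  by rewrite eqxx.
- move=> d T v w d0 Ttw vw.
  have [dv0 Uv Uv1 Uv2] := dUP v; have [dw0 Uw Uw1 Uw2] := dUP w.
  have tw : twisted ((dl v)^-1 * d * dl w) ((U v)^t* *m T *m U w).
    by apply: twistedM => //; apply: twistedM => //; apply: twisted_adj.
  have d1 : 0 < (dl v)^-1 * d * dl w by rewrite !mulr_gt0 // invr_gt0.
  have [c [E cE]] := twisted_schur (ce (rep v)) (me (rep v)) (e0 (rep v)) d1 tw.
  have [U1 _] := Ue _ _ _ Uv1 Uv2; have [U2 _] := Ue _ _ _ Uw1 Uw2.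
  have U1' : e (rep v) *m (U v)^t* = (U v)^t*.
    by apply: (@adjmx_inj _ n n); have [he _ _] := ce (rep v); rewrite adjmxM trmxCK he U1.
  exists c; split.
    rewrite -E; have -> : e (rep v) *m ((U v)^t* *m T *m U w) *m e (rep v) =
        e (rep v) *m (U v)^t* *m T *m (U w *m e (rep v)) by rewrite !mulmxA.
    by rewrite U1' vw [U w *m _]U2.
  move/cE => H; have : dl v * ((dl v)^-1 * d * dl w) = dl v by rewrite H mulr1.
  by rewrite !mulrA mulfV ?mul1r // gt_eqF.
Qed.

End TwistedCommutant.

(** * Intertwiners from the Kadison-Schwarz inequality *)

Section RDiag.
Variable R : realType.

Lemma rdiagM n (d d' : 'I_n -> R) : rdiag d *m rdiag d' = rdiag (fun i => d i * d' i).
Proof.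
apply/matrixP => i j; rewrite mul_rdiag_mx !rdiagE mulrnAr -rmorphM.
by case: eqP => [->|_]; rewrite ?mulr1n ?mulr0n ?mulr0.
Qed.

Lemma rdiag1 n (d : 'I_n -> R) : (forall i, d i = 1) -> rdiag d = 1%:M.
Proof. by move=> d1; apply/matrixP => i j; rewrite rdiagE d1 mxE. Qed.

Lemma rdiagVK n m (d : 'I_n -> R) (A : 'M[R[i]]_(n, m)) : (forall i, 0 < d i) ->
  rdiag d *m (rdiag (fun i => (d i)^-1) *m A) = A.
Proof.
move=> d0; rewrite mulmxA rdiagM rdiag1 ?mul1mx // => i.
by rewrite divff // gt_eqF.
Qed.

End RDiag.

(* The defect in Kadison's inequality for the unital map [F Y = sum K Y K^*]
   at [X = F Y] is a sum of squares of the commutators [X K - K Y]. *)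
Lemma kadison_defect (R : realType) (I : finType) p q (K : I -> 'M[R[i]]_(p, q))
    (S X : 'M[R[i]]_p) (Y : 'M[R[i]]_q) :
  \sum_m K m *m (K m)^t* = 1%:M -> X = \sum_m K m *m Y *m (K m)^t* ->
  \sum_m \tr (S *m (X *m K m - K m *m Y) *m (S *m (X *m K m - K m *m Y))^t*) =
  \sum_m \tr (S *m K m *m Y *m Y^t* *m (S *m K m)^t*) - \tr (S *m X *m X^t* *m S^t*).
Proof.
move=> K1 XE.
have XE' : X^t* = \sum_m K m *m Y^t* *m (K m)^t*.
  rewrite XE adjmx_sum; apply: eq_bigr => m _.
  by rewrite !adjmxM trmxCK mulmxA.
rewrite -!raddf_sum /= -raddfB /=; congr (\tr _).
transitivity (S *m (X *m (\sum_m K m *m (K m)^t*) *m X^t*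
    - X *m (\sum_m K m *m Y^t* *m (K m)^t*) - (\sum_m K m *m Y *m (K m)^t*) *m X^t*
    + \sum_m K m *m Y *m Y^t* *m (K m)^t*) *m S^t*).
  rewrite mulmx_sumr mulmx_suml [X *m \sum_m _]mulmx_sumr [(\sum_m _) *m X^t*]mulmx_suml.
  rewrite -!sumrB -big_split /= mulmx_sumr mulmx_suml; apply: eq_bigr => m _.
  rewrite adjmxM -!mulmxA; congr (S *m _); rewrite !mulmxA; congr (_ *m S^t*).
  by rewrite adjmxB !adjmxM mulmxBl !mulmxBr !mulmxA opprB addrA addrAC.
rewrite K1 mulmx1 -XE -XE' subrr sub0r mulmxDr mulmxDl mulmxN mulNmx addrC !mulmxA.
congr (_ - _); rewrite mulmx_sumr mulmx_suml; apply: eq_bigr => m _.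
by rewrite adjmxM !mulmxA.
Qed.

Section KadisonSchwarz.
Variables (R : realType) (a b : nat) (I : finType).
Local Notation C := R[i].
Variables (s : 'I_a -> R) (t : 'I_b -> R) (om : I -> 'M[C]_(a, b)) (dl : I -> R).
Variable G : 'M[C]_(a * a, b * b).
Hypotheses (s0 : forall i, 0 < s i) (t0 : forall j, 0 < t j).
Hypothesis om_homog : forall m, rdiag s *m om m = (dl m)%:C *: (om m *m rdiag t).
Hypothesis omA : \sum_m om m *m (om m)^t* = rdiag (fun i => s i ^+ 2).
Hypothesis omB : \sum_m (om m)^t* *m om m = rdiag (fun j => t j ^+ 2).
Hypothesis Giso : G *m G^t* *m G = G.
Hypothesis Gflat : forall i i' j j', \sum_m om m i j * (om m i' j')^* =
  (s i * t j')%:C * G (mxtens_index (i, i')) (mxtens_index (j, j')).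
Hypothesis Gflat' : forall i i' j j', \sum_m om m i j * (om m i' j')^* =
  (s i' * t j)%:C * G (mxtens_index (i, i')) (mxtens_index (j, j')).

Let eta m := rdiag (fun i => (s i)^-1) *m om m.

Lemma eta_om m : rdiag s *m eta m = om m.
Proof. exact: rdiagVK. Qed.

Lemma eta_om' m : (dl m)%:C *: (eta m *m rdiag t) = om m.
Proof. by rewrite /eta -mulmxA scalemxAr -om_homog mulmxA -mulmxA -/(eta m) mulmxA rdiagM rdiag1
  ?mul1mx // => i; rewrite mulVf // gt_eqF. Qed.

Lemma eta_homog m : rdiag s *m eta m = (dl m)%:C *: (eta m *m rdiag t).
Proof. by rewrite eta_om eta_om'. Qed.

Definition transferA (Y : 'M[C]_b) : 'M[C]_a := \sum_m eta m *m Y *m (eta m)^t*.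
(** By homogeneity, [dl m] times the adjoint of [eta m] is [rho_B^(-1/2)] times the adjoint of
    [om m]. These are the Kraus operators for which the map is unital, whence the squares of
    [dl m]. *)
Definition transferB (X : 'M[C]_a) : 'M[C]_b :=
  \sum_m (dl m ^+ 2)%:C *: ((eta m)^t* *m X *m eta m).

Lemma transferA1 : transferA 1%:M = 1%:M.
Proof.
transitivity (rdiag (fun i => (s i)^-1) *m (\sum_m om m *m (om m)^t*) *m rdiag (fun i => (s i)^-1)).
  rewrite mulmx_sumr mulmx_suml; apply: eq_bigr => m _.
  by rewrite mulmx1 /eta adjmxM adj_rdiag !mulmxA.
rewrite omA !rdiagM rdiag1 // => i; rewrite expr2; field.
by rewrite gt_eqF.
Qed.

Lemma transferB1 : transferB 1%:M = 1%:M.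
Proof.
transitivity (rdiag (fun j => (t j)^-1) *m (\sum_m (om m)^t* *m om m) *m rdiag (fun i => (t i)^-1)).
  rewrite mulmx_sumr mulmx_suml; apply: eq_bigr => m _.
  have E : (dl m)%:C *: eta m = om m *m rdiag (fun j => (t j)^-1).
    rewrite -[in RHS](eta_om' m) -scalemxAl -mulmxA rdiagM rdiag1 ?mulmx1 // => j.
    by rewrite divff // gt_eqF.
  set D := rdiag _ in E *.
  have -> : D *m ((om m)^t* *m om m) *m D = (om m *m D)^t* *m (om m *m D).
    by rewrite adjmxM adj_rdiag !mulmxA.
  by rewrite -E adjmxZ conjC_real mulmx1 -scalemxAl -scalemxAr scalerA -rmorphM expr2.
rewrite omB !rdiagM rdiag1 // => i; rewrite expr2; field.
by rewrite gt_eqF.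
Qed.

Lemma transferA_adj Y : transferA (Y^t*) = (transferA Y)^t*.
Proof.
rewrite adjmx_sum; apply: eq_bigr => m _.
by rewrite (adjmxM (eta m *m Y)) (adjmxM (eta m)) trmxCK (mulmxA (eta m)).
Qed.

Lemma transferB_adj X : transferB (X^t*) = (transferB X)^t*.
Proof.
rewrite adjmx_sum; apply: eq_bigr => m _.
by rewrite adjmxZ (adjmxM (_ *m X)) (adjmxM ((eta m)^t*)) trmxCK (mulmxA ((eta m)^t*)) conjC_real.
Qed.

(** The vector of [X rho_A^(1/2)], as in the GNS representation of rho_A. In these coordinates
    [transferA] is [G] and [transferB] its adjoint, so [G G^* G = G] becomes an identity between the
    maps. *)
Let vecA (X : 'M[C]_a) : 'cV[C]_(a * a) := \col_u
  (X (mxtens_unindex u).1 (mxtens_unindex u).2 * (s (mxtens_unindex u).2)%:C).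
Let vecB (Y : 'M[C]_b) : 'cV[C]_(b * b) := \col_u
  (Y (mxtens_unindex u).1 (mxtens_unindex u).2 * (t (mxtens_unindex u).2)%:C).

Lemma vecA_inj : injective vecA.
Proof.
move=> X X' E; apply/matrixP => i i'.
have := congr1 (fun v : 'cV_(a * a) => v (mxtens_index (i, i')) 0) E.
rewrite !mxE mxtens_indexK /=; apply: mulIf.
by rewrite fmorph_eq0 gt_eqF.
Qed.

Lemma vecB_inj : injective vecB.
Proof.
move=> X X' E; apply/matrixP => i i'.
have := congr1 (fun v : 'cV_(b * b) => v (mxtens_index (i, i')) 0) E.
rewrite !mxE mxtens_indexK /=; apply: mulIf.
by rewrite fmorph_eq0 gt_eqF.
Qed.

Lemma eta_entry m i j : eta m i j = (s i)%:C^-1 * om m i j.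
Proof. by rewrite /eta mul_rdiag_mx fmorphV. Qed.

Lemma eta_entry' m i j : (dl m)%:C * eta m i j = om m i j * (t j)%:C^-1.
Proof.
rewrite -[in RHS](eta_om' m) [in RHS]mxE mul_mx_rdiag -!mulrA mulfV ?mulr1 // fmorph_eq0 gt_eqF //.
Qed.

Lemma transferA_entry Y i i' : transferA Y i i' =
  \sum_j \sum_j' (\sum_m eta m i j * (eta m i' j')^*) * Y j j'.
Proof.
rewrite summxE; under [RHS]eq_bigr do under eq_bigr do rewrite mulr_suml.
under [RHS]eq_bigr do rewrite exchange_big.
rewrite [RHS]exchange_big; apply: eq_bigr => m _ /=.
rewrite mxE exchange_big; apply: eq_bigr => j' _ /=.
rewrite mxE mulr_suml; apply: eq_bigr => j _.
by rewrite adjmxE; ring.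
Qed.

Lemma transferB_entry X j j' : transferB X j j' =
  \sum_i \sum_i' (\sum_m (dl m ^+ 2)%:C * ((eta m i j)^* * eta m i' j')) * X i i'.
Proof.
rewrite summxE; under [RHS]eq_bigr do under eq_bigr do rewrite mulr_suml.
under [RHS]eq_bigr do rewrite exchange_big.
rewrite [RHS]exchange_big; apply: eq_bigr => m _ /=.
rewrite mxE mxE mulr_sumr exchange_big; apply: eq_bigr => i' _ /=.
rewrite mxE mulr_suml mulr_sumr; apply: eq_bigr => i _.
by rewrite adjmxE; ring.
Qed.

Lemma vec_transferA Y : vecA (transferA Y) = G *m vecB Y.
Proof.
apply/matrixP => u k; rewrite ord1 {k}; case: (mxtens_indexP u) => i i'.
rewrite mxE mxtens_indexK mxE sum_mxtens transferA_entry mulr_suml.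
apply: eq_bigr => j _; rewrite mulr_suml; apply: eq_bigr => j' _ /=.
rewrite mxE mxtens_indexK /=.
have -> : \sum_m eta m i j * (eta m i' j')^* =
    (s i)%:C^-1 * (s i')%:C^-1 * \sum_m om m i j * (om m i' j')^*.
  rewrite mulr_sumr; apply: eq_bigr => m _; rewrite !eta_entry rmorphM fmorphV /= conjC_real; ring.
rewrite Gflat rmorphM /=; field.
by rewrite !fmorph_eq0 !gt_eqF.
Qed.

Lemma vec_transferB X : vecB (transferB X) = G^t* *m vecA X.
Proof.
apply/matrixP => u k; rewrite ord1 {k}; case: (mxtens_indexP u) => j j'.
rewrite mxE mxtens_indexK mxE sum_mxtens transferB_entry mulr_suml.
apply: eq_bigr => i _; rewrite mulr_suml; apply: eq_bigr => i' _ /=.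
rewrite [vecA _ _ _]mxE mxtens_indexK /= adjmxE.
have -> : \sum_m (dl m ^+ 2)%:C * ((eta m i j)^* * eta m i' j') =
    (t j)%:C^-1 * (t j')%:C^-1 * (\sum_m om m i j * (om m i' j')^*)^*.
  rewrite rmorph_sum mulr_sumr; apply: eq_bigr => m _ /=.
  transitivity (((dl m)%:C * eta m i j)^* * ((dl m)%:C * eta m i' j')).
    by rewrite [(_ * eta m i j)^*]rmorphM /= conjC_real rmorphXn /=; ring.
  by rewrite !eta_entry' !rmorphM /= fmorphV /= conjC_real conjCK; ring.
rewrite Gflat' !rmorphM /= !conjC_real; field.
by rewrite !fmorph_eq0 !gt_eqF.
Qed.

Lemma transferABA Y : transferA (transferB (transferA Y)) = transferA Y.
Proof. by apply: vecA_inj; rewrite !(vec_transferA, vec_transferB) !mulmxA Giso. Qed.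

Lemma transferBAB X : transferB (transferA (transferB X)) = transferB X.
Proof.
apply: vecB_inj; rewrite !(vec_transferA, vec_transferB) !mulmxA.
congr (_ *m _); rewrite -[in RHS]Giso !adjmxM trmxCK mulmxA //.
Qed.

Definition transfer_pair (X : 'M[C]_a) (Y : 'M[C]_b) := X = transferA Y /\ Y = transferB X.

Lemma transfer_pair_adj X Y : transfer_pair X Y -> transfer_pair (X^t*) (Y^t*).
Proof. by move=> [EX EY]; split; rewrite ?transferA_adj ?transferB_adj -?EX -?EY. Qed.

(** Each map carries one density to the other. Hence the Kadison defect of [transferA] weighted by
    rho_A and that of [transferB] weighted by rho_B are negatives of each other. Both are sums of
    squares, so both vanish, and the invertible weight can be cancelled. *)
Lemma transfer_pair_intertwine X Y m : transfer_pair X Y -> X *m eta m = eta m *m Y.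
Proof.
move=> [EX EY].
have D1 := @kadison_defect R I a b eta (rdiag s) X Y.
have D2 := @kadison_defect R I b a (fun m => (dl m)%:C *: (eta m)^t*) (rdiag t) Y X.
have {}D1 := D1 _ EX.
have K1 : \sum_m eta m *m (eta m)^t* = 1%:M.
  by rewrite -[RHS]transferA1; apply: eq_bigr => k _; rewrite mulmx1.
have {}D1 := D1 K1.
have K2 : \sum_m ((dl m)%:C *: (eta m)^t*) *m ((dl m)%:C *: (eta m)^t*)^t* = 1%:M.
  rewrite -[RHS]transferB1; apply: eq_bigr => k _.
  by rewrite adjmxZ trmxCK conjC_real mulmx1 -scalemxAl -scalemxAr scalerA -rmorphM expr2.
have E2 : Y = \sum_m ((dl m)%:C *: (eta m)^t*) *m X *m ((dl m)%:C *: (eta m)^t*)^t*.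
  rewrite {1}EY; apply: eq_bigr => k _.
  by rewrite adjmxZ trmxCK conjC_real -!scalemxAl -scalemxAr scalerA -rmorphM expr2.
have {}D2 := D2 K2 E2.
have T1 : \sum_m \tr (rdiag s *m eta m *m Y *m Y^t* *m (rdiag s *m eta m)^t*) =
    \tr (rdiag t *m Y *m Y^t* *m (rdiag t)^t*).
  under eq_bigr do rewrite eta_om mxtrace_mulC !mulmxA.
  by rewrite -raddf_sum /= -!mulmx_suml omB adj_rdiag [RHS]mxtrace_mulC !mulmxA rdiagM.
have T2 : \sum_m \tr (rdiag t *m ((dl m)%:C *: (eta m)^t*) *m X *m X^t* *m
     (rdiag t *m ((dl m)%:C *: (eta m)^t*))^t*) =
    \tr (rdiag s *m X *m X^t* *m (rdiag s)^t*).
  have E k : rdiag t *m ((dl k)%:C *: (eta k)^t*) = (om k)^t*.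
    by rewrite -scalemxAr -[in RHS](eta_om' k) adjmxZ conjC_real (adjmxM (eta k)) adj_rdiag.
  under eq_bigr do rewrite E trmxCK mxtrace_mulC !mulmxA.
  by rewrite -raddf_sum /= -!mulmx_suml omA adj_rdiag [RHS]mxtrace_mulC !mulmxA rdiagM.
rewrite T1 in D1; rewrite T2 in D2.
have nn p q (A : 'M[C]_(p, q)) : 0 <= \tr (A *m A^t*).
  rewrite mxtrace_mul_adj lecR sumr_ge0 // => i _; rewrite sumr_ge0 // => j _.
  exact: normsq_ge0.
have : \sum_m \tr (rdiag s *m (X *m eta m - eta m *m Y) *m
    (rdiag s *m (X *m eta m - eta m *m Y))^t*) == 0.
  rewrite eq_le sumr_ge0 ?andbT => [|k _]; last exact: nn.
  rewrite D1 -opprB -D2 oppr_le0 sumr_ge0 // => k _; exact: nn.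
rewrite psumr_eq0 => [/allP/(_ m)|k _]; last exact: nn.
rewrite mem_index_enum => /(_ isT) /= /eqP E.
have {}E : rdiag s *m (X *m eta m - eta m *m Y) = 0.
  rewrite mxtrace_mul_adj pair_bigA /= in E; have {}E := complexI E.
  by apply/matrixP => i j; rewrite [RHS]mxE; exact: (sum_normsq_eq0 E (i, j)).
apply/eqP; rewrite -subr_eq0; apply/eqP/matrixP => i j.
have := congr1 (fun A : 'M_(a, b) => A i j) E; rewrite mul_rdiag_mx [RHS]mxE => /eqP.
rewrite mulf_eq0 fmorph_eq0 gt_eqF //= => /eqP ->; by rewrite mxE.
Qed.

End KadisonSchwarz.

(** * Mixtures of triangle states *)

Section Fibers.
Variable R : realType.
Local Notation C := R[i].

Definition tensv m n (u : 'cV[C]_m) (v : 'cV[C]_n) : 'cV[C]_(m * n) :=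
  \col_k (u (mxtens_unindex k).1 0 * v (mxtens_unindex k).2 0).

Lemma tensvE m n (u : 'cV[C]_m) (v : 'cV[C]_n) i j :
  tensv u v (mxtens_index (i, j)) 0 = u i 0 * v j 0.
Proof. by rewrite mxE mxtens_indexK. Qed.

Definition fiber_orthonormal n (J X Z : finType) (jz : Z -> J) (jx : X -> J)
    (al : Z -> X -> 'cV[C]_n) :=
  forall z x z' x', jz z = jx x -> jz z' = jx x' ->
    (al z x)^t* *m al z' x' = ((z == z') && (x == x'))%:R%:M.

Definition fiber_normalized (J X : finType) (jx : X -> J) (l : X -> R) :=
  (forall x, 0 < l x) /\ forall x0, \sum_(x | jx x == jx x0) l x = 1.

(* X, Y and Z index bases of the edges AB, BC and CA of all the triangles, jx, jy
   and jz map them to the summands in J, and al z x, be y x are the vectors |z>|x>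
   of A_L^j (x) A_R^j and |x>|y> of B_L^j (x) B_R^j; they matter only for linked
   indices.  Tracing out C leaves a mixture over the linked pairs (y, z). *)
Definition triangle_mixture a b (rho : 'M[C]_(a * b)) :=
  exists (J X Y Z : finType) (jx : X -> J) (jy : Y -> J) (jz : Z -> J)
    (l : X -> R) (m : Y -> R) (n : Z -> R)
    (al : Z -> X -> 'cV[C]_a) (be : Y -> X -> 'cV[C]_b),
  [/\ fiber_normalized jx l, fiber_normalized jy m & forall z, 0 <= n z] /\
  [/\ fiber_orthonormal jz jx al, fiber_orthonormal jy jx be &
      rho = \sum_y \sum_(z | jz z == jy y) (m y * n z)%:C *:
        projector (\sum_(x | jx x == jy y) (Num.sqrt (l x))%:C *: tensv (al z x) (be y x))].

End Fibers.

(** Provides a test matrix between two projections, from which a scalar factor in an operator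
    identity can be read off. *)
Lemma exists_mulmx_neq0 (R : realType) n (e f : 'M[R[i]]_n) : e != 0 -> f != 0 ->
  exists K, e *m K *m f != 0.
Proof.
have ex (g : 'M[R[i]]_n) : g != 0 -> exists i j, g i j != 0.
  move=> g0; apply: contrapT => H; move/eqP: g0; apply; apply/matrixP => i j.
  by rewrite mxE; apply/eqP; apply: contrapT => /negP gij; apply: H; exists i, j.
move=> /ex[i [j eij]] /ex[k [l fkl]]; exists (delta_mx j k).
apply/eqP => /matrixP/(_ i l); rewrite !mxE (bigD1 k) //= big1 ?addr0 => [|u uk].
  rewrite !mxE (bigD1 j) //= big1 ?addr0 => [|v vj].
    by rewrite !mxE !eqxx mulr1 => /eqP; rewrite mulf_eq0 (negPf eij) (negPf fkl).
  by rewrite !mxE (negPf vj) mulr0.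
rewrite mxE big1 ?mul0r // => v _.
by rewrite !mxE (negPf uk) andbF mulr0.
Qed.

Lemma partial_isometry_mul (R : realType) m n (U : 'M[R[i]]_(m, n)) f :
  U^t* *m U = f -> f *m f = f -> f^t* = f -> U *m f = U.
Proof.
move=> Uf ff hf; have : U *m (1%:M - f) = 0.
  apply: adj_mul_eq0; rewrite adjmxM -mulmxA (mulmxA (U^t*)) Uf.
  by rewrite mulmxBr mulmx1 ff subrr mulmx0.
by rewrite mulmxBr mulmx1 => /eqP; rewrite subr_eq0 => /eqP.
Qed.

(** * From intertwiners to a mixture of edge vectors *)

Section Structure.
Variables (R : realType) (a b : nat) (I : finType).
Local Notation C := R[i].
Variables (s : 'I_a -> R) (t : 'I_b -> R) (eta : I -> 'M[C]_(a, b)) (dl : I -> R).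
Hypotheses (s0 : forall i, 0 < s i) (t0 : forall j, 0 < t j) (dl0 : forall m, 0 < dl m).
Hypothesis eta_hom : forall m, rdiag s *m eta m = (dl m)%:C *: (eta m *m rdiag t).
Variable pair : 'M[C]_a -> 'M[C]_b -> Prop.
Hypothesis pair_adj : forall X Y, pair X Y -> pair (X^t*) (Y^t*).
Hypothesis pair_eta : forall X Y m, pair X Y -> X *m eta m = eta m *m Y.
Let trA (Y : 'M[C]_b) : 'M[C]_a := \sum_m eta m *m Y *m (eta m)^t*.
Let trB (X : 'M[C]_a) : 'M[C]_b := \sum_m (dl m ^+ 2)%:C *: ((eta m)^t* *m X *m eta m).
Hypothesis pairA : forall Y, exists Y', pair (trA Y) Y'.
Hypothesis pairB : forall X, exists X', pair X' (trB X).
Hypothesis trA1 : trA 1%:M = 1%:M.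

Local Notation n := (a + b)%N.
Let PA : 'M[C]_n := block_mx 1%:M 0 0 0.
Let ZZ (Z : 'M[C]_n) := exists X Y, pair X Y /\ Z = block_mx X 0 0 Y.
Let wt (k : 'I_n) : R := match fintype.split k with inl i => s i | inr j => t j end.
Let tau : 'M[C]_n := rdiag wt.
(** Off the diagonal, the intertwining relation [X eta = eta Y] becomes commutation with
    [block_mx X 0 0 Y], and [eta_hom] becomes a twist by [dl m]. *)
Let h m : 'M[C]_n := block_mx 0 (eta m) 0 0.

Lemma adj_block_mx m1 m2 n1 n2 (A : 'M[C]_(m1, n1)) (B : 'M[C]_(m1, n2))
    (D : 'M[C]_(m2, n1)) (E : 'M[C]_(m2, n2)) :
  (block_mx A B D E)^t* = block_mx (A^t*) (D^t*) (B^t*) (E^t*).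
Proof. by rewrite tr_block_mx map_block_mx. Qed.

Lemma tau_block : tau = block_mx (rdiag s) 0 0 (rdiag t).
Proof.
apply/matrixP => i j; rewrite rdiagE.
case: (split_ordP i) => i' ->; case: (split_ordP j) => j' ->.
- by rewrite block_mxEul rdiagE /wt (unsplitK (inl j')) eq_lshift.
- by rewrite block_mxEur mxE eq_lrshift mulr0n.
- by rewrite block_mxEdl mxE eq_rlshift mulr0n.
- by rewrite block_mxEdr rdiagE /wt (unsplitK (inr j')) eq_rshift.
Qed.

Let wt0 k : 0 < wt k.
Proof. by rewrite /wt; case: fintype.split. Qed.

Let ZZadj Z : ZZ Z -> ZZ (Z^t*).
Proof.
move=> [X [Y [XY ->]]]; exists (X^t*), (Y^t*); split; first exact: pair_adj.
by rewrite adj_block_mx !adjmx0.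
Qed.

Let PAadj : PA^t* = PA.
Proof. by rewrite adj_block_mx !adjmx0 adjmx1. Qed.

Let PAidem : PA *m PA = PA.
Proof. by rewrite mulmx_block !(mulmx0, mul0mx, mulmx1, addr0). Qed.

Let PAtw : twisted ZZ wt 1 PA.
Proof.
split=> [Z [X [Y [_ ->]]]|]; rewrite ?scale1r -?/tau ?tau_block !mulmx_block.
  by rewrite !(mulmx0, mul0mx, mulmx1, mul1mx, addr0).
by rewrite !(mulmx0, mul0mx, mulmx1, mul1mx, addr0).
Qed.

Let h_tw m : twisted ZZ wt (dl m) (h m).
Proof.
split=> [Z [X [Y [XY ->]]]|]; rewrite -?/tau ?tau_block !mulmx_block.
  by rewrite !(mulmx0, mul0mx, addr0, add0r) (pair_eta _ XY).
rewrite !(mulmx0, mul0mx, addr0, add0r) eta_hom.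
by rewrite scale_block_mx !scaler0.
Qed.

Lemma h_sandwich W : \sum_m h m *m W *m (h m)^t* = block_mx (trA (drsubmx W)) 0 0 0.
Proof.
rewrite -[W]submxK block_mxKdr; set W1 := ulsubmx W; set W2 := ursubmx W.
set W3 := dlsubmx W; set W4 := drsubmx W.
transitivity (\sum_m block_mx (eta m *m W4 *m (eta m)^t*) 0 0 0 : 'M[C]_n).
  apply: eq_bigr => m _; rewrite /h adj_block_mx !adjmx0 !mulmx_block.
  by rewrite !(mulmx0, mul0mx, addr0, add0r).
rewrite /trA; elim/big_rec2: _ => [|m x y _ ->]; first by rewrite block_mx0.
by rewrite add_block_mx !addr0.
Qed.

Lemma h_cosandwich W : \sum_m (dl m ^+ 2)%:C *: ((h m)^t* *m W *m h m) =
  block_mx 0 0 0 (trB (ulsubmx W)).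
Proof.
rewrite -[W]submxK block_mxKul; set W1 := ulsubmx W; set W2 := ursubmx W.
set W3 := dlsubmx W; set W4 := drsubmx W.
transitivity (\sum_m block_mx 0 0 0 ((dl m ^+ 2)%:C *: ((eta m)^t* *m W1 *m eta m)) : 'M[C]_n).
  apply: eq_bigr => m _; rewrite /h adj_block_mx !adjmx0 !mulmx_block.
  by rewrite !(mulmx0, mul0mx, addr0, add0r) scale_block_mx !scaler0.
rewrite /trB; elim/big_rec2: _ => [|m x y _ ->]; first by rewrite block_mx0.
by rewrite add_block_mx !addr0.
Qed.

(* [h W h^*] summed is [Z PA] for a pair [Z]. *)
Lemma h_sandwich_comm W d T : twisted ZZ wt d T -> PA *m T = T *m PA ->
  (\sum_m h m *m W *m (h m)^t*) *m T = T *m (\sum_m h m *m W *m (h m)^t*).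
Proof.
move=> [zT _] pT; rewrite h_sandwich; have [Y' pr] := pairA (drsubmx W).
have -> : block_mx (trA (drsubmx W)) 0 0 0 = block_mx (trA (drsubmx W)) 0 0 Y' *m PA.
  by rewrite mulmx_block !(mulmx0, mul0mx, mulmx1, addr0, add0r).
rewrite -mulmxA pT !mulmxA zT //.
by exists (trA (drsubmx W)), Y'.
Qed.

Lemma h_cosandwich_comm W d T : twisted ZZ wt d T -> PA *m T = T *m PA ->
  (\sum_m (dl m ^+ 2)%:C *: ((h m)^t* *m W *m h m)) *m T =
  T *m (\sum_m (dl m ^+ 2)%:C *: ((h m)^t* *m W *m h m)).
Proof.
move=> [zT _] pT; rewrite h_cosandwich; have [X' pr] := pairB (ulsubmx W).
have -> : block_mx 0 0 0 (trB (ulsubmx W)) = block_mx X' 0 0 (trB (ulsubmx W)) *m (1%:M - PA).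
  rewrite mulmxBr mulmx1 mulmx_block !(mulmx0, mul0mx, mulmx1, addr0, add0r).
  by rewrite opp_block_mx add_block_mx !oppr0 subrr !addr0.
have pT' : (1%:M - PA) *m T = T *m (1%:M - PA).
  by rewrite mulmxBl mulmxBr mul1mx mulmx1 pT.
rewrite -mulmxA pT' !mulmxA zT //.
by exists X', (trB (ulsubmx W)).
Qed.

Section Frames.
Variables (N : nat) (e U : 'I_N -> 'M[C]_n) (rep : 'I_N -> 'I_N) (dv : 'I_N -> R).
Variable isA : pred 'I_N.
Hypothesis Pe : forall v, [/\ (e v)^t* = e v, e v *m e v = e v, e v != 0 & twisted ZZ wt 1 (e v)].
Hypothesis Oe : forall v w, v != w -> e v *m e w = 0.
Hypothesis Se : \sum_v e v = 1%:M.
Hypothesis PAe : forall v, PA *m e v = if isA v then e v else 0.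
Hypothesis rr : forall v, rep (rep v) = rep v.
Hypothesis dv0 : forall v, 0 < dv v.
Hypothesis Utw : forall v, twisted ZZ wt (dv v) (U v).
Hypothesis U1 : forall v, (U v)^t* *m U v = e (rep v).
Hypothesis U2 : forall v, U v *m (U v)^t* = e v.
Variable c : I -> 'I_N -> 'I_N -> C.
Hypothesis cE : forall m v w, (U v)^t* *m h m *m U w =
  if rep v == rep w then c m v w *: e (rep v) else 0.
Hypothesis c_dl : forall m v w, c m v w != 0 -> dl m * dv w = dv v.
Hypothesis c_rep : forall m v w, c m v w != 0 -> rep v = rep w.

Let he v : (e v)^t* = e v. Proof. by have [] := Pe v. Qed.
Let ee v : e v *m e v = e v. Proof. by have [] := Pe v. Qed.
Let e0 v : e v != 0. Proof. by have [] := Pe v. Qed.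
Let etw v : twisted ZZ wt 1 (e v). Proof. by have [] := Pe v. Qed.

Let Ue v : U v *m e (rep v) = U v.
Proof. by apply: partial_isometry_mul; rewrite ?U1. Qed.

Let eU v : e v *m U v = U v.
Proof.
apply: (@adjmx_inj _ n n); rewrite adjmxM he.
by apply: partial_isometry_mul; rewrite ?trmxCK ?U2.
Qed.

Let ePA v : e v *m PA = if isA v then e v else 0.
Proof.
apply: (@adjmx_inj _ n n); rewrite adjmxM PAadj he PAe.
by case: isA; rewrite ?he ?adjmx0.
Qed.

Let PAU v : PA *m U v = if isA v then U v else 0.
Proof. by rewrite -{1}eU mulmxA PAe; case: isA; rewrite ?eU ?mul0mx. Qed.

Let UPA v : (U v)^t* *m PA = if isA v then (U v)^t* else 0.
Proof.
apply: (@adjmx_inj _ n n); rewrite adjmxM PAadj trmxCK PAU.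
by case: isA; rewrite ?trmxCK ?adjmx0.
Qed.

Let hPA m : h m *m PA = 0.
Proof. by rewrite mulmx_block !(mulmx0, mul0mx, addr0) block_mx0. Qed.

Let PAh m : PA *m h m = h m.
Proof. by rewrite mulmx_block !(mulmx0, mul0mx, addr0, mul1mx). Qed.

Lemma c_isA m v w : c m v w != 0 -> isA v && ~~ isA w.
Proof.
move=> c0; have := cE m v w; rewrite (c_rep c0) eqxx => E.
have X0 : (U v)^t* *m h m *m U w != 0.
  by rewrite E scaler_eq0 (negPf c0) (negPf (e0 _)).
apply/andP; split.
  by apply: contraNT X0 => /negPf vA; rewrite -PAh mulmxA UPA vA !mul0mx.
apply: contra X0 => wA; have -> : U w = PA *m U w by rewrite PAU wA.
by rewrite -!mulmxA (mulmxA (h m)) hPA mul0mx mulmx0.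
Qed.

Lemma h_expand m : h m = \sum_v \sum_w c m v w *: (U v *m (U w)^t*).
Proof.
rewrite -[LHS]mul1mx -[LHS]mulmx1 -Se !mulmx_suml; apply: eq_bigr => v _.
rewrite mulmx_sumr; apply: eq_bigr => w _.
have -> : e v *m h m *m e w = U v *m ((U v)^t* *m h m *m U w) *m (U w)^t*.
  by rewrite -U2 -[in LHS](U2 w) !mulmxA.
rewrite cE; case: eqP => [_|vw].
  by rewrite -scalemxAr -scalemxAl Ue.
have -> : c m v w = 0 by apply: contra_notP vw => /eqP; apply: c_rep.
by rewrite mulmx0 mul0mx scale0r.
Qed.

Lemma cEadj m v w : (U w)^t* *m (h m)^t* *m U v =
  if rep v == rep w then (c m v w)^* *: e (rep v) else 0.
Proof.
have -> : (U w)^t* *m (h m)^t* *m U v = ((U v)^t* *m h m *m U w)^t*.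
  by rewrite !adjmxM trmxCK mulmxA.
by rewrite cE; case: eqP => _; rewrite ?adjmx0 // adjmxZ he.
Qed.

Definition cc v w v' w' := \sum_m c m v w * (c m v' w')^*.

(** Any sum of [h k *m W *m (h k)^t*] commutes with every [e v], so its corner between different
    projections vanishes. For [W] carried by [U w] and [U w'] that corner is the Gram entry of the
    scalars times a matrix that can be chosen nonzero. *)
Lemma cc_row v w v' w' : v != v' -> cc v w v' w' = 0.
Proof.
move=> vv'; apply: contrapT => /eqP cc0.
have [m m0] : exists m, c m v w * (c m v' w')^* != 0.
  apply: contrapT => H; move/eqP: cc0; apply; apply: big1 => m _.
  by apply/eqP; apply: contrapT => /negP ?; apply: H; exists m.
have [cm cm'] : c m v w != 0 /\ c m v' w' != 0.
  by move: m0; rewrite mulf_eq0 conjC_eq0 negb_or => /andP.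
have [rv rv'] := (c_rep cm, c_rep cm').
have [K K0] := exists_mulmx_neq0 (e0 (rep v)) (e0 (rep v')).
pose W := U w *m K *m (U w')^t*.
have E : (U v)^t* *m (\sum_k h k *m W *m (h k)^t*) *m U v' =
    cc v w v' w' *: (e (rep v) *m K *m e (rep v')).
  rewrite mulmx_sumr mulmx_suml scaler_suml; apply: eq_bigr => k _.
  have -> : (U v)^t* *m (h k *m W *m (h k)^t*) *m U v' =
     ((U v)^t* *m h k *m U w) *m K *m ((U w')^t* *m (h k)^t* *m U v') by rewrite !mulmxA.
  by rewrite cE cEadj rv rv' !eqxx -!scalemxAl -scalemxAr scalerA.
move/eqP: K0; apply; apply/eqP; have : cc v w v' w' *: (e (rep v) *m K *m e (rep v')) == 0.
  rewrite -E -eU adjmxM he -!mulmxA (mulmxA (e v)).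
  rewrite -(h_sandwich_comm W (etw v)) ?PAe ?ePA //.
  by rewrite -!mulmxA -[U v']eU (mulmxA (e v)) Oe // mul0mx !mulmx0.
by rewrite scaler_eq0 (negPf cc0).
Qed.

Lemma dl_c m v w : (dl m ^+ 2)%:C * c m v w = ((dv v / dv w) ^+ 2)%:C * c m v w.
Proof.
have [->|cm] := eqVneq (c m v w) 0; first by rewrite !mulr0.
by rewrite -(c_dl cm) mulfK // gt_eqF.
Qed.

Lemma h_cosandwich_frame v w v' w' K : rep v = rep w -> rep v' = rep w' ->
  (U w)^t* *m (\sum_k (dl k ^+ 2)%:C *: ((h k)^t* *m (U v *m K *m (U v')^t*) *m h k)) *m U w' =
    (((dv v / dv w) ^+ 2)%:C * (cc v w v' w')^*) *: (e (rep w) *m K *m e (rep w')).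
Proof.
move=> rv rv'; rewrite mulmx_sumr mulmx_suml rmorph_sum mulr_sumr scaler_suml.
apply: eq_bigr => k _.
rewrite -scalemxAr -scalemxAl.
have -> : (U w)^t* *m ((h k)^t* *m (U v *m K *m (U v')^t*) *m h k) *m U w' =
   ((U w)^t* *m (h k)^t* *m U v) *m K *m ((U v')^t* *m h k *m U w') by rewrite !mulmxA.
rewrite cE cEadj rv rv' !eqxx -!scalemxAl -scalemxAr !scalerA /=; congr (_ *: _).
rewrite [(c k v w * _)^*]rmorphM /= conjCK mulrA; congr (_ * _).
have := congr1 Num.conj (dl_c k v w); rewrite !rmorphM /= => H.
by have := H; rewrite !conjC_real => ->.
Qed.

(** The same argument on the B side. The weights [dl k ^+ 2] do not spoil the Gram entry: wherever
    [c k v w] is nonzero they equal [(dv v / dv w) ^+ 2], independently of [k]. *)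
Lemma cc_col v w v' w' : w != w' -> cc v w v' w' = 0.
Proof.
move=> ww'; apply: contrapT => /eqP cc0.
have [m m0] : exists m, c m v w * (c m v' w')^* != 0.
  apply: contrapT => H; move/eqP: cc0; apply; apply: big1 => m _.
  by apply/eqP; apply: contrapT => /negP ?; apply: H; exists m.
have [cm cm'] : c m v w != 0 /\ c m v' w' != 0.
  by move: m0; rewrite mulf_eq0 conjC_eq0 negb_or => /andP.
have [rv rv'] := (c_rep cm, c_rep cm').
have [K K0] := exists_mulmx_neq0 (e0 (rep w)) (e0 (rep w')).
have E := h_cosandwich_frame K rv rv'.
move/eqP: K0; apply; apply/eqP.
have : (((dv v / dv w) ^+ 2)%:C * (cc v w v' w')^*) *: (e (rep w) *m K *m e (rep w')) == 0.
  rewrite -E -[U w]eU adjmxM he -!mulmxA (mulmxA (e w)).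
  rewrite -(h_cosandwich_comm _ (etw w)) ?PAe ?ePA //.
  by rewrite -!mulmxA -[U w']eU (mulmxA (e w)) Oe // mul0mx !mulmx0.
rewrite scaler_eq0 mulf_eq0 conjC_eq0 (negPf cc0) orbF fmorph_eq0 expf_eq0 /=.
by rewrite mulf_eq0 invr_eq0 !gt_eqF.
Qed.

Definition qq v w := \sum_m normsq (c m v w).

Lemma cc_diag v w : cc v w v w = (qq v w)%:C.
Proof.
by rewrite rmorph_sum; apply: eq_bigr => m _; rewrite /= normsqE mulrC.
Qed.

(** The partial isometry from [w] to [w'] is twisted but commutes with [PA], both ends being in H_B.
    It therefore commutes with the images of the B-side map, which look alike on the two ranges;
    only the twists distinguish the two lengths. *)
Lemma qq_transfer v w w' : rep v = rep w -> rep v = rep w' -> ~~ isA w -> ~~ isA w' ->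
  qq v w / dv w ^+ 2 = qq v w' / dv w' ^+ 2.
Proof.
move=> vw vw' wB wB'.
have [K K0] := exists_mulmx_neq0 (e0 (rep v)) (e0 (rep v)).
have E := h_cosandwich_frame K vw vw; have E' := h_cosandwich_frame K vw' vw'.
set Y := \sum_k _ in E E'.
pose T := U w' *m (U w)^t*.
have Ttw : twisted ZZ wt (dv w' * (dv w)^-1) T.
  by apply: twistedM => //; apply: twisted_adj.
have PAT : PA *m T = T *m PA.
  by rewrite /T mulmxA PAU (negPf wB') mul0mx -mulmxA UPA (negPf wB) mulmx0.
have YT := h_cosandwich_comm (U v *m K *m (U v)^t*) Ttw PAT; rewrite -/Y in YT.
have TU : T *m U w = U w' by rewrite /T -mulmxA U1 -vw vw' Ue.
have EE : (U w')^t* *m Y *m U w' = (U w)^t* *m Y *m U w.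
  rewrite -{2}TU -mulmxA (mulmxA Y) YT /T -!mulmxA (mulmxA ((U w')^t*)) U1.
  rewrite -vw' vw (mulmxA (e _)); congr (_ *m _).
  by apply: (@adjmx_inj _ n n); rewrite adjmxM trmxCK he Ue.
move: EE; rewrite E E' -vw -vw' => /eqP; rewrite -subr_eq0 -scalerBl scaler_eq0 (negPf K0) orbF.
rewrite !cc_diag !conjC_real -!rmorphM subr_eq0 => /eqP /complexI.
have dvv : dv v != 0 by rewrite gt_eqF.
rewrite !exprMn !exprVn -!mulrA => E3; have H := mulfI dvv (mulfI dvv E3).
by rewrite [LHS]mulrC [RHS]mulrC H.
Qed.

Lemma qq_sum v : isA v -> \sum_w qq v w = 1.
Proof.
move=> vA; have := h_sandwich 1%:M.
have -> : drsubmx (1%:M : 'M[C]_n) = 1%:M by rewrite scalar_mx_block block_mxKdr.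
rewrite trA1 => H.
have : (U v)^t* *m (\sum_m h m *m 1%:M *m (h m)^t*) *m U v = (\sum_w qq v w)%:C *: e (rep v).
  rewrite mulmx_sumr mulmx_suml exchange_big rmorph_sum scaler_suml; apply: eq_bigr => m _ /=.
  have -> : (U v)^t* *m (h m *m 1%:M *m (h m)^t*) *m U v =
     \sum_w ((U v)^t* *m h m *m U w) *m ((U w)^t* *m (h m)^t* *m U v).
    rewrite mulmx1 -[X in h m *m X]mul1mx -Se mulmx_suml !mulmx_sumr mulmx_suml.
    by apply: eq_bigr => w _; rewrite -U2 !mulmxA.
  rewrite rmorph_sum scaler_suml; apply: eq_bigr => w _ /=.
  rewrite cE cEadj; case: eqP => [_|vw]; first by rewrite -scalemxAl -scalemxAr scalerA ee normsqE mulrC.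
  have -> : c m v w = 0 by apply: contra_notP vw => /eqP; apply: c_rep.
  by rewrite mulmx0 /normsq /= expr0n addr0 scale0r.
rewrite H -/PA UPA vA U1 => /eqP; rewrite -[X in X == _]scale1r eq_sym -subr_eq0 -scalerBl.
by rewrite scaler_eq0 (negPf (e0 _)) orbF subr_eq0 -[1](rmorph1 (real_complex R)) => /eqP/complexI.
Qed.

Definition mass r := \sum_(w | ~~ isA w && (rep w == r)) dv w ^+ 2.

(** Proportionality to [dv w ^+ 2] and unitality of [trA] determine the lengths. They do not depend
    on [v], which is what makes the weights of the mixture products of a factor from BC and a factor
    from CA. *)
Lemma qqE v w : isA v -> ~~ isA w -> rep v = rep w -> qq v w = dv w ^+ 2 / mass (rep w).
Proof.
move=> vA wB vw.
have dw : dv w ^+ 2 != 0 by rewrite expf_neq0 // gt_eqF.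
have E : qq v w / dv w ^+ 2 * mass (rep w) = 1.
  rewrite -(qq_sum vA) mulr_sumr [RHS](bigID (fun u => ~~ isA u && (rep u == rep w))) /=.
  rewrite [X in _ = _ + X]big1 ?addr0 => [|u uw].
    apply: eq_bigr => u /andP[uB /eqP uw]; rewrite (@qq_transfer v w u) ?vw ?uw //.
    by rewrite divfK // expf_neq0 // gt_eqF.
  apply: big1 => m _; apply/eqP; rewrite normsq_eq0; apply: contraNT uw => cm.
  by have /andP[_ ->] := c_isA cm; rewrite -(c_rep cm) vw eqxx.
have M0 : mass (rep w) != 0.
  by apply/eqP => M0; move/eqP: E; rewrite M0 mulr0 eq_sym oner_eq0.
apply/(mulIf M0); rewrite divfK // -{1}[qq v w](divfK dw).
by rewrite mulrAC E mul1r.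
Qed.

Variables (eps : 'I_N -> 'I_n -> R) (f : 'I_N -> 'I_n -> 'cV[C]_n).
Hypothesis eps0 : forall r x, 0 <= eps r x.
Hypothesis fon : forall r, orthonormal_vectors (f r).
Hypothesis fE : forall r, e r *m tau *m e r = \sum_x (eps r x)%:C *: projector (f r x).
Variable rho : 'M[C]_(a * b).
Hypothesis rhoE : forall i j i' j', rho (mxtens_index (i, j)) (mxtens_index (i', j')) =
  \sum_m (rdiag s *m eta m) i j * ((rdiag s *m eta m) i' j')^*.

Lemma ef r x : 0 < eps r x -> e r *m f r x = f r x.
Proof.
move=> e_gt0; have fon' k l : xpredT k -> xpredT l -> (f r k)^t* *m f r l = (k == l)%:R%:M.
  by move=> _ _; apply: fon.
have H := @projector_sum_mul R n 'I_n xpredT (eps r) (f r) fon' x isT; rewrite -fE in H.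
have eC : (eps r x)%:C != 0 by rewrite fmorph_eq0 gt_eqF.
apply: (scalerI eC); rewrite scalemxAr -H.
by rewrite !mulmxA ee.
Qed.

Let T v w := tau *m U v *m (U w)^t*.

(** The twist moves [tau] between the partial isometries, into the common range [e (rep w)]. All
    pairs of a class therefore share the spectrum [eps], which becomes the Schmidt spectrum of the
    edge AB. *)
Lemma T_expand v w : rep v = rep w -> T v w = (dv v)%:C *:
  \sum_(x | 0 < eps (rep w) x) (eps (rep w) x)%:C *:
    ((U v *m f (rep w) x) *m (U w *m f (rep w) x)^t*).
Proof.
move=> vw; have [_ tU] := Utw v; rewrite /T [tau *m U v]tU -scalemxAl; congr (_ *: _).
have -> : U v *m rdiag wt *m (U w)^t* = U v *m (e (rep w) *m tau *m e (rep w)) *m (U w)^t*.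
  have eU' : e (rep w) *m (U w)^t* = (U w)^t*.
    by apply: (@adjmx_inj _ n n); rewrite adjmxM trmxCK he Ue.
  by rewrite -!mulmxA eU' !mulmxA -vw Ue.
rewrite fE mulmx_sumr mulmx_suml (bigID (fun x => 0 < eps (rep w) x)) /=.
rewrite [X in _ + X]big1 ?addr0 => [|x].
  by apply: eq_bigr => x _; rewrite -scalemxAr -scalemxAl adjmxM /projector !mulmxA.
rewrite lt_def eps0 andbT negbK => /eqP ->.
by rewrite scale0r mulmx0 mul0mx.
Qed.

(** Expanding each Kraus operator in the frames gives cross terms between pairs [(v, w)], all
    removed by [cc_row] and [cc_col]; rho is left as a mixture of the vectors [T v w]. *)
Lemma rho_frames i j i' j' : rho (mxtens_index (i, j)) (mxtens_index (i', j')) =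
  \sum_v \sum_w (qq v w)%:C * (T v w (lshift b i) (rshift a j) *
     (T v w (lshift b i') (rshift a j'))^*).
Proof.
have tE m k l : (rdiag s *m eta m) k l =
    \sum_p c m p.1 p.2 * T p.1 p.2 (lshift b k) (rshift a l).
  have -> : (rdiag s *m eta m) k l = (tau *m h m) (lshift b k) (rshift a l).
    by rewrite tau_block mulmx_block !(mulmx0, mul0mx, addr0) block_mxEur.
  rewrite h_expand mulmx_sumr summxE sum_pair; apply: eq_bigr => v _.
  rewrite mulmx_sumr summxE; apply: eq_bigr => w _.
  by rewrite -scalemxAr mulmxA mxE.
transitivity (\sum_p \sum_p' cc p.1 p.2 p'.1 p'.2 *
   (T p.1 p.2 (lshift b i) (rshift a j) * (T p'.1 p'.2 (lshift b i') (rshift a j'))^*)).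
  rewrite rhoE; under eq_bigr do rewrite !tE rmorph_sum mulr_suml.
  rewrite exchange_big; apply: eq_bigr => p _ /=.
  under eq_bigr do rewrite mulr_sumr.
  rewrite exchange_big; apply: eq_bigr => p' _ /=.
  rewrite /cc mulr_suml; apply: eq_bigr => m _; rewrite rmorphM /=; ring.
rewrite pair_bigA /=.
rewrite (eq_bigr (fun p : ('I_N * 'I_N) * ('I_N * 'I_N) => (qq p.1.1 p.1.2)%:C *
  (T p.1.1 p.1.2 (lshift b i) (rshift a j) * (T p.2.1 p.2.2 (lshift b i') (rshift a j'))^*) *
  (p.2 == p.1)%:R)) => [|[[v w] [v' w']] _ /=].
  rewrite sum_pair sum_pair; apply: eq_bigr => v _; apply: eq_bigr => w _ /=.
  by rewrite (sum_deltar (fun p' : 'I_N * 'I_N => (qq v w)%:C *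
    (T v w (lshift b i) (rshift a j) * (T p'.1 p'.2 (lshift b i') (rshift a j'))^*)) (v, w)).
rewrite xpair_eqE [v' == v]eq_sym [w' == w]eq_sym.
have [<-|vv'] := eqVneq v v'; last by rewrite cc_row // mul0r mulr0.
have [<-|ww'] := eqVneq w w'; last by rewrite cc_col // mul0r mulr0.
by rewrite cc_diag mulr1.
Qed.

(** The trace of [tau *m tau] on the range of [e r], where [tau] has the eigenvalues [eps r]. *)
Definition frame_weight r := \sum_(x | 0 < eps r x) eps r x ^+ 2.

Lemma frame_weight_gt0 r x : 0 < eps r x -> 0 < frame_weight r.
Proof.
move=> ex; rewrite /frame_weight (bigD1 x) //= ltr_wpDr ?exprn_gt0 //.
by rewrite sumr_ge0 // => y _; rewrite sqr_ge0.
Qed.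

Lemma frames_triangle_mixture : triangle_mixture rho.
Proof.
pose AX := [pred p : 'I_N * 'I_n | (rep p.1 == p.1) && (0 < eps p.1 p.2)].
pose AY := [pred w : 'I_N | ~~ isA w].
pose AZ := [pred v : 'I_N | isA v].
pose jx (x : {x in AX}) := (val x).1.
pose jy (y : {y in AY}) := rep (val y).
pose jz (z : {z in AZ}) := rep (val z).
pose l (x : {x in AX}) := eps (val x).1 (val x).2 ^+ 2 / frame_weight (val x).1.
pose m (y : {y in AY}) := dv (val y) ^+ 2 / mass (rep (val y)).
(* By the twist of [U], this is the trace of [tau *m tau] on the range of [e (val z)]. It is not
   normalized: the probability of the summand is still contained in it. *)
pose nn (z : {z in AZ}) := frame_weight (rep (val z)) * dv (val z) ^+ 2.
pose al (z : {z in AZ}) (x : {x in AX}) : 'cV[C]_a :=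
  usubmx (U (val z) *m f (val x).1 (val x).2).
(* Conjugated because the B vector enters [T v w] through its adjoint. *)
pose be (y : {y in AY}) (x : {x in AX}) : 'cV[C]_b :=
  map_mx Num.conj (dsubmx (U (val y) *m f (val x).1 (val x).2)).
have sumX (V : nmodType) (F : 'I_N -> 'I_n -> V) r : rep r = r ->
    \sum_(x | jx x == r) F (val x).1 (val x).2 = \sum_(x | 0 < eps r x) F r x.
  move=> r_r; rewrite -(big_sub_cond AX (fun p => p.1 == r) (fun p => F p.1 p.2)).
  rewrite big_mkcond sum_pair (bigD1 r) //= [X in _ + X]big1 ?addr0 => [|k kr].
    by rewrite [RHS]big_mkcond; apply: eq_bigr => x _; rewrite inE /= r_r !eqxx andbT.
  by rewrite big1 // => x _; rewrite inE /= (negPf kr) andbF.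
have jxr (x : {x in AX}) : rep (jx x) = jx x.
  by have := valP x; rewrite inE /= => /andP[/eqP].
have epsx (x : {x in AX}) : 0 < eps (val x).1 (val x).2.
  by have := valP x; rewrite inE /= => /andP[].
have efx (x : {x in AX}) : e (val x).1 *m f (val x).1 (val x).2 = f (val x).1 (val x).2.
  exact: ef.
exists 'I_N, {x in AX}, {y in AY}, {z in AZ}, jx, jy, jz, l, m, nn, al, be.
have weight_ge0 r : 0 <= frame_weight r.
  by rewrite sumr_ge0 // => x _; rewrite sqr_ge0.
have mass_ge0 r : 0 <= mass r by rewrite sumr_ge0 // => x _; rewrite sqr_ge0.
have frame_on v w (x y : {x in AX}) : rep v = jx x -> rep w = jx y ->
    (U v *m f (val x).1 (val x).2)^t* *m (U w *m f (val y).1 (val y).2) =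
    ((v == w) && (x == y))%:R%:M.
  move=> vx wy; rewrite adjmxM -mulmxA (mulmxA ((U v)^t*)).
  have [E|vw] := eqVneq v w; last first.
    by rewrite -[U v]eU -[U w]eU adjmxM he -!mulmxA (mulmxA (e v)) Oe // mul0mx !mulmx0 raddf0.
  rewrite -E U1 vx; have xy : jx x = jx y by rewrite -vx -wy E.
  rewrite xy efx -(inj_eq val_inj) /=.
  move: xy; rewrite /jx /=; case: (sval x) (sval y) => [r k] [r' k'] /= ->.
  by rewrite fon xpair_eqE eqxx.
have PAcol (u : 'cV[C]_n) : PA *m u = col_mx (usubmx u) 0.
  by rewrite -{1}[u]vsubmxK mul_block_col !mul0mx mul1mx !addr0.
have dotE (u u' : 'cV[C]_n) : u^t* *m u' =
    (usubmx u)^t* *m usubmx u' + (dsubmx u)^t* *m dsubmx u'.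
  by rewrite -{1}[u]vsubmxK -{1}[u']vsubmxK tr_col_mx map_row_mx mul_row_col.
have isAz (z : {z in AZ}) : isA (val z) by exact: (valP z).
have isBy (y : {y in AY}) : ~~ isA (val y) by exact: (valP y).
have lowA (z : {z in AZ}) (x : {x in AX}) : dsubmx (U (val z) *m f (val x).1 (val x).2) = 0 :> 'cV[C]_b.
  have -> : U (val z) = PA *m U (val z) by rewrite PAU isAz.
  by rewrite -mulmxA PAcol col_mxKd.
have upB (y : {y in AY}) (x : {x in AX}) : usubmx (U (val y) *m f (val x).1 (val x).2) = 0 :> 'cV[C]_a.
  have : PA *m (U (val y) *m f (val x).1 (val x).2) = 0.
    by rewrite mulmxA PAU (negPf (isBy y)) mul0mx.
  by rewrite PAcol => /(congr1 usubmx); rewrite col_mxKu linear0.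
have mass_gt0 (y : {y in AY}) : 0 < mass (rep (val y)).
  rewrite /mass (bigD1 (val y)) /=; last by rewrite isBy eqxx.
  by rewrite ltr_wpDr ?exprn_gt0 // sumr_ge0 // => w _; rewrite sqr_ge0.
split; split.
- split=> [x|x0]; first by rewrite divr_gt0 ?exprn_gt0 ?(frame_weight_gt0 (epsx x)).
  rewrite (sumX _ (fun r k => eps r k ^+ 2 / frame_weight r)) //.
  by rewrite -mulr_suml divff // gt_eqF // (frame_weight_gt0 (epsx x0)).
- split=> [y|y0]; first by rewrite divr_gt0 ?exprn_gt0 // (mass_gt0 y).
  rewrite -(big_sub_cond AY (fun w => rep w == rep (val y0)) (fun w => dv w ^+ 2 / mass (rep w))).
  rewrite (eq_bigr (fun w => dv w ^+ 2 / mass (rep (val y0)))) => [|w /andP[_ /eqP ->]] //.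
  by rewrite -mulr_suml; apply: divff; rewrite gt_eqF //; apply: (mass_gt0 y0).
- by move=> z; rewrite mulr_ge0 ?sqr_ge0.
- move=> z x z' x' zx zx'; rewrite -(inj_eq val_inj z z') -(frame_on _ _ _ _ zx zx').
  by rewrite dotE !lowA mulmx0 addr0.
- move=> y x y' x' yx yx'; rewrite -(inj_eq val_inj y y').
  have := congr1 (map_mx Num.conj) (frame_on _ _ _ _ yx yx').
  rewrite dotE !upB mulmx0 add0r map_scalar_mx /= conjC_nat => <-.
  by rewrite map_mxM /be map_trmx.
apply/matrixP => u u'; case: (mxtens_indexP u) => i j; case: (mxtens_indexP u') => i' j'.
rewrite rho_frames exchange_big /= (bigID (fun w => w \in AY)) /=.
rewrite [X in _ + X]big1 ?addr0 => [|w wA]; last first.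
  apply: big1 => v _; have -> : qq v w = 0; last by rewrite mul0r.
  apply: big1 => k _; apply/eqP; rewrite normsq_eq0; apply: contraR wA => ck.
  by have /andP[] := c_isA ck.
rewrite big_sub summxE; apply: eq_bigr => y _.
rewrite (bigID (fun v => (v \in AZ) && (rep v == jy y))) /=.
rewrite [X in _ + X]big1 ?addr0 => [|v vA]; last first.
  have -> : qq v (val y) = 0; last by rewrite mul0r.
  apply: big1 => k _; apply/eqP; rewrite normsq_eq0; apply: contraR vA => ck.
  by have /andP[vA _] := c_isA ck; rewrite inE /= vA (c_rep ck) eqxx.
rewrite (big_sub_cond AZ (fun v => rep v == jy y)) summxE; apply: eq_bigr => z /eqP zy.
(* Dividing [eps] by the root of [frame_weight] normalizes the Schmidt coefficients; the square of
   the scalar left in front is [nn z]. *)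
have TE k k' : T (val z) (val y) (lshift b k) (rshift a k') =
    (dv (val z) * Num.sqrt (frame_weight (rep (val y))))%:C *
    (\sum_(x | jx x == jy y) (Num.sqrt (l x))%:C *: tensv (al z x) (be y x)) (mxtens_index (k, k')) 0.
  rewrite T_expand // mxE summxE rmorphM -mulrA /=; congr (_ * _).
  rewrite summxE mulr_sumr.
  rewrite -(sumX _ (fun r x => ((eps r x)%:C *: ((U (val z) *m f r x) *m
     (U (val y) *m f r x)^t*)) (lshift b k) (rshift a k')) (rep (val y))) //.
  apply: eq_bigr => x /eqP xy; rewrite [LHS]mxE [X in _ = _ * X]mxE tensvE.
  have -> : al z x k 0 = (U (val z) *m f (val x).1 (val x).2) (lshift b k) 0 by rewrite mxE.
  have -> : be y x k' 0 = ((U (val y) *m f (val x).1 (val x).2) (rshift a k') 0)^*.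
    by rewrite mxE mxE.
  rewrite [X in _ * X]mxE big_ord1 adjmxE /l -xy /jx.
  rewrite sqrtrM ?sqr_ge0 // sqrtr_sqr gtr0_norm // sqrtrV //.
  rewrite [RHS]mulrA -rmorphM; congr (_%:C * _).
  rewrite mulrCA divff ?mulr1 // gt_eqF // sqrtr_gt0.
  exact: (frame_weight_gt0 (epsx x)).
rewrite !TE; set v := \sum_(x | _) _.
rewrite [RHS]mxE [X in _ = _ * X](_ : _ = v (mxtens_index (i, j)) 0 * (v (mxtens_index (i', j')) 0)^*);
  last by rewrite /projector mxE big_ord1 adjmxE.
rewrite qqE ?isAz ?isBy // [(_ * v _ _)^*]rmorphM /= conjC_real.
have -> : m y * nn z = dv (val y) ^+ 2 / mass (rep (val y)) *
    (dv (val z) * Num.sqrt (frame_weight (rep (val y)))) ^+ 2.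
  by rewrite exprMn sqr_sqrtr // /nn /m [rep (val z)]zy mulrC; ring.
by rewrite [in RHS]rmorphM rmorphXn /=; ring.
Qed.

End Frames.

Theorem intertwiner_triangle_mixture (rho : 'M[C]_(a * b)) :
  (forall i j i' j', rho (mxtens_index (i, j)) (mxtens_index (i', j')) =
    \sum_m (rdiag s *m eta m) i j * ((rdiag s *m eta m) i' j')^*) ->
  triangle_mixture rho.
Proof.
move=> rhoE.
have [N [e [U [rep [dv [isA [[Pe Oe Se PAe] [rr dv0 Utw U1 U2] Ho Hs]]]]]]] :=
  twisted_frames wt0 ZZadj PAadj PAidem PAtw.
have he v : (e v)^t* = e v by have [] := Pe v.
have /choice[c cP] : forall p : I * 'I_N * 'I_N, exists c : C,
    [/\ (U p.1.2)^t* *m h p.1.1 *m U p.2 =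
         (if rep p.1.2 == rep p.2 then c *: e (rep p.1.2) else 0),
        c != 0 -> dl p.1.1 * dv p.2 = dv p.1.2 &
        c != 0 -> rep p.1.2 = rep p.2].
  move=> [[m v] w] /=; have [vw|vw] := eqVneq (rep v) (rep w).
    by have [c [cE cd]] := Hs _ _ _ _ (dl0 m) (h_tw m) vw; exists c.
  exists 0; rewrite eqxx; split=> //.
  have ev : (U v)^t* *m e v = (U v)^t*.
    by apply: partial_isometry_mul; rewrite ?trmxCK ?U2 //; have [] := Pe v.
  have ew : e w *m U w = U w.
    apply: (@adjmx_inj _ n n); rewrite adjmxM he.
    by apply: partial_isometry_mul; rewrite ?trmxCK ?U2 //; have [] := Pe w.
  rewrite -ev -ew -!mulmxA (mulmxA (h m)) (mulmxA (e v)) (mulmxA (e v)).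
  by rewrite (Ho _ _ _ _ (dl0 m) (h_tw m) vw) mul0mx mulmx0.
have /choice[fr frP] : forall r, exists p : ('I_n -> R) * ('I_n -> 'cV[C]_n),
    [/\ forall x, 0 <= p.1 x, orthonormal_vectors p.2 &
        e r *m tau *m e r = \sum_x (p.1 x)%:C *: projector (p.2 x)].
  (* Writing [e r *m tau *m e r] as a Gram matrix makes its eigenvalues nonnegative at once. *)
  move=> r; have [w [v [w0 von E _ _]]] := gram_eigenbasis (e r *m rdiag (fun k => Num.sqrt (wt k))).
  exists (w, v); split=> //=; rewrite -E adjmxM he adj_rdiag !mulmxA -[in RHS](mulmxA (e r)) rdiagM.
  congr (_ *m _ *m _); congr rdiag; apply/funext => k.
  by rewrite -expr2 sqr_sqrtr // ltW.
apply: (@frames_triangle_mixture N e U rep dv isA Pe Oe Se PAe rr dv0 Utw U1 U2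
  (fun m v w => c (m, v, w)) _ _ _ (fun r => (fr r).1) (fun r => (fr r).2)) => //.
- by move=> m v w; have [] := cP (m, v, w).
- by move=> m v w; have [] := cP (m, v, w).
- by move=> m v w; have [] := cP (m, v, w).
- by move=> r; have [] := frP r.
- by move=> r; have [] := frP r.
- by move=> r; have [] := frP r.
Qed.

End Structure.

(** * The Kraus operators taken from the square root of rho *)

Section GapZero.
Variable R : realType.
Local Notation C := R[i].

Lemma sqrtmx_gram n N (X : 'M[C]_(n, N)) :
  let M := sqrtmx (X *m X^t*) in M^t* = M /\ M *m M = X *m X^t*.
Proof.
have hX : (X *m X^t*)^t* = X *m X^t* by rewrite adjmxM trmxCK.
split; first exact: adj_hermfun.
have [L [r [w [r0 won E _]]]] := gram_positive_decomposition X.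
have won' k l : xpredT k -> xpredT l -> (w k)^t* *m w l = (k == l)%:R%:M by [].
rewrite /sqrtmx E (hermfun_sum r won' (sqrtr0 _)) mulmx_sumr; apply: eq_bigr => k _.
rewrite /projector -scalemxAr mulmxA (projector_sum_mul _ won') //.
by rewrite -scalemxAl scalerA -rmorphM -expr2 sqr_sqrtr // ltW.
Qed.

Theorem markov_gap0_mixture_diag a b N (X : 'M[C]_(a * b, N)) (al : 'I_a -> R) (be : 'I_b -> R) :
  (forall i, 0 < al i) -> (forall j, 0 < be j) ->
  ptrace2 (X *m X^t*) = rdiag al -> ptrace1 (X *m X^t*) = rdiag be ->
  markov_gap (X *m X^t*) = 0 -> triangle_mixture (X *m X^t*).
Proof.
move=> al0 be0 rhoA rhoB gap0.
have [G [Giso Gflat Ghom]] := markov_gap0_flat al0 be0 rhoA rhoB gap0.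
have hrho : (X *m X^t*)^t* = X *m X^t* by rewrite adjmxM trmxCK.
have [hM MM] := sqrtmx_gram X; set rho := X *m X^t* in Gflat Ghom rhoA rhoB hrho hM MM *.
pose M := sqrtmx rho; rewrite -/M in hM MM.
(* Columns of the square root, unlike those of [X], are homogeneous: [M] commutes with [D], which is
   rho_A (x) rho_B^-1, so column [m] is supported where [D] takes the value [D m]. This is the
   origin of [dl]. *)
pose om (m : 'I_(a * b)) : 'M[C]_(a, b) := \matrix_(i, j) M (mxtens_index (i, j)) m.
pose D (u : 'I_(a * b)) : R := al (mxtens_unindex u).1 / be (mxtens_unindex u).2.
pose s i := Num.sqrt (al i); pose t j := Num.sqrt (be j); pose dl m := Num.sqrt (D m).
have s0 i : 0 < s i by rewrite sqrtr_gt0.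
have t0 j : 0 < t j by rewrite sqrtr_gt0.
have D0 u : 0 < D u by rewrite divr_gt0.
have dl0 m : 0 < dl m by rewrite sqrtr_gt0.
have MD : rdiag D *m M = M *m rdiag D.
  apply: hermfun_comm => //; apply/matrixP => u v.
  case: (mxtens_indexP u) => i j; case: (mxtens_indexP v) => i' j'.
  rewrite mul_rdiag_mx mul_mx_rdiag mulrC.
  have [->|r0] := eqVneq (rho (mxtens_index (i, j)) (mxtens_index (i', j'))) 0.
    by rewrite !mul0r.
  have := Ghom _ _ _ _ r0; rewrite /D !mxtens_indexK /= => E; congr (_ * _%:C).
  apply/eqP; rewrite eqr_div ?E ?(gt_eqF (be0 _)) //.
have om_entry m i j : om m i j = M (mxtens_index (i, j)) m by rewrite mxE.
have om_homog m : rdiag s *m om m = (dl m)%:C *: (om m *m rdiag t).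
  apply/matrixP => i j; rewrite mul_rdiag_mx [RHS]mxE mul_mx_rdiag om_entry.
  have := congr1 (fun Z : 'M_(a * b) => Z (mxtens_index (i, j)) m) MD.
  rewrite mul_rdiag_mx mul_mx_rdiag.
  have [->|M0] := eqVneq (M (mxtens_index (i, j)) m) 0; first by rewrite !(mulr0, mul0r).
  rewrite [LHS]mulrC => E0; have {E0}E := complexI (mulfI M0 E0).
  have -> : s i = dl m * t j.
    rewrite /dl -E /D mxtens_indexK /= sqrtrM ?ltW // sqrtrV ?ltW // -mulrA mulVf ?mulr1 //.
    by rewrite gt_eqF // sqrtr_gt0.
  by rewrite rmorphM /=; ring.
have omE i j i' j' : \sum_m om m i j * (om m i' j')^* =
    rho (mxtens_index (i, j)) (mxtens_index (i', j')).
  rewrite -MM mxE; apply: eq_bigr => m _; rewrite !om_entry.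
  by congr (_ * _); rewrite -adjmxE hM.
have omA : \sum_m om m *m (om m)^t* = rdiag (fun i => s i ^+ 2).
  transitivity (ptrace2 rho); last first.
    by rewrite rhoA; congr rdiag; apply/funext => i; rewrite sqr_sqrtr // ltW.
  apply/matrixP => i i'; rewrite summxE [RHS]mxE.
  under [LHS]eq_bigr do rewrite mxE.
  rewrite exchange_big; apply: eq_bigr => j _ /=; rewrite -omE.
  by apply: eq_bigr => m _; rewrite adjmxE.
have omB : \sum_m (om m)^t* *m om m = rdiag (fun j => t j ^+ 2).
  transitivity ((ptrace1 rho)^T); last first.
    apply/matrixP => j j'; rewrite rhoB mxE !rdiagE eq_sym; case: eqP => [->|_] //.
    by rewrite sqr_sqrtr // ltW.
  apply/matrixP => j j'; rewrite summxE [RHS]mxE [RHS]mxE.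
  under [LHS]eq_bigr do rewrite mxE.
  rewrite exchange_big; apply: eq_bigr => i _ /=; rewrite -omE.
  by apply: eq_bigr => m _; rewrite adjmxE mulrC.
have Gflat1 i i' j j' : \sum_m om m i j * (om m i' j')^* =
  (s i * t j')%:C * G (mxtens_index (i, i')) (mxtens_index (j, j')).
  by rewrite omE Gflat.
(* On the support of rho the commutation clause exchanges the two square roots; off it the entry of
   [G] vanishes as well. *)
have Gflat2 i i' j j' : \sum_m om m i j * (om m i' j')^* =
  (s i' * t j)%:C * G (mxtens_index (i, i')) (mxtens_index (j, j')).
  have [r0|r0] := eqVneq (rho (mxtens_index (i, j)) (mxtens_index (i', j'))) 0.
    have st : (s i * t j')%:C != 0 by rewrite fmorph_eq0 gt_eqF // mulr_gt0.
    move: (Gflat1 i i' j j'); rewrite omE r0 => /eqP; rewrite eq_sym mulf_eq0 (negPf st) /=.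
    by move=> /eqP ->; rewrite mulr0.
  rewrite Gflat1; congr (_%:C * _); rewrite /s /t -!sqrtrM ?ltW //.
  by rewrite (Ghom _ _ _ _ r0).
pose eta m := rdiag (fun i => (s i)^-1) *m om m.
apply: (@intertwiner_triangle_mixture R a b 'I_(a * b) s t eta dl s0 t0 dl0 _
   (transfer_pair s om dl)).
- exact: (eta_homog s0 om_homog).
- exact: transfer_pair_adj.
- move=> Y Z m; exact: (transfer_pair_intertwine s0 t0 om_homog omA omB).
- move=> Y; exists (transferB s om dl (transferA s om Y)); split=> //.
  by rewrite (transferABA s0 t0 om_homog Giso Gflat1 Gflat2).
- move=> Y; exists (transferA s om (transferB s om dl Y)); split=> //.
  by rewrite (transferBAB s0 t0 om_homog Giso Gflat1 Gflat2).
- exact: (transferA1 s0 omA).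
- move=> i j i' j'; rewrite -omE; apply: eq_bigr => m _.
  by rewrite !(eta_om _ s0).
Qed.

End GapZero.

(** * Restriction to the supports of the marginals *)

Section Reduction.
Variable R : realType.
Local Notation C := R[i].

Lemma tensv_mul m n p q (A : 'M[C]_(m, n)) (B : 'M[C]_(p, q)) u v :
  tensmx A B *m tensv u v = tensv (A *m u) (B *m v).
Proof.
apply/matrixP => k o; rewrite ord1 {o}; case: (mxtens_indexP k) => i j.
rewrite tensvE !mxE sum_mxtens mulr_suml; apply: eq_bigr => i' _.
rewrite mulr_sumr; apply: eq_bigr => j' _.
by rewrite tensmxE tensvE; ring.
Qed.

Lemma triangle_mixture_isometry a b a' b' (A : 'M[C]_(a, a')) (B : 'M[C]_(b, b'))
    (rho : 'M[C]_(a' * b')) :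
  A^t* *m A = 1%:M -> B^t* *m B = 1%:M -> triangle_mixture rho ->
  triangle_mixture (tensmx A B *m rho *m (tensmx A B)^t*).
Proof.
move=> AA BB [J [X [Y [Z [jx [jy [jz [l [m [n [al [be [[nl nm n0] [oa ob ->]]]]]]]]]]]]]].
exists J, X, Y, Z, jx, jy, jz, l, m, n, (fun z x => A *m al z x), (fun y x => B *m be y x).
split; split=> //.
- move=> z x z' x' zx zx'; rewrite adjmxM -mulmxA (mulmxA (A^t*)) AA mul1mx; exact: oa.
- move=> z x z' x' zx zx'; rewrite adjmxM -mulmxA (mulmxA (B^t*)) BB mul1mx; exact: ob.
- rewrite mulmx_sumr mulmx_suml; apply: eq_bigr => y _.
  rewrite mulmx_sumr mulmx_suml; apply: eq_bigr => z _.
  rewrite -scalemxAr -scalemxAl; congr (_ *: _).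
  set v := \sum_(x | _) _; set w := \sum_(x | _) _.
  have -> : w = tensmx A B *m v.
    rewrite mulmx_sumr; apply: eq_bigr => x _.
    by rewrite -scalemxAr tensv_mul.
  by rewrite /projector adjmxM !mulmxA.
Qed.

Definition family_mx n (K : finType) (v : K -> 'cV[C]_n) : 'M[C]_(n, #|K|) :=
  \matrix_(i, k) v (enum_val k) i 0.

Lemma family_mx_isometry n (K : finType) (v : K -> 'cV[C]_n) :
  orthonormal_vectors v -> (family_mx v)^t* *m family_mx v = 1%:M.
Proof.
move=> von; apply/matrixP => k l; rewrite [RHS]mxE.
have := congr1 (fun M : 'M_1 => M 0 0) (von (enum_val k) (enum_val l)).
rewrite [RHS]mxE eqxx mulr1n (inj_eq enum_val_inj) => <-.
by rewrite !mxE; apply: eq_bigr => i _; rewrite !adjmxE !mxE.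
Qed.

Lemma family_mx_spectral n (K : finType) (v : K -> 'cV[C]_n) (w : K -> R) :
  family_mx v *m rdiag (fun k => w (enum_val k)) *m (family_mx v)^t* =
  \sum_k (w k)%:C *: projector (v k).
Proof.
apply/matrixP => i j; rewrite mxE summxE.
rewrite -(big_mkcond xpredT) (big_enum_val (fun k => ((w k)%:C *: projector (v k)) i j)) /=.
apply: eq_bigr => k _; rewrite mul_mx_rdiag adjmxE !mxE big_ord1 !mxE; ring.
Qed.

Lemma family_mx_proj n (K : finType) (v : K -> 'cV[C]_n) :
  family_mx v *m (family_mx v)^t* = \sum_k projector (v k).
Proof.
have := family_mx_spectral v (fun _ => 1); rewrite rdiag1 // mulmx1 => ->.
by apply: eq_bigr => k _; rewrite scale1r.
Qed.

Definition unfoldA a b N (X : 'M[C]_(a * b, N)) : 'M[C]_(a, b * N) :=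
  \matrix_(i, u) X (mxtens_index (i, (mxtens_unindex u).1)) (mxtens_unindex u).2.

Definition unfoldB a b N (X : 'M[C]_(a * b, N)) : 'M[C]_(b, a * N) :=
  \matrix_(j, u) X (mxtens_index ((mxtens_unindex u).1, j)) (mxtens_unindex u).2.

Lemma ptrace2_gram a b N (X : 'M[C]_(a * b, N)) :
  ptrace2 (X *m X^t*) = unfoldA X *m (unfoldA X)^t*.
Proof.
apply/matrixP => i i'; rewrite !mxE sum_mxtens; apply: eq_bigr => j _.
by rewrite mxE; apply: eq_bigr => k _; rewrite !adjmxE !mxE mxtens_indexK.
Qed.

Lemma ptrace1_gram a b N (X : 'M[C]_(a * b, N)) :
  ptrace1 (X *m X^t*) = unfoldB X *m (unfoldB X)^t*.
Proof.
apply/matrixP => i i'; rewrite !mxE sum_mxtens; apply: eq_bigr => j _.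
by rewrite mxE; apply: eq_bigr => k _; rewrite !adjmxE !mxE mxtens_indexK.
Qed.

Lemma tensmx_unfoldA a b N (Q : 'M[C]_a) (X : 'M[C]_(a * b, N)) :
  Q *m unfoldA X = unfoldA X -> tensmx Q 1%:M *m X = X.
Proof.
move=> QX; apply/matrixP => u k; case: (mxtens_indexP u) => i j.
have := congr1 (fun M : 'M_(a, b * N) => M i (mxtens_index (j, k))) QX.
rewrite [RHS]mxE mxtens_indexK /= => <-; rewrite !mxE sum_mxtens.
apply: eq_bigr => i' _; rewrite (bigD1 j) //= big1 ?addr0 => [|j' jj'].
  by rewrite tensmxE !mxE eqxx mulr1 mxtens_indexK.
by rewrite tensmxE !mxE eq_sym (negPf jj') mulr0 mul0r.
Qed.

Lemma tensmx_unfoldB a b N (Q : 'M[C]_b) (X : 'M[C]_(a * b, N)) :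
  Q *m unfoldB X = unfoldB X -> tensmx 1%:M Q *m X = X.
Proof.
move=> QX; apply/matrixP => u k; case: (mxtens_indexP u) => i j.
have := congr1 (fun M : 'M_(b, a * N) => M j (mxtens_index (i, k))) QX.
rewrite [RHS]mxE mxtens_indexK /= => <-; rewrite !mxE sum_mxtens exchange_big.
apply: eq_bigr => j' _; rewrite (bigD1 i) //= big1 ?addr0 => [|i' ii'].
  by rewrite tensmxE !mxE eqxx mul1r mxtens_indexK.
by rewrite tensmxE !mxE eq_sym (negPf ii') !mul0r.
Qed.

Theorem markov_gap0_mixture a b N (X : 'M[C]_(a * b, N)) :
  markov_gap (X *m X^t*) = 0 -> triangle_mixture (X *m X^t*).
Proof.
move=> gap0.
have [K [w [v [w0 von vE vX]]]] := gram_positive_decomposition (unfoldA X).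
have [L [r [u [r0 uon uE uX]]]] := gram_positive_decomposition (unfoldB X).
pose A := family_mx v; pose B := family_mx u.
have AA : A^t* *m A = 1%:M by apply: family_mx_isometry.
have BB : B^t* *m B = 1%:M by apply: family_mx_isometry.
(* [V *m V^t*] is the product of the support projections of the two marginals. It fixes [X], so
   compressing to the supports loses nothing. *)
pose V := tensmx A B; pose X' := V^t* *m X.
have VX : V *m X' = X.
  rewrite /X' mulmxA adj_tensmx tensmx_mul !family_mx_proj.
  rewrite -[\sum_k projector (v k)]mulmx1 -[\sum_k projector (u k)]mul1mx -tensmx_mul -mulmxA.
  by rewrite tensmx_unfoldB // tensmx_unfoldA.
have XE : X *m X^t* = V *m (X' *m X'^t*) *m V^t*.
  by rewrite -VX adjmxM !mulmxA.
have hX' : (X' *m X'^t*)^t* = X' *m X'^t* by rewrite adjmxM trmxCK.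
rewrite XE; apply: triangle_mixture_isometry => //.
apply: (@markov_gap0_mixture_diag _ _ _ _ _ (fun k => w (enum_val k)) (fun k => r (enum_val k))) => //.
- have : ptrace2 (X *m X^t*) = A *m rdiag (fun k => w (enum_val k)) *m A^t*.
    by rewrite ptrace2_gram vE family_mx_spectral.
  rewrite XE ptrace2_sandwich // => /(congr1 (fun M => A^t* *m M *m A)).
  by rewrite !mulmxA AA !mul1mx -!mulmxA AA !mulmx1.
- have : ptrace1 (X *m X^t*) = B *m rdiag (fun k => r (enum_val k)) *m B^t*.
    by rewrite ptrace1_gram uE family_mx_spectral.
  rewrite XE ptrace1_sandwich // => /(congr1 (fun M => B^t* *m M *m B)).
  by rewrite !mulmxA BB !mul1mx -!mulmxA BB !mulmx1.
- by rewrite -gap0 XE markov_gap_isometry.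
Qed.

End Reduction.

(** * Sums of triangle states *)

Section TriangleForms.
Variable R : realType.
Local Notation C := R[i].

(** Unlike in [fiber_normalized], the sum is 1 over every [j], so no fiber is empty. *)
Definition fiber_distribution (J X : finType) (jx : X -> J) (l : X -> R) :=
  (forall x, 0 < l x) /\ forall j, \sum_(x | jx x == j) l x = 1.

Definition edge_vector a b (J X Y Z : finType) (jx : X -> J) (l : X -> R)
    (al : Z -> X -> 'cV[C]_a) (be : Y -> X -> 'cV[C]_b) j y z : 'cV[C]_(a * b) :=
  \sum_(x | jx x == j) (Num.sqrt (l x))%:C *: tensv (al z x) (be y x).

Definition strong_mixture a b (rho : 'M[C]_(a * b)) :=
  exists (J X Y Z : finType) (jx : X -> J) (jy : Y -> J) (jz : Z -> J)
    (p : J -> R) (l : X -> R) (m : Y -> R) (n : Z -> R)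
    (al : Z -> X -> 'cV[C]_a) (be : Y -> X -> 'cV[C]_b),
  [/\ forall j, 0 < p j, fiber_distribution jx l, fiber_distribution jy m &
      fiber_distribution jz n] /\
  [/\ fiber_orthonormal jz jx al, fiber_orthonormal jy jx be &
      rho = \sum_j \sum_(y | jy y == j) \sum_(z | jz z == j)
        (p j * (m y * n z))%:C *: projector (edge_vector jx l al be j y z)].

(** [J] is restricted to the summands where all three edges are present with positive weight; the
    sum of [n] over a fiber then becomes [p j], and dividing by it leaves a distribution. *)
Lemma triangle_mixture_strong a b (rho : 'M[C]_(a * b)) :
  triangle_mixture rho -> strong_mixture rho.
Proof.
move=> [J [X [Y [Z [jx [jy [jz [l [m [n [al [be [[nl nm n0] [oa ob rhoE]]]]]]]]]]]]]].
pose GX j := [exists x, jx x == j]; pose GY j := [exists y, jy y == j].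
pose GZ j := [exists z, (jz z == j) && (0 < n z)].
pose G := [pred j | [&& GX j, GY j & GZ j]].
pose AX := [pred x | G (jx x)]; pose AY := [pred y | G (jy y)].
pose AZ := [pred z | G (jz z) && (0 < n z)].
have GAZ (z : {z in AZ}) : jz (val z) \in G by have /andP[] := valP z.
pose jx' (x : {x in AX}) : {j in G} := Sub (jx (val x)) (valP x).
pose jy' (y : {y in AY}) : {j in G} := Sub (jy (val y)) (valP y).
pose jz' (z : {z in AZ}) : {j in G} := Sub (jz (val z)) (GAZ z).
pose p (j : {j in G}) := \sum_(z | jz z == val j) n z.
have sum_sub (V : nmodType) (T : finType) (jt : T -> J) (F : T -> V) (j : {j in G}) :
    \sum_(x : {x in [pred x | G (jt x)]} | jt (val x) == val j) F (val x) =
    \sum_(x | jt x == val j) F x.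
  rewrite -(big_sub_cond [pred x | G (jt x)] (fun x => jt x == val j) F); apply: eq_bigl => x.
  by case: eqP => [E|]; rewrite ?andbF // andbT inE /= E; exact: (valP j).
have sumX (V : nmodType) (F : X -> V) (j : {j in G}) :
    \sum_(x : {x in AX} | jx' x == j) F (val x) = \sum_(x | jx x == val j) F x by exact: sum_sub.
have sumY (V : nmodType) (F : Y -> V) (j : {j in G}) :
    \sum_(y : {y in AY} | jy' y == j) F (val y) = \sum_(y | jy y == val j) F y by exact: sum_sub.
have sumZ (V : nmodType) (F : Z -> V) (j : {j in G}) : (forall z, n z = 0 -> F z = 0) ->
    \sum_(z : {z in AZ} | jz' z == j) F (val z) = \sum_(z | jz z == val j) F z.
  move=> F0; rewrite (eq_bigl (fun z : {z in AZ} => jz (val z) == val j)) //.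
  rewrite -(big_sub_cond AZ (fun x => jz x == val j) F).
  rewrite [RHS](bigID (fun z => 0 < n z)) /= [X in _ = _ + X]big1 ?addr0 => [|z].
    apply: eq_bigl => z; rewrite inE /=; case: eqP => [->|]; rewrite ?andbF // !andbT.
    by rewrite (_ : [&& _, _ & _] = true) //; exact: (valP j).
  by move=> /andP[_]; rewrite lt_def n0 andbT negbK => /eqP /F0.
have Gp (j : {j in G}) : 0 < p j.
  have /and3P[_ _ /existsP[z /andP[zj nz]]] := valP j.
  rewrite /p (bigD1 z) //= ltr_wpDr // sumr_ge0 // => ? _; exact: n0.
exists {j in G}, {x in AX}, {y in AY}, {z in AZ}, jx', jy', jz', p,
  (fun x => l (val x)), (fun y => m (val y)), (fun z => n (val z) / p (jz' z)),
  (fun z x => al (val z) (val x)), (fun y x => be (val y) (val x)).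
split; split=> //.
- split=> [x|j]; first exact: nl.1.
  rewrite sumX; have /and3P[/existsP[x /eqP <-] _ _] := valP j; exact: nl.2.
- split=> [y|j]; first exact: nm.1.
  rewrite sumY; have /and3P[_ /existsP[y /eqP <-] _] := valP j; exact: nm.2.
- split=> [z|j]; first by rewrite divr_gt0 //; have /andP[] := valP z.
  rewrite (eq_bigr (fun z : {z in AZ} => n (val z) / p j)) => [|z /eqP -> //].
  rewrite (sumZ _ (fun z => n z / p j)) => [|z ->]; last by rewrite mul0r.
  by rewrite -mulr_suml; apply: divff; rewrite gt_eqF //; exact: Gp.
- move=> z x z' x' /(congr1 val) zx /(congr1 val) zx'.
  by rewrite -(inj_eq val_inj z z') -(inj_eq val_inj x x'); apply: oa.
- move=> y x y' x' /(congr1 val) yx /(congr1 val) yx'.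
  by rewrite -(inj_eq val_inj y y') -(inj_eq val_inj x x'); apply: ob.
(* A discarded summand contributes nothing: either its [n z] vanish, or its fiber in [X] is empty
   and the edge vector is an empty sum. *)
rewrite rhoE (partition_big jy predT) //= (bigID (fun j => j \in G)) /=.
rewrite [X in _ + X]big1 ?addr0 => [|j jG]; last first.
  apply: big1 => y /eqP yj; apply: big1 => z /eqP zj.
  have [->|nz] := eqVneq (n z) 0; first by rewrite mulr0 scale0r.
  have nX : ~~ GX j.
    apply: contra jG => Xj; apply/and3P; split=> //; apply/existsP.
      by exists y; rewrite yj.
    by exists z; rewrite zj yj eqxx lt_def nz n0.
  rewrite [\sum_(x | _) _]big1 => [|x /eqP xy]; first by rewrite /projector mul0mx scaler0.
  by case/negP: nX; apply/existsP; exists x; rewrite xy yj.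
rewrite big_sub; apply: eq_bigr => j _.
rewrite -(sumY _ (fun y => \sum_(z | jz z == jy y) _)); apply: eq_bigr => y /eqP yj.
have -> : jy (val y) = val j by rewrite -yj.
rewrite -(sumZ _ (fun z => _)) => [|z ->]; last by rewrite mulr0 scale0r.
apply: eq_bigr => z /eqP zj; rewrite zj; congr (_%:C *: _).
  by field; rewrite gt_eqF.
rewrite /edge_vector; congr projector.
by rewrite -(sumX _ (fun x => (Num.sqrt (l x))%:C *: tensv (al (val z) x) (be (val y) x))).
Qed.

Definition strong_triangle a b c (psi : 'cV[C]_(a * b * c)) :=
  exists (J X Y Z : finType) (jx : X -> J) (jy : Y -> J) (jz : Z -> J)
    (p : J -> R) (l : X -> R) (m : Y -> R) (n : Z -> R)
    (al : Z -> X -> 'cV[C]_a) (be : Y -> X -> 'cV[C]_b) (ga : Y -> Z -> 'cV[C]_c),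
  [/\ forall j, 0 < p j, fiber_distribution jx l, fiber_distribution jy m,
      fiber_distribution jz n & \sum_j p j = 1] /\
  [/\ fiber_orthonormal jz jx al, fiber_orthonormal jy jx be, fiber_orthonormal jy jz ga &
      psi = \sum_j \sum_(y | jy y == j) \sum_(z | jz z == j)
        (Num.sqrt (p j * (m y * n z)))%:C *: tensv (edge_vector jx l al be j y z) (ga y z)].

Lemma dot_tensv m n (u u' : 'cV[C]_m) (v v' : 'cV[C]_n) s t :
  u^t* *m u' = s%:M -> v^t* *m v' = t%:M -> (tensv u v)^t* *m tensv u' v' = (s * t)%:M.
Proof.
move=> /matrixP/(_ 0 0); rewrite !mxE eqxx mulr1n => <-.
move=> /matrixP/(_ 0 0); rewrite !mxE eqxx mulr1n => <-.
apply/matrixP => i j; rewrite !ord1 !mxE eqxx mulr1n sum_mxtens mulr_suml.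
apply: eq_bigr => k _; rewrite mulr_sumr; apply: eq_bigr => k' _.
by rewrite !adjmxE !tensvE rmorphM /=; ring.
Qed.

Section EdgeVectors.
Variables (a b : nat) (J X Y Z : finType) (jx : X -> J) (jy : Y -> J) (jz : Z -> J).
Variables (l : X -> R) (al : Z -> X -> 'cV[C]_a) (be : Y -> X -> 'cV[C]_b).
Hypotheses (fl : fiber_distribution jx l).
Hypotheses (oa : fiber_orthonormal jz jx al) (ob : fiber_orthonormal jy jx be).

Lemma edge_vector_dot j j' y y' z z' : jy y = j -> jz z = j -> jy y' = j' -> jz z' = j' ->
  (edge_vector jx l al be j y z)^t* *m edge_vector jx l al be j' y' z' =
  ((y == y') && (z == z'))%:R%:M.
Proof.
move=> yj zj yj' zj'; rewrite adjmx_sum mulmx_suml.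
transitivity (\sum_(x | jx x == j) \sum_(x' | jx x' == j')
   ((Num.sqrt (l x) * Num.sqrt (l x'))%:C *
    (((z == z') && (x == x'))%:R * ((y == y') && (x == x'))%:R))%:M : 'M[C]_1).
  apply: eq_bigr => x /eqP xj; rewrite mulmx_sumr; apply: eq_bigr => x' /eqP xj'.
  rewrite adjmxZ conjC_real -scalemxAl -scalemxAr scalerA -rmorphM.
  rewrite (dot_tensv (oa _ _) (ob _ _)) ?xj ?xj' //.
  by rewrite scale_scalar_mx.
have s0 : (0 : C)%:M = 0 :> 'M[C]_1 by apply: raddf0.
have [yy|yy] := eqVneq y y'; last first.
  by rewrite /= mulr0n s0 big1 // => x _; rewrite big1 // => x' _; rewrite !(mulr0n, mulr0, mul0r) s0.
have [zz|zz] := eqVneq z z'; last first.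
  by rewrite /= mulr0n s0 big1 // => x _; rewrite big1 // => x' _; rewrite !(mulr0n, mulr0, mul0r) s0.
have jj : j = j' by rewrite -yj -yj' yy.
rewrite -jj (eq_bigr (fun x => (l x)%:C%:M)) => [|x xj].
  rewrite -raddf_sum -rmorph_sum /=.
  by have [_ ->] := fl.
rewrite (bigD1 x) //= big1 ?addr0 => [|x' /andP[_ xx']].
  by rewrite eqxx !mulr1 -expr2 sqr_sqrtr // ltW //; apply: fl.1.
by rewrite eq_sym (negPf xx') /= !(mulr0n, mulr0, mul0r) s0.
Qed.

End EdgeVectors.

Lemma sum_fibers (V : nmodType) (J Y Z : finType) (jy : Y -> J) (jz : Z -> J)
    (F : J -> Y -> Z -> V) :
  \sum_j \sum_(y | jy y == j) \sum_(z | jz z == j) F j y z =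
  \sum_(q : Y * Z | jz q.2 == jy q.1) F (jy q.1) q.1 q.2.
Proof.
rewrite -(pair_big_dep xpredT (fun y z => jz z == jy y) (fun y z => F (jy y) y z)) /=.
rewrite [RHS](partition_big jy predT) //=; apply: eq_bigr => j _.
by apply: eq_bigr => y /eqP ->.
Qed.

(** The edge vectors of linked pairs are orthonormal eigenvectors of rho_AB with positive weights.
    The components of psi along them, divided by the roots of the weights, are orthonormal in C and
    indexed by the same pairs [(y, z)], which gives the product structure of C. *)
Lemma strong_triangle_of_mixture a b c (psi : 'cV[C]_(a * b * c)) :
  unit_vector psi -> strong_mixture (ptrace2 (projector psi) : 'M_(a * b)) ->
  strong_triangle psi.
Proof.
move=> upsi; rewrite ptrace2_projector; set Psi := unfold_vec psi.
move=> [J [X [Y [Z [jx [jy [jz [p [l [m [n [al [be [[p0 fl fm fn] [oa ob rhoE]]]]]]]]]]]]]]].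
rewrite sum_fibers in rhoE.
pose P (q : Y * Z) := jz q.2 == jy q.1.
pose w (q : Y * Z) := p (jy q.1) * (m q.1 * n q.2).
pose v (q : Y * Z) := edge_vector jx l al be (jy q.1) q.1 q.2.
have w0 q : 0 < w q by rewrite !mulr_gt0 //; [apply: fm.1 | apply: fn.1].
have von q q' : P q -> P q' -> (v q)^t* *m v q' = (q == q')%:R%:M.
  by move=> /eqP qP /eqP qP'; rewrite (edge_vector_dot fl oa ob).
have rhov q : P q -> Psi *m Psi^t* *m v q = (w q)%:C *: v q.
  by move=> Pq; rewrite rhoE (projector_sum_mul w von Pq).
pose Q := \sum_(q | P q) projector (v q).
have QPsi : Q *m Psi = Psi.
  have Qv q : P q -> Q *m v q = v q.
    move=> Pq; rewrite /Q (eq_bigr (fun q => (1 : R)%:C *: projector (v q))).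
      by rewrite (projector_sum_mul (fun _ => 1) von Pq) scale1r.
    by move=> q' _; rewrite scale1r.
  have Qrho : Q *m (Psi *m Psi^t*) = Psi *m Psi^t*.
    rewrite rhoE mulmx_sumr; apply: eq_bigr => q Pq.
    by rewrite -scalemxAr /projector mulmxA Qv.
  apply/eqP; rewrite eq_sym -subr_eq0 -{1}[Psi]mul1mx -mulmxBl; apply/eqP/mul_adj_eq0.
  rewrite adjmxM mulmxA -(mulmxA (1%:M - Q)) mulmxBl mul1mx Qrho subrr mul0mx //.
pose ga y z := ((Num.sqrt (w (y, z)))%:C^-1 *: ((v (y, z))^t* *m Psi))^T.
exists J, X, Y, Z, jx, jy, jz, p, l, m, n, al, be, ga; split; split=> //.
- have : \tr (Psi *m Psi^t*) = (\sum_j p j)%:C.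
    rewrite rhoE raddf_sum /=.
    rewrite (eq_bigr (fun q => (w q)%:C)) => [|q Pq]; last first.
      rewrite mxtraceZ /projector mxtrace_mulC -/(v q) von // eqxx mxtrace1.
      by rewrite mulr1.
    rewrite -rmorph_sum; congr (_%:C).
    transitivity (\sum_j \sum_(y | jy y == j) \sum_(z | jz z == j) p j * (m y * n z)).
      by rewrite sum_fibers.
    apply: eq_bigr => j _.
    rewrite (eq_bigr (fun y => p j * m y)) => [|y _].
      by rewrite -mulr_sumr fm.2 mulr1.
    by rewrite -mulr_sumr -mulr_sumr fn.2 mulr1.
  have -> : \tr (Psi *m Psi^t*) = 1.
    rewrite mxtrace_mul_adj -upsi [RHS]sum_mxtens rmorph_sum; apply: eq_bigr => u _ /=.
    rewrite rmorph_sum; apply: eq_bigr => k _ /=.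
    by rewrite normsqE normCK mulrC /Psi mxE.
  by move=> E; apply: (@complexI R); rewrite -E.
- move=> y z y' z' yz yz'.
  have Pq : P (y, z) by rewrite /P /= yz.
  have Pq' : P (y', z') by rewrite /P /= yz'.
  rewrite /ga trmx_adj_mul adjmxZ -scalemxAl -scalemxAr adjmxM trmxCK mulmxA.
  rewrite -(mulmxA ((v (y', z'))^t*)) -mulmxA rhov // -scalemxAr von // eq_sym xpair_eqE.
  rewrite fmorphV /= conjC_real.
  case: andP => [[/eqP -> /eqP ->]|_]; last by rewrite (_ : (false%:R)%:M = 0) ?scaler0 ?trmx0 //;
    apply: raddf0.
  have wC : (Num.sqrt (w (y', z')))%:C != 0 by rewrite fmorph_eq0 gt_eqF // sqrtr_gt0.
  have -> : (w (y', z'))%:C = (Num.sqrt (w (y', z')))%:C * (Num.sqrt (w (y', z')))%:C.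
    by rewrite -rmorphM -expr2 sqr_sqrtr // ltW.
  by rewrite !scalerA (_ : _ * _ = 1) ?scale1r ?tr_scalar_mx //; field.
rewrite sum_fibers; apply/matrixP => u o; rewrite ord1 {o}; case: (mxtens_indexP u) => i k.
transitivity (Psi i k); first by rewrite mxE.
rewrite -{1}QPsi mulmx_suml !summxE; apply: eq_bigr => q Pq.
rewrite [RHS]mxE tensvE -/(v q) /ga -!surjective_pairing /projector -mulmxA [LHS]mxE big_ord1.
rewrite [X in _ = _ * (_ * X)]mxE [X in _ = _ * (_ * X)]mxE.
have wC : (Num.sqrt (w q))%:C != 0 by rewrite fmorph_eq0 gt_eqF // sqrtr_gt0.
case: q Pq wC => y z /= Pq wC.
rewrite -/(w (y, z)); set G := (_ *m Psi) _ _; set V := v _ _ _; set W := _%:C.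
by rewrite -/W -/G [RHS]mulrCA mulrA -mulrA; field.
Qed.

End TriangleForms.

(** * From basis vectors to embedded tensor factors *)

Section Embeddings.
Variable R : realType.
Local Notation C := R[i].

Lemma tensvZl m n (s : C) (u : 'cV[C]_m) (v : 'cV[C]_n) : tensv (s *: u) v = s *: tensv u v.
Proof.
apply/matrixP => k o; rewrite ord1 {o}; case: (mxtens_indexP k) => i j.
by rewrite [RHS]mxE !tensvE mxE mulrA.
Qed.

Lemma tensv_suml m n (I : finType) (P : pred I) (u : I -> 'cV[C]_m) (v : 'cV[C]_n) :
  tensv (\sum_(i | P i) u i) v = \sum_(i | P i) tensv (u i) v.
Proof.
apply/matrixP => k o; rewrite ord1 {o}; case: (mxtens_indexP k) => i j.
rewrite tensvE !summxE mulr_suml; apply: eq_bigr => x _; by rewrite tensvE.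
Qed.

(** H^0 is the range of the complementary projection. Its positive eigenvalues are all 1, so its
    eigenvectors assemble into an isometry. *)
Lemma isometry_complement n (J : finType) (d : J -> nat) (E : forall j, 'M[C]_(n, d j)) :
  (forall j, (E j)^t* *m E j = 1%:M) -> (forall j k, j != k -> (E j)^t* *m E k = 0) ->
  exists d0 (E0 : 'M[C]_(n, d0)),
  [/\ E0^t* *m E0 = 1%:M, forall j, E0^t* *m E j = 0 &
      E0 *m E0^t* + \sum_j E j *m (E j)^t* = 1%:M].
Proof.
move=> EE EF; pose Q := \sum_j E j *m (E j)^t*; pose P := 1%:M - Q.
have QE k : Q *m E k = E k.
  rewrite mulmx_suml (bigD1 k) //= -mulmxA EE mulmx1 big1 ?addr0 // => j jk.
  by rewrite -mulmxA EF // mulmx0.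
have adjQ : Q^t* = Q.
  by rewrite adjmx_sum; apply: eq_bigr => j _; rewrite adjmxM trmxCK.
have QQ : Q *m Q = Q by rewrite {2}/Q mulmx_sumr; apply: eq_bigr => j _; rewrite mulmxA QE.
have PE k : P *m E k = 0 by rewrite mulmxBl mul1mx QE subrr.
have adjP : P^t* = P by rewrite adjmxB adjmx1 adjQ.
have PP : P *m P = P by rewrite {1}/P mulmxBl mul1mx {2}/P mulmxBr mulmx1 QQ subrr subr0.
have [K [w [v [w0 von]]]] := gram_positive_decomposition P.
rewrite adjP PP => PE' _.
have von' k l : xpredT k -> xpredT l -> (v k)^t* *m v l = (k == l)%:R%:M by [].
have w1 k : w k = 1.
  have Pv : P *m v k = (w k)%:C *: v k by rewrite PE' (projector_sum_mul w von').
  have : (v k)^t* *m (P *m P *m v k) = (v k)^t* *m (P *m v k) by rewrite PP.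
  rewrite -!mulmxA Pv -scalemxAr Pv -!scalemxAr von eqxx => /matrixP/(_ 0 0).
  rewrite !mxE eqxx !mulr1n mulr1 -rmorphM => /(@complexI R) /eqP.
  rewrite -subr_eq0 -{3}[w k]mulr1 -mulrBr mulf_eq0 subr_eq0 gt_eqF //=.
  by move/eqP.
have E0P : family_mx v *m (family_mx v)^t* = P.
  by rewrite family_mx_proj [RHS]PE'; apply: eq_bigr => k _; rewrite w1 scale1r.
have E01 : (family_mx v)^t* *m family_mx v = 1%:M by apply: family_mx_isometry.
exists #|K|, (family_mx v); split=> // [j|]; last by rewrite E0P subrK.
by rewrite -[X in X *m _]mul1mx -E01 -mulmxA -mulmxA (mulmxA (family_mx v)) E0P PE mulmx0.
Qed.

Lemma fiber_orthonormal_sym n (J X Z : finType) (jz : Z -> J) (jx : X -> J)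
    (al : Z -> X -> 'cV[C]_n) :
  fiber_orthonormal jz jx al -> fiber_orthonormal jx jz (fun x z => al z x).
Proof. by move=> oa x z x' z' xz xz'; rewrite oa // andbC. Qed.

Section FiberMatrix.
Variables (n : nat) (J U V : finType) (ju : U -> J) (jv : V -> J) (al : U -> V -> 'cV[C]_n).

Definition fiber_mx j :
    'M[C]_(n, #|[pred u | ju u == j]| * #|[pred v | jv v == j]|) :=
  \matrix_(i, k) al (enum_val (mxtens_unindex k).1) (enum_val (mxtens_unindex k).2) i 0.

Lemma fiber_mx_delta j k l :
  fiber_mx j *m tensv (delta_mx k 0) (delta_mx l 0) = al (enum_val k) (enum_val l).
Proof.
apply/matrixP => i o; rewrite ord1 {o} mxE sum_mxtens (bigD1 k) //= [X in _ + X]big1 => [|k' kk].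
  rewrite (bigD1 l) //= big1 => [|l' ll]; first by rewrite tensvE !mxE mxtens_indexK !eqxx !mulr1 !addr0.
  by rewrite tensvE [in X in _ * (_ * X)]mxE (negPf ll) !mulr0.
by rewrite big1 // => l' _; rewrite tensvE [in X in _ * (X * _)]mxE (negPf kk) mul0r mulr0.
Qed.

Hypothesis oa : fiber_orthonormal ju jv al.

Lemma fiber_mxM j j' k k' l l' :
  ((fiber_mx j)^t* *m fiber_mx j') (mxtens_index (k, l)) (mxtens_index (k', l')) =
  ((enum_val k == enum_val k') && (enum_val l == enum_val l'))%:R.
Proof.
have /eqP uk := enum_valP k; have /eqP vl := enum_valP l.
have /eqP uk' := enum_valP k'; have /eqP vl' := enum_valP l'.
transitivity (((al (enum_val k) (enum_val l))^t* *m al (enum_val k') (enum_val l')) 0 0).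
  by rewrite !mxE; apply: eq_bigr => i _; rewrite !adjmxE !mxE !mxtens_indexK.
by rewrite oa ?uk ?uk' // mxE eqxx mulr1n.
Qed.

Lemma fiber_mx_isometry j : (fiber_mx j)^t* *m fiber_mx j = 1%:M.
Proof.
apply/matrixP => u u'; case: (mxtens_indexP u) => k l; case: (mxtens_indexP u') => k' l'.
by rewrite fiber_mxM !(inj_eq enum_val_inj) mxE mxtens_index_eq.
Qed.

Lemma fiber_mx_orthogonal j j' : j != j' -> (fiber_mx j)^t* *m fiber_mx j' = 0.
Proof.
move=> jj; apply/matrixP => u u'; case: (mxtens_indexP u) => k l; case: (mxtens_indexP u') => k' l'.
rewrite fiber_mxM mxE; case: eqP => // E; case/eqP: jj.
by have /eqP <- := enum_valP k; have /eqP <- := enum_valP k'; rewrite E.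
Qed.

End FiberMatrix.

Lemma unit_vectorE n (v : 'cV[C]_n) : unit_vector v <-> v^t* *m v = 1%:M.
Proof.
have E : (v^t* *m v) 0 0 = \sum_i `|v i 0| ^+ 2.
  by rewrite mxE; apply: eq_bigr => i _; rewrite adjmxE normCK mulrC.
split=> [uv|vv]; last by rewrite /unit_vector -E vv mxE eqxx.
by apply/matrixP => i j; rewrite !ord1 E uv mxE eqxx.
Qed.

Lemma dot_sum_tensv m n (K : finType) (s : K -> R) (u : K -> 'cV[C]_m) (v : K -> 'cV[C]_n) :
  orthonormal_vectors u -> orthonormal_vectors v ->
  let a := \sum_k (s k)%:C *: tensv (u k) (v k) in a^t* *m a = (\sum_k s k ^+ 2)%:C%:M.
Proof.
move=> uon von a; rewrite adjmx_sum mulmx_suml rmorph_sum raddf_sum.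
apply: eq_bigr => k _; rewrite mulmx_sumr (bigD1 k) //= big1 ?addr0 => [|l lk].
  rewrite adjmxZ conjC_real -scalemxAl -scalemxAr scalerA (dot_tensv (uon _ _) (von _ _)).
  by rewrite eqxx mulr1 scale_scalar_mx mulr1 -rmorphM.
rewrite adjmxZ -scalemxAl -scalemxAr (dot_tensv (uon _ _) (von _ _)) eq_sym (negPf lk) mul0r.
by rewrite (_ : 0%:M = 0) ?scaler0 //; apply: raddf0.
Qed.

Lemma triangle_vector_sum lA rA lB rB lC rC (X Y Z : finType) (s : X -> C) (t : Y -> C) (r : Z -> C)
    (u1 : X -> 'cV[C]_rA) (u2 : X -> 'cV[C]_lB) (v1 : Y -> 'cV[C]_rB) (v2 : Y -> 'cV[C]_lC)
    (w1 : Z -> 'cV[C]_rC) (w2 : Z -> 'cV[C]_lA) :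
  triangle_vector (\sum_x s x *: tensv (u1 x) (u2 x)) (\sum_y t y *: tensv (v1 y) (v2 y))
    (\sum_z r z *: tensv (w1 z) (w2 z)) =
  \sum_y \sum_z \sum_x (s x * t y * r z) *:
    tensv (tensv (tensv (w2 z) (u1 x)) (tensv (u2 x) (v1 y))) (tensv (v2 y) (w1 z)).
Proof.
apply/matrixP => q o; rewrite ord1 {o}.
case: (mxtens_indexP q) => h h''; case: (mxtens_indexP h) => k k'.
case: (mxtens_indexP k) => al ar; case: (mxtens_indexP k') => bl br.
case: (mxtens_indexP h'') => cl cr.
rewrite mxE !mxtens_indexK.
set F := (X in X * _ * _ = _); set G := (X in _ * X * _ = _); set H := (X in _ * X = _).
rewrite /G summxE mulr_sumr mulr_suml summxE; apply: eq_bigr => y _.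
rewrite /H summxE mulr_sumr summxE; apply: eq_bigr => z _.
rewrite /F summxE !mulr_suml summxE; apply: eq_bigr => x _.
by rewrite [X in X * _ * _ = _]mxE [X in _ * X * _ = _]mxE [X in _ * X = _]mxE [RHS]mxE !tensvE; ring.
Qed.

Lemma orthonormal_delta n (I : finType) (f : I -> 'I_n) : injective f ->
  orthonormal_vectors (fun i => delta_mx (f i) 0 : 'cV[C]_n).
Proof.
move=> fI k l; apply/matrixP => i j; rewrite !ord1 [RHS]mxE eqxx mulr1n mxE.
rewrite (bigD1 (f k)) //= big1 => [|i' ki]; rewrite adjmxE !mxE.
  by rewrite !eqxx rmorph1 mul1r addr0 andbT (inj_eq fI).
by rewrite (negPf ki) rmorph0 mul0r.
Qed.

Lemma sum_of_triangle_states_strong a b c (psi : 'cV[C]_(a * b * c)) :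
  strong_triangle psi -> sum_of_triangle_states psi.
Proof.
move=> [J [X [Y [Z [jx [jy [jz [p [l [m [n [al [be [ga]]]]]]]]]]]]]].
move=> [[p0 fl fm fn p1] [oa ob oc psiE]].
(* The left factor of B belongs to the edge AB, indexed by [X], so the arguments of [be] are
   exchanged. *)
pose ob' := fiber_orthonormal_sym ob.
have [dA [A0 [A1 A2 A3]]] := isometry_complement (fiber_mx_isometry oa) (fiber_mx_orthogonal oa).
have [dB [B0 [B1 B2 B3]]] := isometry_complement (fiber_mx_isometry ob') (fiber_mx_orthogonal ob').
have [dC [C0 [C1 C2 C3]]] := isometry_complement (fiber_mx_isometry oc) (fiber_mx_orthogonal oc).
pose DA := BipartiteDecomposition A1 (fiber_mx_isometry oa) A2 (fiber_mx_orthogonal oa) A3.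
pose DB := BipartiteDecomposition B1 (fiber_mx_isometry ob') B2 (fiber_mx_orthogonal ob') B3.
pose DC := BipartiteDecomposition C1 (fiber_mx_isometry oc) C2 (fiber_mx_orthogonal oc) C3.
pose e (V : finType) (jv : V -> J) j (k : 'I_#|[pred v | jv v == j]|) :=
  delta_mx k 0 : 'cV[C]_#|[pred v | jv v == j]|.
(* An edge vector pairs the coordinate bases of its two ends diagonally; the embeddings carry all
   other data. *)
pose diag (V : finType) (jv : V -> J) (s : V -> R) j :=
  \sum_(k < #|[pred v | jv v == j]|) (Num.sqrt (s (enum_val k)))%:C *: tensv (e V jv j k) (e V jv j k).
have sumV (M : nmodType) (V : finType) (jv : V -> J) (F : V -> M) j :
    \sum_(k < #|[pred v | jv v == j]|) F (enum_val k) = \sum_(v | jv v == j) F v.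
  by rewrite -big_enum_val.
have udiag (V : finType) (jv : V -> J) (s : V -> R) j :
    fiber_distribution jv s -> unit_vector (diag V jv s j).
  move=> [s0 s1]; apply/unit_vectorE.
  rewrite dot_sum_tensv; try exact: (orthonormal_delta (f := id)).
  rewrite (eq_bigr (fun k => s (enum_val k))) => [|k _]; last by rewrite sqr_sqrtr // ltW.
  by rewrite (sumV _ V jv s) s1.
exists J, DA, DB, DC, p, (diag X jx l), (diag Y jy m), (diag Z jz n).
split=> // [j|j|]; [exact: ltW | by split; apply: udiag |].
rewrite psiE; apply: eq_bigr => j _.
rewrite /diag triangle_vector_sum mulmx_sumr -sumV scaler_sumr; apply: eq_bigr => y _.
rewrite mulmx_sumr -sumV scaler_sumr; apply: eq_bigr => z _.
rewrite mulmx_sumr /edge_vector -sumV tensv_suml !scaler_sumr; apply: eq_bigr => x _.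
rewrite -scalemxAr tensvZl !tensv_mul /= !fiber_mx_delta !scalerA; congr (_ *: _).
rewrite -!rmorphM !sqrtrM ?ltW ?p0 ?fm.1 ?mulr_gt0 ?p0 ?fm.1 ?fn.1 //; congr _%:C; ring.
Qed.

End Embeddings.

(** * From embedded tensor factors back to basis vectors *)

Section Schmidt.
Variable R : realType.
Local Notation C := R[i].

Record schmidt_decomposition m n (v : 'cV[C]_(m * n)) := SchmidtDecomposition {
  sindex : finType;
  sweight : sindex -> R;
  sleft : sindex -> 'cV[C]_m;
  sright : sindex -> 'cV[C]_n;
  sweight_gt0 : forall k, 0 < sweight k;
  sleft_orthonormal : orthonormal_vectors sleft;
  sright_orthonormal : orthonormal_vectors sright;
  schmidtE : v = \sum_k (sweight k)%:C *: tensv (sleft k) (sright k)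
}.

Arguments sweight {m n v} s k.
Arguments sleft {m n v} s k.
Arguments sright {m n v} s k.
Arguments sleft_orthonormal {m n v} s.
Arguments sright_orthonormal {m n v} s.

Lemma schmidt_exists m n (v : 'cV[C]_(m * n)) : inhabited (schmidt_decomposition v).
Proof.
have [K [s [x [y [s0 xon yon E]]]]] := svd (unfold_vec v).
apply: inhabits; apply: (SchmidtDecomposition s0 xon yon).
apply/matrixP => u o; rewrite ord1 {o}; case: (mxtens_indexP u) => i j.
transitivity (unfold_vec v i j); first by rewrite mxE.
rewrite E !summxE; apply: eq_bigr => k _.
by rewrite [LHS]mxE [RHS]mxE tensvE mxE big_ord1 mxE.
Qed.

(** The index type of the decomposition depends on the vector, so a choice for every [j] leads to
    index sets of the form [{j & K j}]. *)
Definition schmidt m n (v : 'cV[C]_(m * n)) : schmidt_decomposition v.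
Proof. by have /cid[] : exists _ : schmidt_decomposition v, True by case: (schmidt_exists v) => D;
  exists D. Qed.

Lemma sum_sweight m n (v : 'cV[C]_(m * n)) :
  unit_vector v -> \sum_k sweight (schmidt v) k ^+ 2 = 1.
Proof.
move=> /unit_vectorE; rewrite {1 2}(schmidtE (schmidt v)).
rewrite (dot_sum_tensv _ (sleft_orthonormal _) (sright_orthonormal _)).
by move=> /matrixP/(_ 0 0); rewrite !mxE eqxx !mulr1n => E; apply: (@complexI R); rewrite E.
Qed.

Lemma sum_tag (V : nmodType) (J : finType) (K : J -> finType) (F : {j & K j} -> V) j :
  \sum_(x | tag x == j) F x = \sum_(k : K j) F (Tagged K k).
Proof.
have := sig_big_dep (op := +%R) (pred1 j) (fun=> xpredT) (fun i (k : K i) => F (Tagged K k)).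
rewrite big_pred1_eq => /= ->.
by apply: eq_big => [x|[]] //=; rewrite andbT.
Qed.

Section FiberTensor.
Variables (n : nat) (J : finType) (dL dR : J -> nat) (E : forall j, 'M[C]_(n, dL j * dR j)).
Variables (K L : J -> finType).
Variables (f : forall j, K j -> 'cV[C]_(dL j)) (g : forall j, L j -> 'cV[C]_(dR j)).

(* [conform_mx 0] is the identity when [tag z = tag x], and junk otherwise. *)
Definition fiber_tensor (z : {j & K j}) (x : {j & L j}) : 'cV[C]_n :=
  E (tag x) *m tensv (conform_mx 0 (f (tagged z))) (g (tagged x)).

Lemma fiber_tensorE j (k : K j) (l : L j) :
  fiber_tensor (Tagged K k) (Tagged L l) = E j *m tensv (f k) (g l).
Proof. by rewrite /fiber_tensor conform_mx_id. Qed.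

Lemma fiber_tensor_orthonormal :
  (forall j, (E j)^t* *m E j = 1%:M) -> (forall j k, j != k -> (E j)^t* *m E k = 0) ->
  (forall j, orthonormal_vectors (@f j)) -> (forall j, orthonormal_vectors (@g j)) ->
  fiber_orthonormal (@tag J K) (@tag J L) fiber_tensor.
Proof.
move=> EE EF fon gon [j k] [j1 l] [j' k'] [j1' l'] /= jj jj'.
case: j1 / jj l => l; case: j1' / jj' l' => l'.
rewrite !fiber_tensorE adjmxM -mulmxA (mulmxA ((E j)^t*)).
have [jj|jj] := eqVneq j j'; last first.
  rewrite EF // mul0mx mulmx0 -!tag_eqE /tag_eq /= (negPf jj) /=.
  by apply/esym; apply: raddf0.
case: j' / jj k' l' => k' l'.
by rewrite EE mul1mx (dot_tensv (fon _ _ _) (gon _ _ _)) !eq_Tagged /= -natrM mulnb.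
Qed.

End FiberTensor.

Lemma strong_of_triangles a b c (psi : 'cV[C]_(a * b * c)) (J : finType)
    (lA rA lB rB lC rC : J -> nat)
    (EA : forall j, 'M[C]_(a, lA j * rA j)) (EB : forall j, 'M[C]_(b, lB j * rB j))
    (EC : forall j, 'M[C]_(c, lC j * rC j)) (p : J -> R)
    (u : forall j, 'cV[C]_(rA j * lB j)) (v : forall j, 'cV[C]_(rB j * lC j))
    (w : forall j, 'cV[C]_(rC j * lA j)) :
  (forall j, (EA j)^t* *m EA j = 1%:M) -> (forall j k, j != k -> (EA j)^t* *m EA k = 0) ->
  (forall j, (EB j)^t* *m EB j = 1%:M) -> (forall j k, j != k -> (EB j)^t* *m EB k = 0) ->
  (forall j, (EC j)^t* *m EC j = 1%:M) -> (forall j k, j != k -> (EC j)^t* *m EC k = 0) ->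
  (forall j, 0 < p j) -> \sum_j p j = 1 ->
  (forall j, [/\ unit_vector (u j), unit_vector (v j) & unit_vector (w j)]) ->
  psi = \sum_j (Num.sqrt (p j))%:C *:
    (tensmx (tensmx (EA j) (EB j)) (EC j) *m triangle_vector (u j) (v j) (w j)) ->
  strong_triangle psi.
Proof.
move=> A1 A2 B1 B2 C1 C2 p0 p1 unit_uvw psiE.
pose K j := sindex (schmidt (u j)); pose L j := sindex (schmidt (v j)).
pose M j := sindex (schmidt (w j)).
pose al := fiber_tensor EA (fun j => sright (schmidt (w j))) (fun j => sleft (schmidt (u j))).
pose be := fiber_tensor EB (fun j => sright (schmidt (u j))) (fun j => sleft (schmidt (v j))).
pose ga := fiber_tensor EC (fun j => sright (schmidt (v j))) (fun j => sleft (schmidt (w j))).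
exists J, {j & K j}, {j & L j}, {j & M j}, (@tag _ _), (@tag _ _), (@tag _ _), p.
exists (fun x : {j & K j} => sweight (schmidt (u (tag x))) (tagged x) ^+ 2),
  (fun y : {j & L j} => sweight (schmidt (v (tag y))) (tagged y) ^+ 2).
exists (fun z : {j & M j} => sweight (schmidt (w (tag z))) (tagged z) ^+ 2), al, (fun y x => be x y), ga.
split; split=> //; try by (split=> [x|j];
  [rewrite exprn_gt0 // sweight_gt0 | rewrite sum_tag /= sum_sweight //; case: (unit_uvw j)]).
- by apply: fiber_tensor_orthonormal => // j; [exact: sright_orthonormal | exact: sleft_orthonormal].
- apply: fiber_orthonormal_sym.
  by apply: fiber_tensor_orthonormal => // j; [exact: sright_orthonormal | exact: sleft_orthonormal].
- by apply: fiber_tensor_orthonormal => // j; [exact: sright_orthonormal | exact: sleft_orthonormal].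
rewrite psiE; apply: eq_bigr => j _.
rewrite {1}(schmidtE (schmidt (u j))) {1}(schmidtE (schmidt (v j))) {1}(schmidtE (schmidt (w j))).
rewrite triangle_vector_sum mulmx_sumr sum_tag scaler_sumr; apply: eq_bigr => y _.
rewrite mulmx_sumr sum_tag scaler_sumr; apply: eq_bigr => z _.
rewrite mulmx_sumr /edge_vector sum_tag tensv_suml !scaler_sumr; apply: eq_bigr => x _ /=.
rewrite /al /be /ga -scalemxAr tensvZl !tensv_mul !fiber_tensorE !scalerA; congr (_ *: _).
rewrite -!rmorphM -!exprMn sqrtrM ?ltW // !sqrtr_sqr !gtr0_norm ?mulr_gt0 ?sweight_gt0 //.
congr _%:C; ring.
Qed.

Lemma strong_of_sum_of_triangle_states a b c (psi : 'cV[C]_(a * b * c)) :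
  sum_of_triangle_states psi -> strong_triangle psi.
Proof.
move=> [J [DA [DB [DC [p [u [v [w [p0 p1 uvw psiE]]]]]]]]].
(* The basis form requires positive probabilities; summands with [p j = 0] vanish from psi. *)
pose G := [pred j | 0 < p j].
have pG j : j \notin G -> p j = 0 by rewrite inE lt_def p0 andbT negbK => /eqP.
apply: (@strong_of_triangles _ _ _ _ {j in G} _ _ _ _ _ _ (fun j => emb DA (val j))
  (fun j => emb DB (val j)) (fun j => emb DC (val j)) (fun j => p (val j))
  (fun j => u (val j)) (fun j => v (val j)) (fun j => w (val j))) => //; try by move=> *;
    first [exact: emb_isometry | exact: emb_orthogonal].
- by move=> j; exact: (valP j).
- rewrite -(big_sub G p) -p1 [RHS](bigID (fun j => j \in G)) /= [X in _ = _ + X]big1 ?addr0 //.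
rewrite -(big_sub G (fun j => (Num.sqrt (p j))%:C *:
  (tensmx (tensmx (emb DA j) (emb DB j)) (emb DC j) *m triangle_vector (u j) (v j) (w j)))).
rewrite psiE [LHS](bigID (fun j => j \in G)) /= [X in _ + X]big1 ?addr0 // => j jG.
by rewrite pG // sqrtr0 scale0r.
Qed.

End Schmidt.

(** * Entropies of triangle states *)

Section Converse.
Variable R : realType.
Local Notation C := R[i].

Lemma ptrace1_projector m n (v : 'cV[C]_(m * n)) :
  ptrace1 (projector v) = (unfold_vec v)^T *m ((unfold_vec v)^T)^t*.
Proof.
apply/matrixP => i j; rewrite !mxE; apply: eq_bigr => k _.
by rewrite mxE big_ord1 !adjmxE !mxE.
Qed.

Lemma unfold_vec_sum m n (I : finType) (P : pred I) (s : I -> C) (u : I -> 'cV[C]_m)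
    (v : I -> 'cV[C]_n) :
  unfold_vec (\sum_(i | P i) s i *: tensv (u i) (v i)) = \sum_(i | P i) s i *: (u i *m (v i)^T).
Proof.
apply/matrixP => i j; rewrite mxE !summxE; apply: eq_bigr => k _.
by rewrite [LHS]mxE [RHS]mxE tensvE mxE big_ord1 mxE.
Qed.

Lemma ptrace2_sum m n (I : finType) (P : pred I) (s : I -> C) (M : I -> 'M[C]_(m * n)) :
  ptrace2 (\sum_(i | P i) s i *: M i) = \sum_(i | P i) s i *: ptrace2 (M i).
Proof.
apply/matrixP => i j; rewrite mxE summxE.
under eq_bigr => k _ do rewrite summxE.
rewrite exchange_big; apply: eq_bigr => k _; rewrite !mxE mulr_sumr.
by apply: eq_bigr => o _; rewrite mxE.
Qed.

Lemma ptrace1_sum m n (I : finType) (P : pred I) (s : I -> C) (M : I -> 'M[C]_(m * n)) :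
  ptrace1 (\sum_(i | P i) s i *: M i) = \sum_(i | P i) s i *: ptrace1 (M i).
Proof.
apply/matrixP => i j; rewrite mxE summxE.
under eq_bigr => k _ do rewrite summxE.
rewrite exchange_big; apply: eq_bigr => k _; rewrite !mxE mulr_sumr.
by apply: eq_bigr => o _; rewrite mxE.
Qed.

Lemma realign_sum m n (I : finType) (P : pred I) (s : I -> C) (M : I -> 'M[C]_(m * n)) :
  realign (\sum_(i | P i) s i *: M i) = \sum_(i | P i) s i *: realign (M i).
Proof.
apply/matrixP => i j; rewrite mxE !summxE.
by apply: eq_bigr => o _; rewrite !mxE.
Qed.

Lemma realign_projector_sum a b (I : finType) (P : pred I) (s : I -> R) (u : I -> 'cV[C]_a)
    (v : I -> 'cV[C]_b) :
  realign (projector (\sum_(i | P i) (s i)%:C *: tensv (u i) (v i))) =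
  \sum_(i | P i) \sum_(i' | P i') (s i * s i')%:C *:
    (tensv (u i) (map_mx Num.conj (u i')) *m (tensv (v i) (map_mx Num.conj (v i')))^T).
Proof.
apply/matrixP => h h'; case: (mxtens_indexP h) => i i'; case: (mxtens_indexP h') => k k'.
rewrite realignE mxE big_ord1 adjmxE !summxE rmorph_sum mulr_suml.
apply: eq_bigr => x _; rewrite mulr_sumr summxE; apply: eq_bigr => y _.
rewrite [X in X * _]mxE [X in _ * X^*]mxE !tensvE.
rewrite [RHS]mxE [X in _ = _ * X]mxE big_ord1 [X in _ = _ * (_ * X)]mxE !tensvE.
rewrite ![map_mx _ _ _ _]mxE !rmorphM /= conjC_real; ring.
Qed.

Section Fibers.
Variables (J U V : finType) (ju : U -> J) (jv : V -> J).
Variables (p : J -> R) (f : U -> R) (g : V -> R).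
Hypotheses (p0 : forall j, 0 < p j) (ff : fiber_distribution ju f) (fg : fiber_distribution jv g).

Lemma fiber_orthonormal_pair n (x : U -> V -> 'cV[C]_n) (q q' : U * V) :
  fiber_orthonormal ju jv x -> jv q.2 == ju q.1 -> jv q'.2 == ju q'.1 ->
  (x q.1 q.2)^t* *m x q'.1 q'.2 = (q == q')%:R%:M.
Proof. by case: q q' => [u v] [u' v'] xon /= /eqP uv /eqP uv'; rewrite xon. Qed.

Lemma fiber_gram m n (x : U -> V -> 'cV[C]_m) (y : U -> V -> 'cV[C]_n) :
  fiber_orthonormal ju jv y ->
  let X := \sum_j \sum_(u | ju u == j) \sum_(v | jv v == j)
    (Num.sqrt (p j * (f u * g v)))%:C *: (x u v *m (y u v)^T) in
  X *m X^t* = \sum_j \sum_(u | ju u == j) \sum_(v | jv v == j)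
    (p j * (f u * g v))%:C *: projector (x u v).
Proof.
move=> yon X; rewrite /X !sum_fibers.
rewrite (gram_sum (fun q => Num.sqrt (p (ju q.1) * (f q.1 * g q.2)))
  (fun q => x q.1 q.2) (fun q q' => fiber_orthonormal_pair yon)).
apply: eq_bigr => q _; rewrite sqr_sqrtr //.
by rewrite ltW // !mulr_gt0 //; [apply: ff.1 | apply: fg.1].
Qed.

Lemma fiber_hermfun n (x : U -> V -> 'cV[C]_n) h :
  fiber_orthonormal ju jv x -> h 0 = 0 ->
  hermfun h (\sum_j \sum_(u | ju u == j) \sum_(v | jv v == j)
    (p j * (f u * g v))%:C *: projector (x u v)) =
  \sum_j \sum_(u | ju u == j) \sum_(v | jv v == j)
    (h (p j * (f u * g v)))%:C *: projector (x u v).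
Proof.
move=> xon h0; rewrite !sum_fibers.
by rewrite (hermfun_sum (fun q => p (ju q.1) * (f q.1 * g q.2)) (fun q q' => fiber_orthonormal_pair xon)).
Qed.

(** The chain rule: inside each summand the spectrum is a product distribution, so the entropy is
    that of [p] plus the averaged entropies of the two edges. *)
Lemma fiber_entropy n (x : U -> V -> 'cV[C]_n) :
  fiber_orthonormal ju jv x ->
  entropy (\sum_j \sum_(u | ju u == j) \sum_(v | jv v == j)
    (p j * (f u * g v))%:C *: projector (x u v)) =
  - (\sum_j p j * ln (p j) + \sum_j p j * (\sum_(u | ju u == j) f u * ln (f u)) +
     \sum_j p j * (\sum_(v | jv v == j) g v * ln (g v))).
Proof.
move=> xon; rewrite !sum_fibers.
rewrite (entropy_sum (fun q => p (ju q.1) * (f q.1 * g q.2)) (fun q q' => fiber_orthonormal_pair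
  xon)); congr (- _).
rewrite -(sum_fibers _ _ (fun j u v => p j * (f u * g v) * ln (p j * (f u * g v)))).
rewrite -!big_split; apply: eq_bigr => j _ /=.
transitivity (\sum_(u | ju u == j) (f u * (p j * ln (p j)) + p j * (f u * ln (f u)) +
    f u * (p j * (\sum_(v | jv v == j) g v * ln (g v))))).
  apply: eq_bigr => u _.
  transitivity (\sum_(v | jv v == j) (g v * (f u * (p j * ln (p j)) + p j * (f u * ln (f u))) +
     f u * (p j * (g v * ln (g v))))).
    apply: eq_bigr => v _; have fu := ff.1 u; have gv := fg.1 v; have pj := p0 j.
    by rewrite !lnM ?posrE ?mulr_gt0 //; ring.
  by rewrite big_split /= -mulr_suml fg.2 mul1r -!mulr_sumr.
by rewrite !big_split /= -!mulr_suml ff.2 !mul1r -mulr_sumr.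
Qed.

End Fibers.

Lemma fiber_orthonormal_conj n (J X Z : finType) (jz : Z -> J) (jx : X -> J)
    (al : Z -> X -> 'cV[C]_n) :
  fiber_orthonormal jz jx al -> fiber_orthonormal jz jx (fun z x => map_mx Num.conj (al z x)).
Proof.
move=> oa z x z' x' zx zx'.
have -> : (map_mx Num.conj (al z x))^t* = map_mx Num.conj ((al z x)^t*).
  by apply/matrixP => i j; rewrite !(adjmxE, mxE).
by rewrite -map_mxM oa // map_scalar_mx rmorph_nat.
Qed.

Lemma strong_triangle_gap0 a b c (psi : 'cV[C]_(a * b * c)) :
  strong_triangle psi -> markov_gap (ptrace2 (projector psi) : 'M_(a * b)) = 0.
Proof.
move=> [J [X [Y [Z [jx [jy [jz [p [l [m [n [al [be [ga]]]]]]]]]]]]]].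
move=> [[p0 fl fm fn p1] [oa ob oc psiE]].
set e := edge_vector jx l al be in psiE.
have oe : fiber_orthonormal jy jz (fun y z => e (jy y) y z).
  move=> y z y' z' yz yz'; apply: (edge_vector_dot fl oa ob) => //.
(* Realignment exchanges the roles of the edges: the singular values of the realigned root are
   indexed by two copies [x], [x'] of the edge AB, while the sums over CA and BC are absorbed into
   the singular vectors [E] and [F]. *)
pose E x x' := edge_vector jz n (fun x z => al z x) (fun x z => map_mx Num.conj (al z x)) (jx x) x' x.
pose F x x' := edge_vector jy m (fun x y => be y x) (fun x y => map_mx Num.conj (be y x)) (jx x) x' x.
have oE : fiber_orthonormal jx jx E.
  move=> x x' y y' xx yy; rewrite (edge_vector_dot fn (fiber_orthonormal_sym oa)
    (fiber_orthonormal_sym (fiber_orthonormal_conj oa))) //.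
  by rewrite andbC.
have oF : fiber_orthonormal jx jx F.
  move=> x x' y y' xx yy; rewrite (edge_vector_dot fm (fiber_orthonormal_sym ob)
    (fiber_orthonormal_sym (fiber_orthonormal_conj ob))) //.
  by rewrite andbC.
have rhoE : ptrace2 (projector psi) = \sum_j \sum_(y | jy y == j) \sum_(z | jz z == j)
    (p j * (m y * n z))%:C *: projector (e (jy y) y z) :> 'M_(a * b).
  rewrite ptrace2_projector -(fiber_gram p0 fm fn _ oc) psiE.
  rewrite (_ : unfold_vec _ = \sum_j \sum_(y | jy y == j) \sum_(z | jz z == j)
    (Num.sqrt (p j * (m y * n z)))%:C *: (e (jy y) y z *m (ga y z)^T)) //.
  rewrite [RHS]sum_fibers -unfold_vec_sum sum_fibers.
  done.
have SAB := fiber_entropy p0 fm fn oe; rewrite -rhoE in SAB.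
have edgeE y z : e (jy y) y z = \sum_(x | jx x == jy y) (Num.sqrt (l x))%:C *: tensv (al z x) (be y x) by [].
have SA : ptrace2 (ptrace2 (projector psi)) = \sum_j \sum_(z | jz z == j) \sum_(x | jx x == j)
    (p j * (n z * l x))%:C *: projector (al z x).
  rewrite rhoE sum_fibers ptrace2_sum -(sum_fibers jy jz (fun j y z =>
    (p j * (m y * n z))%:C *: ptrace2 (projector (e (jy y) y z)))).
  apply: eq_bigr => j _; rewrite exchange_big; apply: eq_bigr => z /eqP zj.
  transitivity (\sum_(y | jy y == j) (m y)%:C *:
      \sum_(x | jx x == j) (p j * (n z * l x))%:C *: projector (al z x)); last first.
    by rewrite -scaler_suml -rmorph_sum /= fm.2 scale1r.
  apply: eq_bigr => y /eqP yj; rewrite ptrace2_projector edgeE unfold_vec_sum yj gram_sum.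
    rewrite !scaler_sumr; apply: eq_bigr => x _; rewrite !scalerA -!rmorphM; congr (_%:C *: _).
    by rewrite sqr_sqrtr ?ltW ?fl.1 //; ring.
  by move=> x x' /eqP xj /eqP xj'; rewrite ob ?xj ?xj' // eqxx.
have SB : ptrace1 (ptrace2 (projector psi)) = \sum_j \sum_(y | jy y == j) \sum_(x | jx x == j)
    (p j * (m y * l x))%:C *: projector (be y x).
  rewrite rhoE sum_fibers ptrace1_sum -(sum_fibers jy jz (fun j y z =>
    (p j * (m y * n z))%:C *: ptrace1 (projector (e (jy y) y z)))).
  apply: eq_bigr => j _; apply: eq_bigr => y /eqP yj.
  transitivity (\sum_(z | jz z == j) (n z)%:C *:
      \sum_(x | jx x == j) (p j * (m y * l x))%:C *: projector (be y x)); last first.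
    by rewrite -scaler_suml -rmorph_sum /= fn.2 scale1r.
  apply: eq_bigr => z /eqP zj; rewrite ptrace1_projector edgeE unfold_vec_sum yj.
  rewrite raddf_sum (eq_bigr (fun x => (Num.sqrt (l x))%:C *: (be y x *m (al z x)^T))) /=.
    rewrite gram_sum.
      rewrite !scaler_sumr; apply: eq_bigr => x _; rewrite !scalerA -!rmorphM; congr (_%:C *: _).
      by rewrite sqr_sqrtr ?ltW ?fl.1 //; ring.
    by move=> x x' /eqP xj /eqP xj'; rewrite oa ?xj ?xj' // eqxx.
  by move=> x _; rewrite linearZ /= trmx_mul trmxK.
have SR : realign (sqrtmx (ptrace2 (projector psi))) =
    \sum_j \sum_(x | jx x == j) \sum_(x' | jx x' == j)
      (Num.sqrt (p j * (l x * l x')))%:C *: (E x x' *m (F x x')^T).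
  rewrite rhoE /sqrtmx (fiber_hermfun _ _ _ oe) ?sqrtr0 //.
  rewrite sum_fibers realign_sum -(sum_fibers jy jz (fun j y z =>
    (Num.sqrt (p j * (m y * n z)))%:C *: realign (projector (e (jy y) y z)))).
  apply: eq_bigr => j _.
  transitivity (\sum_(y | jy y == j) \sum_(z | jz z == j) \sum_(x | jx x == j) \sum_(x' | jx x' == j)
    (Num.sqrt (p j * (m y * n z)) * (Num.sqrt (l x) * Num.sqrt (l x')))%:C *:
      (tensv (al z x) (map_mx Num.conj (al z x')) *m (tensv (be y x) (map_mx Num.conj (be y x')))^T)).
    apply: eq_bigr => y /eqP yj; apply: eq_bigr => z /eqP zj.
    rewrite edgeE realign_projector_sum yj scaler_sumr; apply: eq_bigr => x _.
    by rewrite scaler_sumr; apply: eq_bigr => x' _; rewrite scalerA -rmorphM.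
  under eq_bigr => y _ do rewrite exchange_big /=.
  rewrite exchange_big; apply: eq_bigr => x /eqP xj /=.
  under eq_bigr => y _ do rewrite exchange_big /=.
  rewrite exchange_big; apply: eq_bigr => x' /eqP xj' /=.
  rewrite /E /F /edge_vector xj [in RHS]raddf_sum mulmx_sumr scaler_sumr.
  apply: eq_bigr => y _; rewrite mulmx_suml scaler_sumr; apply: eq_bigr => z _.
  rewrite /= [trmx (_ *: _)]linearZ /= -scalemxAl -scalemxAr !scalerA -!rmorphM; congr (_%:C *: _).
  have pj := ltW (p0 j); have lx := ltW (fl.1 x); have my := ltW (fm.1 y); have nz := ltW (fn.1 z).
  by rewrite !sqrtrM //; ring.
rewrite /markov_gap /mutual_information reflected_entropyE SR SA SB.
rewrite (fiber_gram p0 fl fl E oF) (fiber_entropy p0 fl fl oE).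
by rewrite (fiber_entropy p0 fn fl oa) (fiber_entropy p0 fm fl ob) SAB; ring.
Qed.

End Converse.

Local Open Scope complex_scope.

Theorem theorem4 (R : realType) (nA nB nC : nat)
    (psi : 'cV[R[i]]_(nA * nB * nC)) (hpsi : unit_vector psi) :
  sum_of_triangle_states psi <->
  markov_gap (ptrace2 (projector psi) : 'M[R[i]]_(nA * nB)) = 0.
Proof.
split=> [/strong_of_sum_of_triangle_states/strong_triangle_gap0 //|gap0].
apply/sum_of_triangle_states_strong/strong_triangle_of_mixture => //.
apply: triangle_mixture_strong.
by move: gap0; rewrite ptrace2_projector; exact: markov_gap0_mixture.
Qed.
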